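(* Let $k$ be a field of characteristic zero, let $n\geq 5$, let $R=k[x_1,\ldots,x_n]$ be the standard graded polynomial ring, write $w=x_{n-1}$, $u=x_n$, and let $$f=2w^{n-1}u+\sum_{i=1}^{n-2}x_i\,w^{i-1}u^{n-i}\in R.$$ Let $T=k[y_1,\ldots,y_{n-2},s,t]$ be a polynomial ring in $n$ variables. Then: (i) $\mathscr{F}(J_f)\cong T/I_2\begin{bmatrix} y_1&\cdots&y_{n-3}\\ y_2&\cdots&y_{n-2}\end{bmatrix}$ as $k$-algebras. In particular, $\mathscr{F}(J_f)$ is Cohen-Macaulay; (ii) $\ell(J_f)=4$; (iii) ${\rm r}(J_f)=1$; (iv) ${\rm reg}\,{\rm Der}_k(R/(f))=n-2$ (and this also holds when $n=4$, for $f$ defined by the same formula).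
   Context: $J_f=(\partial f/\partial x_1,\ldots,\partial f/\partial x_n)\subset R$ is the Jacobian ideal and $R_+=(x_1,\ldots,x_n)$. For a matrix $N$, $I_2(N)$ is the ideal generated by its $2\times 2$ minors. For a homogeneous proper ideal $I\subset R$: the Rees algebra is $\mathscr{R}(I)=\bigoplus_{i\ge 0}I^it^i\subset R[t]$; the special fiber ring is $\mathscr{F}(I)=\mathscr{R}(I)\otimes_R k\cong\bigoplus_{i\geq 0}I^i/R_+I^i$; the analytic spread is $\ell(I)=\dim\mathscr{F}(I)$. A subideal $K\subset I$ is a reduction of $I$ if $I^{r+1}=KI^r$ for some $r\geq 0$, and ${\rm r}_K(I)$ is the least such $r$; the reduction number ${\rm r}(I)$ is the minimum of ${\rm r}_K(I)$ over all reductions $K$ of $I$ that are minimal with respect to inclusion. Grading of ${\rm Der}_k(R/(f))$: ${\rm Der}_k(R)$ is graded so that each $\partial/\partial x_i$ has degree $-1$; the module $T_{R/k}(f)=\{\theta\in{\rm Der}_k(R):\theta(f)\in(f)\}$ has the induced grading, and ${\rm Der}_k(R/(f))=T_{R/k}(f)/f{\rm Der}_k(R)$ has the quotient grading. For a finitely generated graded $R$-module $E$ with minimal graded free resolution with terms $F_i=\bigoplus_j R(-a_{i,j})$, $0\le i\le p$, the Castelnuovo-Mumford regularity is ${\rm reg}\,E=\max\{a_{i,j}-i\}$.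
   Formalization: Reductions K of J_f, and minimality among them, are taken among homogeneous subideals only; among all subideals of the polynomial ring J_f has no inclusion-minimal reduction, so r(J_f) would be a minimum over the empty set. *)

(* Defs.v *)
From HB Require Import structures.
From mathcomp Require Import all_boot all_order all_algebra.
From mathcomp Require Import boolp classical_sets functions.
From mathcomp Require Import mpoly.

Set Implicit Arguments.
Unset Strict Implicit.
Unset Printing Implicit Defensive.

Import GRing.Theory.
Local Open Scope ring_scope.
Local Open Scope quotient_scope.
Local Open Scope classical_set_scope.

Section Ideals.
Variable A : comPzRingType.
Implicit Types (I K P S : set A) (s : seq A).

Definition is_ideal I : Prop :=
  [/\ I 0, forall x y, I x -> I y -> I (x + y)
         & forall a x, I x -> I (a * x)].

Definition ideal_span S : set A :=
  [set x | exists (m : nat) (c g : 'I_m -> A),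
     (forall i, S (g i)) /\ x = \sum_(i < m) c i * g i].

Definition ideal_mul I K : set A :=
  ideal_span [set x | exists a b, [/\ I a, K b & x = a * b]].

Fixpoint ideal_exp I (i : nat) : set A :=
  if i is j.+1 then ideal_mul I (ideal_exp I j) else setT.

Definition prime_ideal P : Prop :=
  [/\ is_ideal P, ~ P 1 & forall a b, P (a * b) -> P a \/ P b].

Definition maximal_ideal P : Prop :=
  [/\ is_ideal P, ~ P 1
    & forall I, is_ideal I -> ~ I 1 -> P `<=` I -> I = P].

Definition noetherian : Prop :=
  forall I, is_ideal I -> exists s, I = ideal_span [set` s].

(** A chain of length [d] consists of [d + 1] primes. *)
Definition prime_chain S (d : nat) : Prop :=
  exists c : nat -> set A,
    (forall i, (i <= d)%N -> prime_ideal (c i) /\ c i `<=` S) /\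
    (forall i, (i < d)%N -> c i `<` c i.+1).

Definition height P (d : nat) : Prop := prime_chain P d /\ ~ prime_chain P d.+1.

Definition krull_dim (d : nat) : Prop :=
  prime_chain setT d /\ ~ prime_chain setT d.+1.

Definition regular_seq s : Prop :=
  (forall i, (i < size s)%N -> forall b,
     ideal_span [set` take i s] (b * s`_i) -> ideal_span [set` take i s] b) /\
  ~ ideal_span [set` s] 1.

Definition depth P (d : nat) : Prop :=
  (exists s, [/\ [set` s] `<=` P, regular_seq s & size s = d]) /\
  (forall s, [set` s] `<=` P -> regular_seq s -> (size s <= d)%N).

(** Eisenbud, Commutative Algebra, Section 18.2: a Noetherian ring such that
    depth (P, A) = codim P for every maximal ideal P. *)
Definition cohen_macaulay : Prop :=
  noetherian /\ forall P, maximal_ideal P -> exists d, height P d /\ depth P d.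

Lemma ideal_spanP S : is_ideal (ideal_span S).
Proof.
split.
- by exists 0, (fun=> 0), (fun=> 0); split; [case | rewrite big_ord0].
- move=> _ _ [m [c [g [Sg ->]]]] [m' [c' [g' [Sg' ->]]]].
  pose j (T : Type) (a : 'I_m -> T) (a' : 'I_m' -> T) (i : 'I_(m + m')) :=
    match fintype.split i with inl l => a l | inr r => a' r end.
  exists (m + m')%N, (j _ c c'), (j _ g g'); split.
    by move=> i; rewrite /j; case: (fintype.split i).
  rewrite big_split_ord /=; congr (_ + _); apply: eq_bigr => i _; rewrite /j.
    by case: split_ordP => l /eqP; rewrite ?eq_lshift ?eq_lrshift // => /eqP ->.
  by case: split_ordP => l /eqP; rewrite ?eq_rshift ?eq_rlshift // => /eqP ->.
- move=> a _ [m [c [g [Sg ->]]]]; exists m, (fun i => a * c i), g; split=> //.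
  by rewrite mulr_sumr; apply: eq_bigr => i _; rewrite mulrA.
Qed.

Lemma ideal_span_gen S x : S x -> ideal_span S x.
Proof.
by move=> Sx; exists 1%N, (fun=> 1), (fun=> x); rewrite big_ord1 mul1r.
Qed.

Lemma ideal_expP I i : is_ideal (ideal_exp I i).
Proof. by case: i => [|i]; [split | exact: ideal_spanP]. Qed.

Lemma ideal_expM I i j x y :
  ideal_exp I i x -> ideal_exp I j y -> ideal_exp I (i + j) (x * y).
Proof.
elim: i x y => [|i IHi] x y.
  by move=> _ Iy; case: (ideal_expP I j) => _ _; apply.
move=> [m [c [g [Ig ->]]]] Iy; rewrite mulr_suml.
have [I0 ID IM] := ideal_expP I (i.+1 + j).
elim/big_rec: _ => // l z _ Iz; apply: ID => //; rewrite -mulrA; apply: IM.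
have [a [b [Ia Ib ->]]] := Ig l; rewrite -mulrA.
by apply: ideal_span_gen; exists a, (b * y); split=> //; apply: IHi.
Qed.

End Ideals.

Definition ideal_minors2 (A : comPzRingType) (p q : nat) (N : 'M[A]_(p, q)) :
    set A :=
  ideal_span [set x | exists (i1 i2 : 'I_p) (j1 j2 : 'I_q),
    [/\ (i1 < i2)%N, (j1 < j2)%N
      & x = N i1 j1 * N i2 j2 - N i1 j2 * N i2 j1]].

(** [quot_alg S] is the algebra A / (S); it may be the zero ring, hence it is
    a [comPzRingType] and an [lmodType] rather than an [algType]. *)
Section QuotAlg.
Variables (k : comNzRingType) (A : comAlgType k) (S : set A).

Definition ideal_pred : {pred A} := fun x => `[< ideal_span S x >].

Lemma ideal_predE x : (x \in ideal_pred) = `[< ideal_span S x >].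
Proof. by []. Qed.

Lemma ideal_pred_zmod : zmod_closed ideal_pred.
Proof.
have [I0 ID IM] := ideal_spanP S.
split=> [|x y /asboolP Ix /asboolP Iy]; first exact/asboolP.
by apply/asboolP; apply: ID => //; rewrite -mulN1r; apply: IM.
Qed.

HB.instance Definition _ := GRing.isZmodClosed.Build A ideal_pred ideal_pred_zmod.

Lemma ideal_predMl a x : x \in ideal_pred -> a * x \in ideal_pred.
Proof.
by have [_ _ IM] := ideal_spanP S; move=> /asboolP Ix; apply/asboolP/IM.
Qed.

Definition quot_alg : Type := Quotient.quot ideal_pred.

HB.instance Definition _ := GRing.Zmodule.on quot_alg.

Definition quot_pi (x : A) : quot_alg := \pi_(Quotient.quot ideal_pred) x.

Definition quot_repr (x : quot_alg) : A := repr (x : Quotient.quot ideal_pred).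

Lemma quot_reprK : cancel quot_repr quot_pi.
Proof. by move=> x; rewrite /quot_pi reprK. Qed.

Lemma quot_piP x y : reflect (quot_pi x = quot_pi y) (x - y \in ideal_pred).
Proof. by rewrite Quotient.idealrBE; apply: eqP. Qed.

Lemma quot_piD x y : quot_pi (x + y) = quot_pi x + quot_pi y.
Proof. by rewrite /quot_pi !piE. Qed.

Lemma quot_pi_repr x : quot_repr (quot_pi x) - x \in ideal_pred.
Proof. by apply/quot_piP; rewrite quot_reprK. Qed.

Definition quot_mul (x y : quot_alg) : quot_alg :=
  quot_pi (quot_repr x * quot_repr y).

Definition quot_scale (c : k) (x : quot_alg) : quot_alg :=
  quot_pi (c *: quot_repr x).

Lemma quot_piM x y : quot_pi (x * y) = quot_mul (quot_pi x) (quot_pi y).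
Proof.
apply/esym/quot_piP; set x' := quot_repr _; set y' := quot_repr _.
have -> : x' * y' - x * y = y' * (x' - x) + x * (y' - y).
  by rewrite !mulrBr (mulrC y' x') (mulrC y' x) addrA subrK.
by rewrite rpredD // ideal_predMl // quot_pi_repr.
Qed.

Lemma quot_piZ c x : quot_pi (c *: x) = quot_scale c (quot_pi x).
Proof.
apply/esym/quot_piP; rewrite -scalerBr -mulr_algl ideal_predMl //.
exact: quot_pi_repr.
Qed.

Lemma quot_mulA : associative quot_mul.
Proof.
move=> x y z; rewrite -[x]quot_reprK -[y]quot_reprK -[z]quot_reprK.
by rewrite -!quot_piM mulrA.
Qed.

Lemma quot_mulC : commutative quot_mul.
Proof.
by move=> x y; rewrite -[x]quot_reprK -[y]quot_reprK -!quot_piM mulrC.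
Qed.

Lemma quot_mul1 : left_id (quot_pi 1) quot_mul.
Proof. by move=> x; rewrite -[x]quot_reprK -!quot_piM mul1r. Qed.

Lemma quot_mulDl : left_distributive quot_mul +%R.
Proof.
move=> x y z; rewrite -[x]quot_reprK -[y]quot_reprK -[z]quot_reprK.
by rewrite -quot_piD -!quot_piM -quot_piD mulrDl.
Qed.

HB.instance Definition _ := GRing.Zmodule_isComPzRing.Build quot_alg
  quot_mulA quot_mulC quot_mul1 quot_mulDl.

Lemma quot_scaleA a b x : quot_scale a (quot_scale b x) = quot_scale (a * b) x.
Proof. by rewrite -[x]quot_reprK -!quot_piZ scalerA. Qed.

Lemma quot_scale1 : left_id 1 quot_scale.
Proof. by move=> x; rewrite -[x]quot_reprK -!quot_piZ scale1r. Qed.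

Lemma quot_scaleDr : right_distributive quot_scale +%R.
Proof.
move=> a x y; rewrite -[x]quot_reprK -[y]quot_reprK.
by rewrite -quot_piD -!quot_piZ -quot_piD scalerDr.
Qed.

Lemma quot_scaleDl x : {morph quot_scale^~ x : a b / a + b}.
Proof. by move=> a b; rewrite -[x]quot_reprK -!quot_piZ scalerDl quot_piD. Qed.

HB.instance Definition _ := GRing.Zmodule_isLmodule.Build k quot_alg
  quot_scaleA quot_scale1 quot_scaleDr quot_scaleDl.

End QuotAlg.

Definition is_submodule (R : pzRingType) (V : lmodType R) (W : set V) : Prop :=
  [/\ W 0, forall x y, W x -> W y -> W (x + y)
         & forall a x, W x -> W (a *: x)].

Section QuotMod.
Variables (R : pzRingType) (V : lmodType R) (W : set V).
Hypothesis submodW : is_submodule W.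

Definition submod_pred (_ : is_submodule W) : {pred V} := fun x => `[< W x >].
Local Notation Wb := (submod_pred submodW).

Lemma submod_pred_zmod : zmod_closed Wb.
Proof.
have [I0 ID IM] := submodW.
split=> [|x y /asboolP Ix /asboolP Iy]; first exact/asboolP.
by apply/asboolP; apply: ID => //; rewrite -scaleN1r; apply: IM.
Qed.

HB.instance Definition _ := GRing.isZmodClosed.Build V Wb submod_pred_zmod.

Definition quot_mod : Type := Quotient.quot Wb.

HB.instance Definition _ := GRing.Zmodule.on quot_mod.

Definition qmod_pi (x : V) : quot_mod := \pi_(Quotient.quot Wb) x.

Definition qmod_repr (x : quot_mod) : V := repr (x : Quotient.quot Wb).

Lemma qmod_reprK : cancel qmod_repr qmod_pi.
Proof. by move=> x; rewrite /qmod_pi reprK. Qed.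

Lemma qmod_piP x y : reflect (qmod_pi x = qmod_pi y) (x - y \in Wb).
Proof. by rewrite Quotient.idealrBE; apply: eqP. Qed.

Lemma qmod_piD x y : qmod_pi (x + y) = qmod_pi x + qmod_pi y.
Proof. by rewrite /qmod_pi !piE. Qed.

Definition qmod_scale (a : R) (x : quot_mod) : quot_mod :=
  qmod_pi (a *: qmod_repr x).

Lemma qmod_piZ a x : qmod_pi (a *: x) = qmod_scale a (qmod_pi x).
Proof.
apply/esym/qmod_piP; rewrite -scalerBr; have [_ _ IM] := submodW.
by apply/asboolP/IM/asboolP/qmod_piP; rewrite qmod_reprK.
Qed.

Lemma qmod_scaleA a b x : qmod_scale a (qmod_scale b x) = qmod_scale (a * b) x.
Proof. by rewrite -[x]qmod_reprK -!qmod_piZ scalerA. Qed.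

Lemma qmod_scale1 : left_id 1 qmod_scale.
Proof. by move=> x; rewrite -[x]qmod_reprK -!qmod_piZ scale1r. Qed.

Lemma qmod_scaleDr : right_distributive qmod_scale +%R.
Proof.
move=> a x y; rewrite -[x]qmod_reprK -[y]qmod_reprK.
by rewrite -qmod_piD -!qmod_piZ -qmod_piD scalerDr.
Qed.

Lemma qmod_scaleDl x : {morph qmod_scale^~ x : a b / a + b}.
Proof. by move=> a b; rewrite -[x]qmod_reprK -!qmod_piZ scalerDl qmod_piD. Qed.

HB.instance Definition _ := GRing.Zmodule_isLmodule.Build R quot_mod
  qmod_scaleA qmod_scale1 qmod_scaleDr qmod_scaleDl.

End QuotMod.

(** [R_+], the ideal generated by the variables. *)
Definition irrelevant (n : nat) (k : fieldType) : set {mpoly k[n]} :=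
  ideal_span (range (fun i : 'I_n => 'X_i)).

Section Rees.
Variables (n : nat) (k : fieldType) (I : set {mpoly k[n]}).
Local Notation R := {mpoly k[n]}.

Definition rees_pred : {pred {poly R}} :=
  fun p : {poly R} => `[< forall i, ideal_exp I i p`_i >].

Lemma rees_predP (p : {poly R}) : reflect (forall i, ideal_exp I i p`_i) (p \in rees_pred).
Proof. exact: asboolP. Qed.

Lemma rees_pred_subring : subring_closed rees_pred.
Proof.
split.
- apply/rees_predP => -[|i] //; rewrite coef1 /=.
  by case: (ideal_expP I i.+1).
- move=> p q /rees_predP Ip /rees_predP Iq; apply/rees_predP => i.
  have [_ ID IM] := ideal_expP I i.
  by rewrite coefB; apply: ID => //; rewrite -mulN1r; apply: IM.
- move=> p q /rees_predP Ip /rees_predP Iq; apply/rees_predP => i.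
  have [I0 ID _] := ideal_expP I i.
  rewrite coefM; elim/big_rec: _ => // j z _ Iz; apply: ID => //.
  by have := ideal_expM (Ip j) (Iq (i - j)%N); rewrite subnKC // -ltnS.
Qed.

HB.instance Definition _ := GRing.isSubringClosed.Build {poly R} rees_pred
  rees_pred_subring.

(** The Rees algebra: the [p] in R[t] whose coefficient of t^i is in I^i. *)
Record rees : Type := Rees { rees_val :> {poly R}; _ : rees_val \in rees_pred }.

HB.instance Definition _ := [isSub for rees_val].
HB.instance Definition _ := [Choice of rees by <:].
HB.instance Definition _ := [SubChoice_isSubComNzRing of rees by <:].

Fact rees_const_subproof (c : k) : (c%:MP)%:P \in rees_pred.
Proof.
by apply/rees_predP => -[|i] //; rewrite coefC /=; case: (ideal_expP I i.+1).
Qed.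

Definition rees_const (c : k) : rees := Rees (rees_const_subproof c).

Definition rees_scale (c : k) (p : rees) : rees := rees_const c * p.

Lemma rees_scaleA a b x : rees_scale a (rees_scale b x) = rees_scale (a * b) x.
Proof.
by rewrite /rees_scale mulrA; congr (_ * _); apply/val_inj; rewrite /= !rmorphM.
Qed.

Lemma rees_scale1 : left_id 1 rees_scale.
Proof.
move=> x; rewrite /rees_scale -[RHS]mul1r; congr (_ * _).
by apply/val_inj; rewrite /= !rmorph1.
Qed.

Lemma rees_scaleDr : right_distributive rees_scale +%R.
Proof. by move=> a x y; rewrite /rees_scale mulrDr. Qed.

Lemma rees_scaleDl x : {morph rees_scale^~ x : a b / a + b}.
Proof.
move=> a b; rewrite /rees_scale -mulrDl; congr (_ * _).
by apply/val_inj; rewrite /= !rmorphD.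
Qed.

HB.instance Definition _ := GRing.Zmodule_isLmodule.Build k rees
  rees_scaleA rees_scale1 rees_scaleDr rees_scaleDl.

Lemma rees_scaleAl a (x y : rees) : a *: (x * y) = (a *: x) * y.
Proof. exact: mulrA. Qed.

HB.instance Definition _ := GRing.Lmodule_isLalgebra.Build k rees rees_scaleAl.
HB.instance Definition _ := GRing.Lalgebra_isComAlgebra.Build k rees.

(** [Rees(I) / R_+ Rees(I)] *)
Definition special_fiber : Type :=
  @quot_alg k rees
    [set p : rees | exists2 a : R, irrelevant a & rees_val p = a%:P].

HB.instance Definition _ := GRing.ComPzRing.on special_fiber.
HB.instance Definition _ := GRing.Lmodule.on special_fiber.

Definition analytic_spread (l : nat) : Prop := krull_dim special_fiber l.

End Rees.

Section Reductions.
Variables (n : nat) (k : fieldType).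
Implicit Types I K L : set {mpoly k[n]}.

Definition homogeneous_ideal I : Prop :=
  is_ideal I /\ forall (d : nat) p, I p -> I (pihomog mdeg d p).

(** Reductions are taken in the graded category. Since [R] is not local, an
    ideal may have no reduction that is inclusion-minimal among all, possibly
    inhomogeneous, reductions. *)
Definition reduction K I : Prop :=
  [/\ homogeneous_ideal K, K `<=` I
    & exists r, ideal_exp I r.+1 = ideal_mul K (ideal_exp I r)].

Definition minimal_reduction K I : Prop :=
  reduction K I /\ forall L, reduction L I -> L `<=` K -> L = K.

Definition reduction_number_wrt K I (r : nat) : Prop :=
  ideal_exp I r.+1 = ideal_mul K (ideal_exp I r) /\
  forall s, ideal_exp I s.+1 = ideal_mul K (ideal_exp I s) -> (r <= s)%N.

Definition reduction_number I (r : nat) : Prop :=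
  (exists2 K, minimal_reduction K I & reduction_number_wrt K I r) /\
  (forall K s, minimal_reduction K I -> reduction_number_wrt K I s ->
     (r <= s)%N).

End Reductions.

Section Regularity.
Variables (n : nat) (k : fieldType).
Local Notation R := {mpoly k[n]}.

Definition homogeneous_deg (d : int) (p : R) : Prop :=
  if d is Posz m then p \is m.-homog else p = 0.

Variables (E : lmodType R) (gr : int -> set E).

(** [F_i] is the free module of row vectors ['rV[R]_(fr_rank i)], its j-th basis
    vector having degree [fr_shift i j]; the differential [F_(i+1) -> F_i] is
    right multiplication by [fr_diff i]. *)
Record min_free_res := MinFreeRes {
  fr_length : nat;
  fr_rank : nat -> nat;
  fr_shift : forall i, 'I_(fr_rank i) -> int;
  fr_aug : 'I_(fr_rank 0) -> E;
  fr_diff : forall i, 'M[R]_(fr_rank i.+1, fr_rank i);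
  fr_finite : forall i, (fr_length < i)%N -> fr_rank i = 0%N;
  fr_aug_homog : forall j, gr (fr_shift j) (fr_aug j);
  fr_diff_homog : forall i j l,
    homogeneous_deg (fr_shift j - fr_shift l) (fr_diff i j l);
  fr_minimal : forall i j l, irrelevant (fr_diff i j l);
  fr_aug_surj : forall e : E,
    exists c : 'rV[R]_(fr_rank 0), e = \sum_j c 0 j *: fr_aug j;
  fr_exact0 : forall c : 'rV[R]_(fr_rank 0),
    \sum_j c 0 j *: fr_aug j = 0 <-> exists b, c = b *m fr_diff 0;
  fr_exactS : forall i (c : 'rV[R]_(fr_rank i.+1)),
    c *m fr_diff i = 0 <-> exists b, c = b *m fr_diff i.+1
}.

Definition regularity (r : int) : Prop :=
  exists F : min_free_res,
    (exists i (j : 'I_(fr_rank F i)), fr_shift j - i%:Z = r) /\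
    (forall i (j : 'I_(fr_rank F i)), (fr_shift j - i%:Z <= r)%R).

End Regularity.

Section Derivations.
Variables (n : nat) (k : fieldType).
Local Notation R := {mpoly k[n]}.

Definition is_derivation (th : R -> R) : Prop :=
  (forall (c : k) p q, th (c *: p + q) = c *: th p + th q) /\
  (forall p q, th (p * q) = p * th q + q * th p).

(** The codomain is [R^o] so that functions form a module over [R], not [k]. *)
Definition der_pred : {pred (R -> R^o)} := fun th => `[< is_derivation th >].

Lemma der_pred_submod : submod_closed der_pred.
Proof.
split.
  by apply/asboolP; split=> [c p q|p q]; rewrite /= ?scaler0 ?mulr0 addr0.
move=> a x y /asboolP[xl xM] /asboolP[yl yM]; apply/asboolP.
have E (p : R) : (a *: x + y) p = a * x p + y p by [].
split=> [c p q|p q]; rewrite !E.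
  by rewrite xl yl mulrDr scalerDr -!scalerAr addrACA.
rewrite xM yM !mulrDr !addrA; congr (_ + _).
by rewrite (mulrCA a p) (mulrCA a q) -!addrA; congr (_ + _); rewrite addrC.
Qed.

HB.instance Definition _ := GRing.isSubmodClosed.Build R (R -> R^o) der_pred
  der_pred_submod.

Record der : Type := Der { der_val : R -> R^o; _ : der_val \in der_pred }.

HB.instance Definition _ := [isSub for der_val].
HB.instance Definition _ := [Choice of der by <:].
HB.instance Definition _ := [SubChoice_isSubLmodule of der by <:].

(** [d/dx_i] has degree -1. *)
Definition der_homog (d : int) (th : der) : Prop :=
  exists g : 'I_n -> R,
    (forall i, homogeneous_deg (d + 1) (g i)) /\
    (forall p, der_val th p = \sum_i g i * p^`M(i)).

Variable f : R.

Definition logder_pred : {pred der} :=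
  fun th => `[< ideal_span [set f] (der_val th f) >].

Lemma logder_pred_submod : submod_closed logder_pred.
Proof.
have [I0 ID IM] := ideal_spanP [set f].
split; first exact/asboolP.
move=> a x y /asboolP Ix /asboolP Iy; apply/asboolP.
by rewrite [der_val _ f]/(a * der_val x f + der_val y f); apply/ID/Iy/IM.
Qed.

HB.instance Definition _ := GRing.isSubmodClosed.Build R der logder_pred
  logder_pred_submod.

(** [T_{R/k}(f)] *)
Record logder : Type :=
  LogDer { logder_val : der; _ : logder_val \in logder_pred }.

HB.instance Definition _ := [isSub for logder_val].
HB.instance Definition _ := [Choice of logder by <:].
HB.instance Definition _ := [SubChoice_isSubLmodule of logder by <:].

Definition fder : set logder :=
  [set th | exists eta : der, logder_val th = f *: eta].

Lemma fder_submod : is_submodule fder.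
Proof.
split.
- by exists 0; rewrite scaler0.
- by move=> x y [e1 E1] [e2 E2]; exists (e1 + e2); rewrite scalerDr -E1 -E2.
- move=> a x [e E]; exists (a *: e).
  by rewrite scalerA mulrC -scalerA -E.
Qed.

(** [T_{R/k}(f) / f Der_k(R)] *)
Definition der_hypersurface : Type := quot_mod fder_submod.

HB.instance Definition _ := GRing.Lmodule.on der_hypersurface.

Definition der_hypersurface_gr (d : int) : set der_hypersurface :=
  [set e | exists2 th : logder, der_homog d (logder_val th)
         & e = qmod_pi fder_submod th].

Definition jacobian_ideal : set R :=
  ideal_span (range (fun i : 'I_n => f^`M(i))).

End Derivations.

(** [xvar k n i] is x_i for [1 <= i <= n] (variables are numbered from 1), and 0
    otherwise. *)
Definition xvar (k : fieldType) (n i : nat) : {mpoly k[n]} :=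
  if insub i.-1 is Some j then 'X_(j : 'I_n) else 0.

Definition form_f (k : fieldType) (n : nat) : {mpoly k[n]} :=
  let x := xvar k n in
  let w := x n.-1 in
  let u := x n in
  2%:R * w ^+ n.-1 * u
  + \sum_(1 <= i < n.-1) x i * w ^+ i.-1 * u ^+ (n - i).

(** y_1, ..., y_(n-2), s, t are the variables x_1, ..., x_n in this order; the
    column index [j] starts at 0. *)
Definition scroll_matrix (k : fieldType) (n : nat) : 'M[{mpoly k[n]}]_(2, n - 3) :=
  \matrix_(i, j) xvar k n (i + j).+1.

Definition scroll_alg (k : fieldType) (n : nat) : Type :=
  @quot_alg k {mpoly k[n]} (ideal_minors2 (scroll_matrix k n)).

HB.instance Definition _ (k : fieldType) (n : nat) :=
  GRing.ComPzRing.on (scroll_alg k n).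
HB.instance Definition _ (k : fieldType) (n : nat) :=
  GRing.Lmodule.on (scroll_alg k n).

(* Main.v *)
Require Import Defs.
From HB Require Import structures.
From mathcomp Require Import all_boot all_order all_algebra.
From mathcomp Require Import boolp classical_sets functions.
From mathcomp Require Import ssrcomplements mpoly.
From mathcomp Require Import ring zify.
Import GRing.Theory.
Local Open Scope ring_scope.

Set Implicit Arguments.
Unset Strict Implicit.
Unset Printing Implicit Defensive.
Local Open Scope classical_set_scope.

(** Write n = m + 3 and number the variables from 0, so that w and u have the
    indices m + 1 and m + 2. The partial derivatives of f are the forms
    w^j u^(n-1-j) for j <= m, f_w and f_u, all of degree n - 1.

    As J is generated by forms of one degree, its special fiber ring A is the ring
    of polynomials in these forms ([fiber_map_ker]). A substitution turns them, up
    to a common factor, into a^(m-j) b^j, s and t ([unproj_map_grad]), whose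
    relations are therefore the only possible ones; they are generated by the
    2 x 2 minors of the matrix of the y_j, because every monomial can be
    straightened to a normal form determined by its image ([scroll_ker]), and the
    minors also vanish at the w^j u^(n-1-j). So A is the coordinate ring of the
    scroll.

    For dimension and depth, A is seen as the subring of
    S = k[a, b, s, t] spanned by the monomials whose degree in a and b is divisible
    by m, so that A is a direct summand of S as an A-module. A maximal ideal of A
    contains, for each of y_0, y_m, s, t, a nonzero polynomial in that element
    ([residue_algebraic]); in S these are polynomials in a, b, s and t respectively,
    so they form a regular sequence in S, and in A by the retraction. A regular
    sequence of length 4 in a prime yields a chain of 4 strict inclusions of primes
    below it ([regular_prime_chain]), while any 5 elements of A are algebraically
    dependent, which bounds chains of primes and regular sequences ([chain_indep]).
    Hence the depth and the height of every maximal ideal are 4 ([cohen_macaulay_dim]).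

    The ideal K generated by f_0, f_m, f_w, f_u is a reduction with J^2 = K J, as
    f_i f_j depends only on i + j for i, j <= m ([par_ideal_reduction]). It is
    minimal ([minimal_par_ideal]): a smaller homogeneous ideal L would lose a linear
    form, and a linear functional on S shows that L J^r is then never J^(r+1).
    A minimal reduction with reduction number 0 would contain J and so K, hence be
    K, but f_1 is not in K since m > 1.

    For the regularity, the derivations preserving (f) are free on n derivations
    of degree 0: Euler's and n - 1 linear syzygies of the partial derivatives, in
    triangular form ([log_span], [log_mx_free]). The quotient by f Der(R), which is
    free on generators of degree n - 1, therefore has the minimal resolution
    0 -> R(-(n-1))^n -> R^n and regularity n - 2 ([der_hypersurface_regularity]). *)

(** * Prime and maximal ideals *)

Section PrimeIdeals.
Variable A : comPzRingType.
Implicit Types (I K P Q M : set A) (s : seq A).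

Lemma ideal_mull I a x : is_ideal I -> I x -> I (a * x).
Proof. by case=> _ _; apply. Qed.

Lemma ideal_mulr I a x : is_ideal I -> I x -> I (x * a).
Proof. by rewrite mulrC; apply: ideal_mull. Qed.

Lemma idealD I x y : is_ideal I -> I x -> I y -> I (x + y).
Proof. by case=> _ h _; apply: h. Qed.

Lemma idealB I x y : is_ideal I -> I x -> I y -> I (x - y).
Proof. by move=> hI Ix Iy; apply: idealD => //; rewrite -mulN1r; apply: ideal_mull. Qed.

Lemma ideal0 I : is_ideal I -> I 0.
Proof. by case. Qed.

Lemma idealDl I x y : is_ideal I -> I x -> I (x + y) -> I y.
Proof. by move=> hI Ix Ixy; rewrite -[y](addKr x) addrC; apply: idealB. Qed.

Lemma ideal_sum I (J : Type) (r : seq J) (p : pred J) (F : J -> A) :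
  is_ideal I -> (forall j, p j -> I (F j)) -> I (\sum_(j <- r | p j) F j).
Proof.
move=> hI IF; elim/big_rec: _ => [|j x pj Ix]; first exact: ideal0.
by apply: idealD => //; apply: IF.
Qed.

Lemma ideal_span_sub (S : set A) I : is_ideal I -> S `<=` I -> ideal_span S `<=` I.
Proof.
move=> hI SI _ [m [c [g [Sg ->]]]].
by apply: ideal_sum => // i _; apply: ideal_mull => //; apply: SI.
Qed.

Lemma ideal_span_mono (S S' : set A) : S `<=` S' -> ideal_span S `<=` ideal_span S'.
Proof.
move=> SS'; apply: ideal_span_sub; first exact: ideal_spanP.
by move=> x /SS'; apply: ideal_span_gen.
Qed.

Lemma ideal_zero : is_ideal [set 0 : A].
Proof. by split=> [//|x y -> ->|a x ->] /=; rewrite ?addr0 ?mulr0. Qed.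

Lemma span_seqP s x :
  ideal_span [set` s] x <->
  exists c : nat -> A, x = \sum_(i < size s) c i * s`_i.
Proof.
split=> [|[c ->]]; last first.
  apply: ideal_sum => [|i _]; first exact: ideal_spanP.
  apply: ideal_mull; first exact: ideal_spanP.
  by apply: ideal_span_gen => /=; apply: mem_nth.
pose K := [set x | exists c : nat -> A, x = \sum_(i < size s) c i * s`_i].
apply: (@ideal_span_sub _ K) => [|y /= ys].
  split.
  - by exists (fun=> 0); rewrite big1 // => i _; rewrite mul0r.
  - move=> _ _ [c ->] [d ->]; exists (fun i => c i + d i).
    by rewrite -big_split /=; apply: eq_bigr => i _; rewrite mulrDl.
  - move=> a _ [c ->]; exists (fun i => a * c i).
    by rewrite mulr_sumr; apply: eq_bigr => i _; rewrite mulrA.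
exists (fun i => (i == index y s)%:R).
have hi : (index y s < size s)%N by rewrite index_mem.
rewrite (bigD1 (Ordinal hi)) //= eqxx mul1r nth_index // big1 ?addr0 // => i ne.
by case: eqP => [e|_]; [case/eqP: ne; apply: val_inj | rewrite mul0r].
Qed.

Lemma span_seq0 : ideal_span [set` [::] : seq A] = [set 0].
Proof.
rewrite eqEsubset; split=> [x /span_seqP [c ->]|x ->].
  by rewrite /= big_ord0.
exact: ideal0 (ideal_spanP _).
Qed.

Definition ideal_adjoin Q a := [set x | exists q c, Q q /\ x = q + c * a].

Lemma ideal_adjoinP Q a : is_ideal Q ->
  [/\ is_ideal (ideal_adjoin Q a), Q `<=` ideal_adjoin Q a & ideal_adjoin Q a a].
Proof.
move=> hQ; split.
- split.
  + by exists 0, 0; split; [apply: ideal0|rewrite mul0r addr0].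
  + move=> _ _ [q [c [Qq ->]]] [q' [c' [Qq' ->]]].
    exists (q + q'), (c + c'); split; first exact: idealD.
    by rewrite mulrDl addrACA.
  + move=> b _ [q [c [Qq ->]]]; exists (b * q), (b * c).
    by split; [apply: ideal_mull|rewrite mulrDr mulrA].
- by move=> x Qx; exists x, 0; rewrite mul0r addr0.
- by exists 0, 1; rewrite mul1r add0r; split=> //; apply: ideal0.
Qed.

(** Take Q maximal among the ideals that contain I and miss M. If a and b are
    outside Q, then Q + (a) and Q + (b) meet M; the product of the two elements
    found is in M and, if a b were in Q, also in Q. *)
Lemma prime_avoiding I M :
  is_ideal I -> M 1 -> (forall x y, M x -> M y -> M (x * y)) ->
  (forall x, I x -> ~ M x) ->
  exists Q, [/\ prime_ideal Q, I `<=` Q, forall x, Q x -> ~ M x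
    & forall K, is_ideal K -> Q `<=` K -> (forall x, K x -> ~ M x) -> K = Q].
Proof.
move=> hI M1 MM IM.
pose good X := [/\ is_ideal X, I `<=` X & forall x, X x -> ~ M x].
(* the empty set is admitted as a bound for the empty chain *)
pose P X := X = set0 \/ good X.
have [|Q [PQ Qmax]] := @Zorn_bigcup A P.
  move=> F FP tot.
  have [[X0 FX0 [x0 X0x0]]|nF] :=
      pselect (exists2 X, F X & exists x, X x); last first.
    left; rewrite eqEsubset; split=> // x [X FX Xx]; case: nF.
    by exists X => //; exists x.
  have gd X x : F X -> X x -> good X.
    by move=> FX Xx; case: (FP _ FX) => // Xe; rewrite Xe in Xx.
  have [hX0 IX0 _] := gd _ _ FX0 X0x0.
  right; split.
  - split.
    + by exists X0 => //; apply: ideal0.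
    + move=> x y [X FX Xx] [Y FY Yy].
      case: (tot X Y FX FY) => sub.
        by exists Y => //; case: (gd _ _ FY Yy) => [hY _ _]; apply: idealD => //; apply: sub.
      by exists X => //; case: (gd _ _ FX Xx) => [hX _ _]; apply: idealD => //; apply: sub.
    + move=> a x [X FX Xx]; exists X => //.
      by case: (gd _ _ FX Xx) => [hX _ _]; apply: ideal_mull.
  - by move=> x /IX0 X0x; exists X0.
  - by move=> x [X FX Xx]; case: (gd _ _ FX Xx) => [_ _]; apply.
have gI : good I by split.
have [hQ IQ QM] : good Q.
  case: PQ => // Q0; exfalso; apply: (Qmax I); last by right.
  rewrite Q0; split=> // /(_ 0 (ideal0 hI)) //.
have Qmax' K : is_ideal K -> Q `<=` K -> (forall x, K x -> ~ M x) -> K = Q.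
  move=> hK QK KM; apply: contrapT => ne; apply: (Qmax K).
    by split=> // KQ; apply: ne; rewrite eqEsubset; split.
  by right; split=> // x /IQ /QK.
exists Q; split=> //; split=> //.
  by move=> Q1; apply: (QM 1).
(* if a is not in Q, the ideal Q + (a) is larger and hence meets M *)
have ext a : ~ Q a -> exists q c, Q q /\ M (q + c * a).
  move=> nQa; apply: contrapT => no; have [hK QK Ka] := ideal_adjoinP a hQ.
  apply: nQa; rewrite -(Qmax' _ hK QK) // => _ [q [c [Qq ->]]] Mx.
  by apply: no; exists q, c.
move=> a b Qab; apply: contrapT => nab.
have [|q [c [Qq Ma]]] := ext a; first by move=> Qa; apply: nab; left.
have [|r [d [Qr Mb]]] := ext b; first by move=> Qb; apply: nab; right.
apply: (QM _ _ (MM _ _ Ma Mb)).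
rewrite mulrDl !mulrDr; apply: idealD => //; first by apply: idealD => //; apply: ideal_mulr.
apply: idealD => //; first exact: ideal_mull.
by rewrite mulrACA; apply: ideal_mull.
Qed.

Lemma exists_maximal I : is_ideal I -> ~ I 1 -> exists2 Q, maximal_ideal Q & I `<=` Q.
Proof.
move=> hI nI.
have [||x Ix x1|Q [[hQ Q1 _] IQ _ Qm]] := @prime_avoiding I [set 1] hI => //.
- by move=> x y -> ->; rewrite /= mulr1.
- by rewrite x1 in Ix.
exists Q => //; split=> // K hK K1 QK; apply: Qm => // x Kx x1; apply: K1.
by rewrite -x1.
Qed.

Lemma maximal_prime Q : maximal_ideal Q -> prime_ideal Q.
Proof.
case=> hQ Q1 Qm.
have [||x Qx x1|P [prP QP _ _]] := @prime_avoiding Q [set 1] hQ => //.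
- by move=> x y -> ->; rewrite /= mulr1.
- by rewrite x1 in Qx.
suff <- : P = Q by [].
by case: prP => hP P1 _; apply: Qm.
Qed.

Lemma maximal_inv Q z : maximal_ideal Q -> ~ Q z -> exists c, Q (1 - c * z).
Proof.
case=> hQ Q1 Qm nQz; apply: contrapT => no; have [hK QK Kz] := ideal_adjoinP z hQ.
apply: nQz; rewrite -(Qm _ hK _ QK) // => -[q [c [Qq e]]].
by apply: no; exists c; rewrite e addrK.
Qed.

End PrimeIdeals.

Section Preimages.
Variables (A B : comPzRingType) (phi : {rmorphism A -> B}).
Implicit Types I P : set B.

Lemma ideal_preimage I : is_ideal I -> is_ideal [set x | I (phi x)].
Proof.
move=> hI; split=> [|x y|a x]; rewrite /= ?rmorph0 ?rmorphD ?rmorphM.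
- exact: ideal0.
- exact: idealD.
- exact: ideal_mull.
Qed.

Lemma prime_preimage P : prime_ideal P -> prime_ideal [set x | P (phi x)].
Proof.
case=> hP P1 pP; split; first exact: ideal_preimage.
  by rewrite /= rmorph1.
by move=> a b; rewrite /= rmorphM => /pP.
Qed.

Lemma maximal_preimage P : (forall b, exists a, phi a = b) ->
  maximal_ideal P -> maximal_ideal [set x | P (phi x)].
Proof.
move=> onto [hP P1 Pm]; split; [exact: ideal_preimage|by rewrite /= rmorph1|].
move=> K hK K1 PK; rewrite eqEsubset; split=> // x Kx.
have kerK y : phi y = 0 -> K y by move=> y0; apply: PK; rewrite /= y0; apply: ideal0.
suff <- : [set b | exists2 a, K a & phi a = b] = P by exists x.
apply: Pm.
- split=> [|_ _ [a Ka <-] [b Kb <-]|c _ [a Ka <-]].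
  + by exists 0; [apply: ideal0|rewrite rmorph0].
  + by exists (a + b); [apply: idealD|rewrite rmorphD].
  + have [d <-] := onto c; by exists (d * a); [apply: ideal_mull|rewrite rmorphM].
- case=> a Ka ea; apply: K1; rewrite -(subrK a 1); apply: idealD => //.
  by apply: kerK; rewrite rmorphB rmorph1 ea subrr.
- by move=> b; have [a <-] := onto b => Pa; exists a => //; apply: PK.
Qed.

End Preimages.

(** * Dimension and depth from algebraic relations *)

Section Relations.
Variables (k : fieldType) (A : comPzRingType) (iota : {rmorphism k -> A}).
Implicit Types (c : seq nat -> k) (xs : seq A).

(** The value at [xs] of the polynomial with all exponents below [N] and
    coefficients [c], in Horner-like nested form so that the first variable can
    be split off. *)
Fixpoint evs (N : nat) xs c : A :=
  if xs is x :: xs' then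
    \sum_(i < N) x ^+ i * evs N xs' (fun e => c (val i :: e))
  else iota (c [::]).

Lemma evs0 N xs c :
  (forall e, size e = size xs -> all (ltn^~ N) e -> c e = 0) -> evs N xs c = 0.
Proof.
elim: xs c => [|x xs IH] c c0 /=; first by rewrite c0 // rmorph0.
rewrite big1 // => i _; rewrite IH ?mulr0 // => e se ae.
by apply: c0; rewrite /= ?se ?ltn_ord.
Qed.

Definition alg_dependent (d : nat) := forall xs, size xs = d ->
  exists N c e, [/\ evs N xs c = 0, size e = d, all (ltn^~ N) e & c e != 0].

(** Both a regular sequence and a choice of elements x_i in P_(i+1) but not in
    P_i along a chain of primes give the hypotheses of this lemma. The constant
    term in x_0 of a relation modulo I_0 is a relation among x_1, x_2, ...
    modulo I_1, hence vanishes by induction; then x_0 can be cancelled. *)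
Lemma chain_indep N xs (I : nat -> set A) c :
  (forall j, (j <= size xs)%N -> is_ideal (I j)) ->
  (forall j, (j < size xs)%N -> [/\ I j `<=` I j.+1, I j.+1 xs`_j
      & forall b, I j (b * xs`_j) -> I j b]) ->
  ~ I (size xs) 1 -> I 0%N (evs N xs c) ->
  forall e, size e = size xs -> all (ltn^~ N) e -> c e = 0.
Proof.
elim: xs I c => [|x xs IH] I c hI hreg n1 /=.
  move=> I0 [] // _ _; apply/eqP; apply: contra_notT n1 => c0.
  rewrite /= -(rmorph1 iota) -(mulVf c0) rmorphM.
  by apply: ideal_mull => //; apply: hI.
have [I01 Ix reg] := hreg 0%N isT; rewrite /= in Ix reg.
have {}IH c' : I 1%N (evs N xs c') ->
    forall e, size e = size xs -> all (ltn^~ N) e -> c' e = 0.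
  apply: (IH (fun j => I j.+1)) => // [j lj|j lj]; first exact: hI.
  exact: (hreg j.+1).
have hI0 := hI 0%N isT; have hI1 := hI 1%N isT.
suff H M (E : nat -> seq nat -> k) :
    I 0%N (\sum_(i < M) x ^+ i * evs N xs (E i)) ->
    forall i, (i < M)%N -> forall e, size e = size xs -> all (ltn^~ N) e -> E i e = 0.
  move/(H N (fun i e => c (i :: e))) => {}H [|i e] //= [se] /andP[li ae].
  exact: H.
elim: M E => [|M IHM] E //.
rewrite big_ord_recl expr0 mul1r.
under eq_bigr => i _ do rewrite exprSr mulrAC.
rewrite -mulr_suml => H.
have E0 : forall e, size e = size xs -> all (ltn^~ N) e -> E 0%N e = 0.
  apply: IH; move/I01: H; rewrite addrC; apply: idealDl => //; exact: ideal_mull.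
move: H; rewrite evs0 // add0r => /reg H [|i] // /(IHM (fun i => E i.+1) H).
exact.
Qed.

Variable d : nat.
Hypothesis dep : alg_dependent d.+1.

Lemma no_long_chain (S : set A) : ~ prime_chain S d.+1.
Proof.
case=> c [cP cS].
have /choice [x xP] : forall i, exists y, (i < d.+1)%N -> c i.+1 y /\ ~ c i y.
  move=> i; have [lt|//] := boolP (i < d.+1)%N; last by exists 0.
  have [_ ns] := cS i lt; apply: contrapT => no; apply: ns => y cy.
  by apply: contrapT => ny; apply: no; exists y.
have sz : size (mkseq x d.+1) = d.+1 by rewrite size_mkseq.
have [N [a [e [a0 se ae]]]] := dep sz; case/eqP.
have pr i : (i <= d.+1)%N -> prime_ideal (c i) by move=> /cP [].
apply: (@chain_indep N (mkseq x d.+1) c) => //; rewrite ?sz //.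
- by move=> j /pr [].
- move=> j lt; rewrite nth_mkseq //; have [xj nxj] := xP j lt; split=> //.
    by case: (cS j lt).
  by have [_ _ pj] := pr j (ltnW lt); move=> b /pj [].
- by have [_] := pr d.+1 (leqnn _).
- by rewrite a0; have [/ideal0] := pr 0%N isT.
Qed.

Lemma no_long_regular (s : seq A) : regular_seq s -> (size s <= d)%N.
Proof.
case=> reg n1; rewrite leqNgt; apply/negP => lt.
have sz : size (take d.+1 s) = d.+1 by rewrite size_takel.
have [N [a [e [a0 se ae]]]] := dep sz; case/eqP.
apply: (@chain_indep N (take d.+1 s) (fun j => ideal_span [set` take j s])) => //;
  rewrite ?sz //.
- by move=> j _; apply: ideal_spanP.
- move=> j ltj; rewrite nth_take //; have js := leq_trans ltj lt; split.
  + apply: ideal_span_mono => y /=.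
    by rewrite (take_nth 0 js) mem_rcons inE orbC => ->.
  + by apply: ideal_span_gen; rewrite /= (take_nth 0 js) mem_rcons mem_head.
  + exact: reg.
- by apply: contra_not n1; apply: ideal_span_mono => y /= /mem_take.
- by rewrite a0; apply: ideal0; apply: ideal_spanP.
Qed.

End Relations.

Section RegularSequences.
Variable A : comPzRingType.

(** The other half of regularity, that the ideal be proper, is automatic for a
    sequence in a maximal ideal. *)
Definition weakly_regular (s : seq A) := forall i, (i < size s)%N -> forall b,
  ideal_span [set` take i s] (b * s`_i) -> ideal_span [set` take i s] b.

(** If s_0, ..., s_i lie in the prime P, then (s_0, ..., s_(i-1)) misses the
    multiplicative set of the t * s_i^j with t outside P; a prime Q avoiding
    that set lies strictly below P. *)
Lemma regular_prime_chain (s : seq A) (P : set A) :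
  weakly_regular s -> prime_ideal P -> [set` s] `<=` P -> prime_chain P (size s).
Proof.
move=> reg prP sP.
suff H i Q : (i <= size s)%N -> prime_ideal Q -> ideal_span [set` take i s] `<=` Q ->
    prime_chain Q i.
  apply: H => //; rewrite take_size; apply: ideal_span_sub sP; by case: prP.
elim: i Q {prP sP P} => [|i IH] P.
  by move=> _ prP _; exists (fun=> P); split=> // i _; split=> // x.
move=> lti prP sP; have [hP P1 pP] := prP.
pose M := [set x | exists t j, ~ P t /\ x = t * s`_i ^+ j].
have Psi : P s`_i.
  by apply/sP/ideal_span_gen; rewrite /= (take_nth 0 lti) mem_rcons mem_head.
have sub : ideal_span [set` take i s] `<=` P.
  apply: (subset_trans _ sP); apply: ideal_span_mono => y /=.
  by rewrite (take_nth 0 lti) mem_rcons inE orbC => ->.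
have [||||Q [prQ sQ QM _]] := @prime_avoiding A (ideal_span [set` take i s]) M.
- exact: ideal_spanP.
- by exists 1, 0%N; rewrite expr0 mulr1.
- move=> _ _ [t [j [nt ->]]] [t' [j' [nt' ->]]]; exists (t * t'), (j + j')%N.
  by split; [case/pP | rewrite exprD mulrACA].
- move=> x Ix [t [j [nt e]]]; apply: nt; apply: sub; move: Ix; rewrite {x}e.
  elim: j => [|j IHj]; first by rewrite expr0 mulr1.
  by rewrite exprSr mulrA => /(reg _ lti) /IHj.
have QP : Q `<=` P.
  move=> x Qx; apply: contrapT => nPx; apply: (QM x Qx).
  by exists x, 0%N; rewrite expr0 mulr1.
have [c [cP cS]] := IH Q (ltnW lti) prQ sQ.
exists (fun j => if (j <= i)%N then c j else P); split=> j.
  case: (leqP j i) => [lj _|_ _]; last by split=> // x.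
  by have [? sc] := cP j lj; split=> //; apply: subset_trans sc _.
rewrite ltnS => lt; rewrite lt; case: (ltngtP j i) lt => // [lt _|-> _]; first exact: cS.
have [_ ciQ] := cP i (leqnn i); split.
  exact: subset_trans QP.
move=> Pci; apply: (QM s`_i); first exact/ciQ/Pci.
by exists 1, 1%N; rewrite mul1r.
Qed.

End RegularSequences.

(** For a maximal ideal P the relations bound by d the length of the chains of
    primes and of the regular sequences in P; a regular sequence of length d in P
    yields a chain of primes of length d below P. *)
Lemma cohen_macaulay_dim (k : fieldType) (A : comPzRingType)
    (iota : {rmorphism k -> A}) (d : nat) :
  noetherian A -> alg_dependent iota d.+1 -> (1 : A) <> 0 ->
  (forall P : set A, maximal_ideal P -> exists s,
     [/\ [set` s] `<=` P, weakly_regular s & size s = d]) ->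
  cohen_macaulay A /\ krull_dim A d.
Proof.
move=> noeth dep n10 reg.
have chain (P : set A) : maximal_ideal P -> prime_chain P d.
  move=> mP; have [s [sP rs <-]] := reg P mP.
  by apply: regular_prime_chain => //; apply: maximal_prime.
split; last first.
  split; last exact: no_long_chain dep _.
  have [|P mP _] := exists_maximal (ideal_zero A); first exact: n10.
  have [c [cP cS]] := chain P mP; exists c; split=> // i /cP [? _]; by split.
split=> // P mP; exists d; split; first by split; [apply: chain | apply: no_long_chain dep _].
split=> [|s _]; last exact: no_long_regular dep _.
have [s [sP rs sz]] := reg P mP; exists s; split=> //; split=> //.
have [hP P1 _] := mP; apply: contra_not P1; exact: ideal_span_sub.
Qed.

(** * Residue fields of polynomial rings *)

Section PolynomialIdeals.
Variable R : comNzRingType.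
Implicit Types (P Q : set R) (K : set {poly R}) (p q f g : {poly R}).

(** The extended ideal I R[x]. *)
Definition poly_ideal P : set {poly R} := [set p | forall i, P p`_i].

Lemma poly_idealP P : is_ideal P -> is_ideal (poly_ideal P).
Proof.
move=> hP; split=> [i|p q Pp Pq i|a p Pp i]; rewrite ?coef0 ?coefD ?coefM.
- exact: ideal0.
- exact: idealD.
- by apply: ideal_sum => // j _; apply: ideal_mull.
Qed.

Lemma poly_idealC P c : is_ideal P -> P c -> poly_ideal P c%:P.
Proof. by move=> hP Pc [|i]; rewrite coefC //=; apply: ideal0. Qed.

Lemma poly_ideal_sub P K : is_ideal K -> (forall c, P c -> K c%:P) -> poly_ideal P `<=` K.
Proof.
move=> hK PK p Pp; rewrite -[p]coefK poly_def; apply: ideal_sum => // i _.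
by rewrite -mul_polyC; apply: ideal_mulr => //; apply: PK.
Qed.

Lemma poly_ideal_top P p : is_ideal P -> ~ poly_ideal P p ->
  exists i, ~ P p`_i /\ forall l, (i < l)%N -> P p`_l.
Proof.
move=> hP nPp; pose b i := ~~ `[< P p`_i >].
have exb : exists i, b i.
  apply: contrapT => no; apply: nPp => i; apply: contrapT => nPi.
  by apply: no; exists i; apply/asboolPn.
have ubb i : b i -> (i <= size p)%N.
  rewrite leqNgt => /asboolPn nPi; apply/negP => lt.
  by apply: nPi; rewrite nth_default ?(ltnW lt) //; apply: ideal0.
case: (ex_maxnP exb ubb) => i /asboolPn bi mx; exists i; split=> // l lt.
by apply: contrapT => nPl; have := mx l; rewrite leqNgt lt => /(_ (introT (asboolPn _) nPl)).
Qed.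

Lemma poly_ideal_coefM P p q i j : is_ideal P ->
  (forall l, (i < l)%N -> P p`_l) -> (forall l, (j < l)%N -> P q`_l) ->
  P ((p * q)`_(i + j)) -> P (p`_i * q`_j).
Proof.
move=> hP Pp Pq; rewrite coefM.
have li : (i < (i + j).+1)%N by rewrite ltnS leq_addr.
rewrite (bigD1 (Ordinal li)) //= addKn addrC.
apply: idealDl => //; apply: ideal_sum => // l ne.
have [lt|gt|e] := ltngtP l i; last by case/eqP: ne; apply: val_inj.
  apply: ideal_mull => //; apply: Pq; have := ltn_ord l; lia.
by apply: ideal_mulr => //; apply: Pp.
Qed.

Lemma poly_ideal_prime P : prime_ideal P -> prime_ideal (poly_ideal P).
Proof.
case=> hP P1 Pp; split; first exact: poly_idealP.
  by move=> /(_ 0%N); rewrite coef1.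
move=> p q Ppq; apply: contrapT => no.
have [|i [ni mi]] := @poly_ideal_top P p hP; first by move=> ?; apply: no; left.
have [|j [nj mj]] := @poly_ideal_top P q hP; first by move=> ?; apply: no; right.
by have /Pp[] := poly_ideal_coefM hP mi mj (Ppq _).
Qed.

(** If some coefficient of q were outside Q, the product of the leading
    coefficients of q and f modulo Q would be a coefficient of positive degree of
    a constant. *)
Lemma poly_ideal_const_multiple Q q f c : prime_ideal Q -> (1 < size f)%N ->
  ~ Q (lead_coef f) -> poly_ideal Q (c%:P - q * f) -> Q c.
Proof.
move=> prQ sf nf Qcf; have [hQ Q1 Qp] := prQ.
have Qq : poly_ideal Q q.
  apply: contrapT => nq; have [i [ni mi]] := poly_ideal_top hQ nq.
  have mf l : ((size f).-1 < l)%N -> Q f`_l.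
    move=> lt; have le : (size f <= l)%N by lia.
    by rewrite nth_default //; apply: ideal0.
  suff : Q (q`_i * f`_(size f).-1) by case/Qp.
  apply: (poly_ideal_coefM hQ mi mf).
  have := Qcf (i + (size f).-1)%N; rewrite coefB coefC.
  have -> : (i + (size f).-1 == 0)%N = false by lia.
  by rewrite sub0r => /(ideal_mull (-1) hQ); rewrite mulN1r opprK.
have H : Q (c - (q * f)`_0) by have := Qcf 0%N; rewrite coefB coefC eqxx.
rewrite -(subrK (q * f)`_0 c); apply: (idealD hQ H); rewrite coefM.
by apply: ideal_sum => // j _; apply: ideal_mulr => //; apply: Qq.
Qed.

(** Pseudo-division by an element f of K of least degree among those whose
    leading coefficient is outside P. For P prime this says that f generates the
    image of K over the fraction field of R / P. *)
Lemma poly_ideal_divisor P K g0 : is_ideal P -> is_ideal K ->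
  poly_ideal P `<=` K -> K g0 -> ~ poly_ideal P g0 ->
  exists f, [/\ K f, ~ P (lead_coef f) & forall g, K g ->
    exists N q, poly_ideal P ((lead_coef f ^+ N)%:P * g - q * f)].
Proof.
move=> hP hK PK Kg0 ng0.
have trunc g : K g -> ~ poly_ideal P g ->
    exists f, [/\ K f, ~ P (lead_coef f) & (size f <= size g)%N].
  move=> Kg /(poly_ideal_top hP) [i [ni mi]].
  have ilt : (i < size g)%N.
    by rewrite ltnNge; apply/negP => le; apply: ni; rewrite nth_default //; apply: ideal0.
  have sz : size (take_poly i.+1 g) = i.+1.
    apply/eqP; rewrite eqn_leq size_take_poly ltnNge; apply/negP => le.
    apply: ni; have := nth_default 0 le; rewrite coef_take_poly ltnSn => ->.
    exact: ideal0.
  exists (take_poly i.+1 g); split; rewrite ?sz //.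
    have := Kg; rewrite -[g in K g](poly_take_drop i.+1) addrC; apply: idealDl => //.
    apply: ideal_mulr => //; apply: PK => l; rewrite coef_drop_poly.
    by apply: mi; rewrite addnS ltnS leq_addl.
  by rewrite lead_coefE sz coef_take_poly ltnSn.
pose b s := `[< exists f, [/\ K f, ~ P (lead_coef f) & size f = s] >].
have exb : exists s, b s.
  have [f [Kf nf _]] := trunc _ Kg0 ng0.
  by exists (size f); apply/asboolP; exists f.
case: (ex_minnP exb) => s /asboolP[f [Kf nf sf]] mn; exists f; split=> // g Kg.
have f0 : f != 0 by apply/eqP => f0; apply: nf; rewrite f0 lead_coef0; apply: ideal0.
have e := Pdiv.ComRing.rdivp_eq f g; rewrite -mul_polyC in e.
exists (Pdiv.Ring.rscalp g f), (Pdiv.Ring.rdivp g f); rewrite e addrC addKr.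
have Kr : K (Pdiv.Ring.rmodp g f).
  by apply: (@idealDl _ K (Pdiv.Ring.rdivp g f * f)) => //; rewrite -?e; apply: ideal_mull.
apply: contrapT => /(trunc _ Kr) [h [Kh nh sh]].
have /mn : b (size h) by apply/asboolP; exists h.
by rewrite -sf leqNgt (leq_ltn_trans sh) // Pdiv.Ring.ltn_rmodpN0.
Qed.

End PolynomialIdeals.

(** The nonzero primes of R / P have intersection zero. A field has no nonzero
    prime, so this fails for P maximal; it holds for the zero ideal of k[x] and
    passes from R to R[x], which is how residue fields are shown to be algebraic. *)
Definition shrinking (R : comNzRingType) (P : set R) := forall e, ~ P e ->
  exists Q, [/\ prime_ideal Q, P `<=` Q, exists2 x, Q x & ~ P x & ~ Q e].

(** If P' is generated over P by an algebraic element, choose f in P' of least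
    degree and b in the ideal (e) + P' of R outside P. A prime Q of R above P
    that avoids both b and the leading coefficient of f lifts to R[x]: the
    ideal Q R[x] + P' contains no constant outside Q, since a constant modulo Q
    is not a multiple of f. *)
Lemma shrinking_poly (R : comNzRingType) (P' : set {poly R}) :
  prime_ideal P' -> shrinking [set c | P' c%:P] -> shrinking P'.
Proof.
move=> prP'; set P := [set c | P' c%:P] => shP e nP'e.
have [hP' P'1 pP'] := prP'.
have prP : prime_ideal P := prime_preimage polyC prP'.
have [hP P1 pP] := prP; have hpP := poly_idealP hP.
have PP' : poly_ideal P `<=` P' by apply: poly_ideal_sub.
(* the transcendental case: extend to R[x] a prime of R that avoids a coefficient of e *)
have [sub|] := pselect (P' `<=` poly_ideal P).
  have [|i [ni _]] := @poly_ideal_top _ P e hP; first by move=> /PP'.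
  have [Q [prQ PQ [x Qx nPx] nQi]] := shP _ ni; have [hQ _ _] := prQ.
  exists (poly_ideal Q); split; first exact: poly_ideal_prime.
  - by move=> p /sub pp j; apply: PQ.
  - by exists x%:P => //; apply: poly_idealC.
  - by move=> /(_ i).
move=> nsub; have [g0 P'g0 ng0] : exists2 g, P' g & ~ poly_ideal P g.
  by apply: contrapT => no; apply: nsub => g P'g; apply: contrapT => ng; apply: no; exists g.
have expP c N : ~ P c -> ~ P (c ^+ N).
  by move=> nc; elim: N => [|N IHN]; rewrite ?expr0 // exprS => /pP [].
have [f [P'f nPf divf]] := poly_ideal_divisor hP hP' PP' P'g0 ng0.
have gt1 (K : set {poly R}) h : K h -> ~ P (lead_coef h) ->
    (forall c, K c%:P -> P c) -> (1 < size h)%N.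
  move=> Kh nh KP; rewrite ltnNge; apply/negP => /size1_polyC eh.
  by apply: nh; rewrite eh lead_coefC; apply: KP; rewrite -eh.
have sf : (1 < size f)%N by apply: (gt1 P').
(* otherwise an element h of least degree of (e) + P' divides f over the fraction
   field, so h or the quotient is in P' and b can be read off *)
have [b nb [u P'u]] : exists2 b, ~ P b & exists u, P' (b%:P - u * e).
  apply: contrapT => no; have [hK P'K Ke] := ideal_adjoinP e hP'.
  have Kc c : ideal_adjoin P' e c%:P -> P c.
    move=> [q [u [P'q ec]]]; apply: contrapT => nc; apply: no; exists c => //.
    by exists u; rewrite ec addrK.
  have [|h [Kh nh divh]] := poly_ideal_divisor hP hK (subset_trans PP' P'K) Ke.
    by move/PP'.
  have sh : (1 < size h)%N by apply: (gt1 _ _ Kh).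
  have [N [q Pq]] := divh f (P'K _ P'f).
  have P'r := PP' _ Pq; have /pP'[P'q|P'h] : P' (q * h).
  - have -> : q * h = (lead_coef h ^+ N)%:P * f - ((lead_coef h ^+ N)%:P * f - q * h).
      by ring.
    by apply: idealB => //; apply: ideal_mull.
  - have [N' [q2 Pq2]] := divf q P'q; have [_ _ phP] := poly_ideal_prime prP.
    have : poly_ideal P (f * ((lead_coef h ^+ N * lead_coef f ^+ N')%:P - q2 * h)).
      set x := (lead_coef f ^+ N')%:P in Pq2; set y := (lead_coef h ^+ N)%:P in Pq.
      have -> : f * ((lead_coef h ^+ N * lead_coef f ^+ N')%:P - q2 * h)
              = x * (y * f - q * h) + h * (x * q - q2 * f).
        by rewrite polyCM -/x -/y; ring.
      by apply: (idealD hpP); apply: (ideal_mull _ hpP).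
    case/phP => [/(_ (size f).-1)//|/(poly_ideal_const_multiple prP sh nh)].
    by case/pP; apply: expP.
  - have [N' [q2 Pq2]] := divh e Ke.
    have /pP'[|//] : P' ((lead_coef h ^+ N')%:P * e).
      rewrite -(subrK (q2 * h) (_ * e)); apply: idealD => //; first exact: PP'.
      exact: ideal_mull.
    exact: expP.
have [|Q [prQ PQ [x Qx nPx] nQ]] := shP (b * lead_coef f); first by case/pP.
have [hQ Q1 pQ] := prQ.
have nQf : ~ Q (lead_coef f) by apply: contra_not nQ; apply: ideal_mull.
have nQb : ~ Q b by apply: contra_not nQ; apply: ideal_mulr.
pose I := [set x | exists g p, [/\ poly_ideal Q g, P' p & x = g + p]].
pose M := [set x | exists2 s, ~ Q s & x = s%:P].
have hI : is_ideal I.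
  have hpQ := poly_idealP hQ; split.
  - by exists 0, 0; split; rewrite ?addr0 //; apply: ideal0.
  - move=> _ _ [g [p [Qg Pp ->]]] [g' [p' [Qg' Pp' ->]]]; exists (g + g'), (p + p').
    by split; [apply: (idealD hpQ)|apply: idealD|rewrite addrACA].
  - move=> a _ [g [p [Qg Pp ->]]]; exists (a * g), (a * p).
    by split; [apply: (ideal_mull _ hpQ)|apply: ideal_mull|rewrite mulrDr].
have QI c : Q c -> I c%:P.
  by move=> Qc; exists c%:P, 0; split; [apply: poly_idealC|apply: ideal0|rewrite addr0].
have PI p : P' p -> I p.
  by move=> P'p; exists 0, p; split; rewrite ?add0r //; apply: ideal0; apply: poly_idealP.
have [|||Q' [prQ' IQ' Q'M _]] := @prime_avoiding _ I M hI.
- by exists 1.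
- move=> _ _ [s ns ->] [t nt ->]; exists (s * t); last by rewrite polyCM.
  by case/pQ.
- move=> y [g [p [Qg P'p ey]]] [s ns es]; have [N [q Pq]] := divf p P'p.
  have /pQ[|//] : Q (lead_coef f ^+ N * s).
    apply: (poly_ideal_const_multiple prQ sf nQf (q := q)).
    set z := (lead_coef f ^+ N)%:P in Pq.
    have -> : (lead_coef f ^+ N * s)%:P - q * f = z * g + (z * p - q * f).
      by rewrite polyCM -/z -es ey; ring.
    have hpQ := poly_idealP hQ.
    by apply: (idealD hpQ); [apply: (ideal_mull _ hpQ) | move=> i; apply: PQ].
  by elim: N {Pq} => [|N IHN]; rewrite ?expr0 // exprS => /pQ [].
have [hQ' _ _] := prQ'.
exists Q'; split=> //.
- by move=> p /PI /IQ'.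
- by exists x%:P => //; apply/IQ'/QI.
- move=> Q'e; apply: (Q'M b%:P); last by exists b.
  rewrite -(subrK (u * e) b%:P); apply: idealD => //; first exact/IQ'/PI.
  exact: ideal_mull.
Qed.

(** Given e, the polynomial 1 + X e is not constant; no maximal ideal containing
    it contains e. *)
Lemma shrinking_poly_field (k : fieldType) : shrinking [set 0 : {poly k}].
Proof.
move=> e e0; pose x := 1 + 'X * e; have hI := ideal_spanP [set x].
have sx : (1 < size x)%N.
  rewrite /x addrC size_polyDl ?size_poly1 mulrC size_mulX //; try exact/eqP.
    by rewrite ltnS lt0n size_poly_eq0; apply/eqP.
  by rewrite ltnS lt0n size_poly_eq0; apply/eqP.
have [|Q mQ IQ] := exists_maximal hI.
  case=> m [c [g [gx]]]; under eq_bigr => i _ do rewrite (gx i).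
  rewrite -mulr_suml => e1; have : x \is a GRing.unit.
    by apply/unitrPr; exists (\sum_i c i); rewrite mulrC.
  by rewrite poly_unitE => /andP[/eqP s1 _]; rewrite s1 in sx.
have prQ := maximal_prime mQ; have [hQ Q1 _] := prQ.
have Qx : Q x by apply/IQ/ideal_span_gen.
exists Q; split=> //.
- by move=> _ ->; apply: ideal0.
- by exists x => // x0; rewrite x0 size_poly0 in sx.
- move=> Qe; apply: Q1; rewrite -(addrK ('X * e) 1); apply: idealB => //.
  exact: ideal_mull.
Qed.

Section Tower.
Variable k : fieldType.

(** Iterated univariate polynomial rings, for inductions that adjoin one variable
    at a time. *)
Fixpoint tower (j : nat) : comNzRingType :=
  if j is i.+1 then {poly (tower i)} else {poly k}.

Fixpoint tower_base (j : nat) : {poly k} -> tower j :=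
  if j is i.+1 then fun p => (tower_base i p)%:P else id.

Lemma shrinking_tower j (P : set (tower j)) : prime_ideal P ->
  (forall p, P (tower_base j p) -> p = 0) -> shrinking P.
Proof.
elim: j P => [|j IH] P prP P0.
  have -> : P = [set 0]; last exact: shrinking_poly_field.
  by rewrite eqEsubset; split=> [p /P0|_ ->] //; case: prP => /ideal0.
by apply: (shrinking_poly prP); apply: IH => //; apply: prime_preimage.
Qed.

(** The variable of the base can be sent to an arbitrary element z, so that k[z] is
    the first step of the tower. *)
Lemma tower_onto n (z : {mpoly k[n]}) : exists phi : {rmorphism tower n -> {mpoly k[n]}},
  (forall p, phi (tower_base n p) = (map_poly (@mpolyC n k) p).[z]) /\
  (forall x, exists a, phi a = x).
Proof.
suff H j : (j <= n)%N -> exists phi : {rmorphism tower j -> {mpoly k[n]}},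
    (forall p, phi (tower_base j p) = (map_poly (@mpolyC n k) p).[z]) /\
    (forall i : 'I_n, (i < j)%N -> exists a, phi a = 'X_i).
  have [phi [phiz phiX]] := H n (leqnn n); exists phi; split=> //.
  apply: (@mpolyind n k) => [|c m p _ _ [a <-]]; first by exists 0; rewrite rmorph0.
  have [b <-] : exists b, phi b = 'X_[m].
    rewrite mpolyXE_id; elim/big_rec: _ => [|i x _ [b <-]]; first by exists 1; rewrite rmorph1.
    have [d <-] := phiX i (ltn_ord i); exists (d ^+ m i * b).
    by rewrite rmorphM rmorphXn.
  exists (tower_base n c%:P * b + a).
  by rewrite rmorphD rmorphM phiz map_polyC hornerC /= mul_mpolyC.
elim: j => [_|j IH lt].
  have cz : commr_rmorph (@mpolyC n k) z by move=> c; apply: mulrC.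
  by exists (horner_morph cz); split.
have [phi [phiz phiX]] := IH (ltnW lt).
have cz : commr_rmorph phi ('X_(Ordinal lt) : {mpoly k[n]}) by move=> c; apply: mulrC.
exists (horner_morph cz); split=> [p|i]; first by rewrite /= horner_morphC.
rewrite ltnS leq_eqVlt => /orP[/eqP e|/phiX [a <-]].
  by exists 'X; rewrite /= horner_morphX; congr 'X_ _; apply: val_inj.
by exists a%:P; rewrite /= horner_morphC.
Qed.

(** Zariski's lemma: a residue field of k[x_1, ..., x_n] is algebraic over k.
    Otherwise the residue field would inherit from k[z] infinitely many nonzero
    primes. *)
Lemma residue_algebraic n (P : set {mpoly k[n]}) z : maximal_ideal P ->
  exists2 p : {poly k}, p != 0 & P (map_poly (@mpolyC n k) p).[z].
Proof.
move=> mP; have [hP P1 pP] := maximal_prime mP.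
have [phi [phiz phiS]] := tower_onto z.
pose M := [set x | P (phi x)].
apply: contrapT => no.
have prM : prime_ideal M by apply: prime_preimage; apply: maximal_prime.
have /shrinking_tower : prime_ideal M by [].
case/(_ _ 1) => [p Mp||Q [[hQ Q1 _] MQ [x Qx nMx] _]].
- apply/eqP; apply: contrapT => /negP p0; apply: no; exists p => //.
  by rewrite -phiz.
- by case: prM.
have [c] := maximal_inv mP nMx; have [c' <-] := phiS c.
rewrite -rmorphM -(rmorph1 phi) -rmorphB => /MQ H.
by apply: Q1; rewrite -(subrK (c' * x) 1); apply: idealD => //; apply: ideal_mull.
Qed.

End Tower.

(** * Hilbert's basis theorem *)

Lemma noetherian_onto (R : comPzRingType) (B : comPzRingType) (phi : {rmorphism R -> B}) :
  (forall b, exists a, phi a = b) -> noetherian R -> noetherian B.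
Proof.
move=> onto noeR I hI.
have [s es] := noeR _ (ideal_preimage phi hI).
exists (map phi s); rewrite eqEsubset; split; last first.
  apply: ideal_span_sub => // _ /= /mapP[a sa ->].
  have : ideal_span [set` s] a by apply: ideal_span_gen.
  by rewrite -es.
move=> b; have [a <-] := onto b => Ia.
have : ideal_span [set` s] a by rewrite -es.
case=> m [c [g [sg ->]]]; exists m, (phi \o c), (phi \o g).
split=> [i|]; first by rewrite /=; apply: map_f; apply: sg.
by rewrite rmorph_sum; apply: eq_bigr => i _; rewrite rmorphM.
Qed.

Lemma noetherian_field (k : fieldType) : noetherian k.
Proof.
move=> I hI; have [[x Ix x0]|no] := pselect (exists2 x, I x & x != 0).
  exists [:: 1]; rewrite eqEsubset; split=> y Iy.
    rewrite -[y]mulr1; apply: ideal_mull; first exact: ideal_spanP.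
    by apply: ideal_span_gen; rewrite /= inE.
  by rewrite -[y](mulfVK x0); apply: ideal_mull.
exists [::]; rewrite span_seq0 eqEsubset; split=> y; last by move=> ->; apply: ideal0.
by move=> Iy; apply/eqP; apply: contrapT => /negP y0; apply: no; exists y.
Qed.

(** The ideals L d of leading coefficients in degree at most d become stationary
    at some N, because their union is finitely generated; elements realizing
    generators of L 0, ..., L N generate the ideal. *)
Lemma noetherian_poly (R : comNzRingType) : noetherian R -> noetherian {poly R}.
Proof.
move=> noeR I hI.
(* leading coefficients of the elements of degree at most d *)
pose L d := [set c | exists p, [/\ I p, (size p <= d.+1)%N & p`_d = c]].
have hL d : is_ideal (L d).
  split.
  - by exists 0; rewrite size_poly0 coef0; split=> //; apply: ideal0.
  - move=> _ _ [p [Ip sp <-]] [q [Iq sq <-]]; exists (p + q); split.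
    + exact: idealD.
    + by rewrite (leq_trans (size_polyD _ _)) // geq_max sp.
    + by rewrite coefD.
  - move=> a _ [p [Ip sp <-]]; exists (a *: p); split.
    + by rewrite -mul_polyC; apply: ideal_mull.
    + by rewrite (leq_trans (size_scale_leq _ _)).
    + by rewrite coefZ.
have LS d e : (d <= e)%N -> L d `<=` L e.
  move=> le _ [p [Ip sp <-]]; exists (p * 'X^(e - d)); split.
  - exact: ideal_mulr.
  - rewrite (leq_trans (size_polyMleq _ _)) // size_polyXn; lia.
  - rewrite coefMXn ltnNge leq_subr /=; congr (p`_ _); lia.
have hU : is_ideal [set c | exists d, L d c].
  split.
  - by exists 0%N; apply: ideal0.
  - move=> x y [d Ld] [e Le]; exists (maxn d e); apply: idealD => //.
      by apply: LS Ld; apply: leq_maxl.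
    by apply: LS Le; apply: leq_maxr.
  - by move=> a x [d Ld]; exists d; apply: ideal_mull.
have [N UN] : exists N, forall d, L d `<=` L N.
  have [s es] := noeR _ hU.
  have [N sN] : exists N, forall x, x \in s -> L N x.
    have : forall x, x \in s -> exists d, L d x.
      move=> x xs; have : ideal_span [set` s] x by apply: ideal_span_gen.
      by rewrite -es.
    elim: s {es} => [|x s IH] H; first by exists 0%N.
    have [d Ld] := H x (mem_head _ _).
    have [y ys|e Le] := IH; first by apply: H; rewrite inE ys orbT.
    exists (maxn d e) => y; rewrite inE => /orP[/eqP ->|/Le].
      by apply: LS Ld; apply: leq_maxl.
    by apply: LS; apply: leq_maxr.
  exists N => d x Lx; have : ideal_span [set` s] x by rewrite -es; exists d.
  by apply: ideal_span_sub => //= y; apply: sN.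
have /choice [G GP] : forall d, exists G : seq {poly R}, [set` G] `<=` I /\
    forall c, L d c -> exists p, [/\ ideal_span [set` G] p, (size p <= d.+1)%N & p`_d = c].
  move=> d; have [t et] := noeR _ (hL d).
  have /choice [h hP] : forall c, exists p, c \in t -> [/\ I p, (size p <= d.+1)%N & p`_d = c].
    move=> c; have [ct|] := boolP (c \in t); last by exists 0.
    have : L d c by rewrite et; apply: ideal_span_gen.
    by case=> p; exists p.
  exists (map h t); split=> [_ /mapP[c /hP[Ip _ _] ->] //|c].
  rewrite et => -[m [a [g [gt ->]]]].
  exists (\sum_(i < m) a i *: h (g i)); split.
  - apply: ideal_sum => [|i _]; first exact: ideal_spanP.
    rewrite -mul_polyC; apply: ideal_mull; first exact: ideal_spanP.
    by apply: ideal_span_gen; apply: map_f; apply: gt.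
  - apply: (leq_trans (size_sum _ _ _)); apply/bigmax_leqP => i _.
    by rewrite (leq_trans (size_scale_leq _ _)) //; case: (hP _ (gt i)).
  - by rewrite coef_sum; apply: eq_bigr => i _; rewrite coefZ; case: (hP _ (gt i)) => _ _ ->.
pose s := flatten [seq G d | d <- iota 0 N.+1].
have Gs d : (d <= N)%N -> ideal_span [set` G d] `<=` ideal_span [set` s].
  move=> dN; apply: ideal_span_mono => p /= pG; apply/flattenP; exists (G d) => //.
  by apply: map_f; rewrite mem_iota.
exists s; rewrite eqEsubset; split; last first.
  apply: ideal_span_sub => // p /= /flattenP[_ /mapP[d _ ->]] pG.
  by case: (GP d) => GI _; apply: GI.
have hs := ideal_spanP [set` s].
move=> p Ip; have [n] := ubnP (size p); elim: n p Ip => // n IH p Ip sp.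
have [->|p0] := eqVneq p 0; first exact: ideal0.
pose d := (size p).-1; have sd : size p = d.+1 by rewrite prednK // size_poly_gt0.
have Ld : L d p`_d by exists p; rewrite sd.
have [q [qs sq qd]] : exists q, [/\ ideal_span [set` s] q, (size q <= d.+1)%N & q`_d = p`_d].
  have [dN|Nd] := leqP d N.
    have [_ /(_ _ Ld) [q [qG sq qd]]] := GP d; exists q; split=> //; exact: Gs qG.
  have [_ /(_ _ (UN _ _ Ld)) [q [qG sq qd]]] := GP N.
  exists (q * 'X^(d - N)); split.
  - by apply: ideal_mulr => //; apply: Gs qG.
  - rewrite (leq_trans (size_polyMleq _ _)) // size_polyXn; lia.
  - rewrite coefMXn ltnNge leq_subr /= -qd; congr (q`_ _); lia.
have Iq : I q.
  move: qs; apply: ideal_span_sub => // g /= /flattenP[_ /mapP[e _ ->]] gG.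
  by case: (GP e) => GI _; apply: GI.
rewrite -(subrK q p); apply: idealD => //; apply: IH; first exact: idealB.
have spq : (size (p - q)%R <= d)%N.
  apply/leq_sizeP => j; rewrite leq_eqVlt => /orP[/eqP <-|dj].
    by rewrite coefB qd subrr.
  rewrite coefB !nth_default ?subr0 //; first exact: leq_trans sq _.
  by rewrite sd.
by apply: (leq_ltn_trans spq); rewrite -ltnS -sd.
Qed.

Lemma noetherian_mpoly (k : fieldType) n : noetherian {mpoly k[n]}.
Proof.
have [phi [_ phiS]] := @tower_onto k n 0.
apply: (noetherian_onto phiS); elim: (X in tower k X) => [|j IH] /=.
  exact/noetherian_poly/noetherian_field.
exact: noetherian_poly.
Qed.

(** * Regular sequences and relations in polynomial rings *)

Section RegularVariables.
Variables (k : fieldType) (r : nat).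
Local Notation S := {mpoly k[r]}.

Definition peval (q : {poly k}) (z : S) : S := (map_poly (@mpolyC r k) q).[z].

(** Write b as a polynomial in X_i. The ideal (G) is generated by polynomials not
    involving X_i, so membership in it can be tested on coefficients, and q, whose
    leading coefficient is a unit, can be cancelled. *)
Lemma weakly_regular_variable (i : 'I_r) (q : {poly k}) (G : set S) b :
  q != 0 -> (forall g, G g -> exists j q', j != i /\ g = peval q' 'X_j) ->
  ideal_span G (b * peval q 'X_i) -> ideal_span G b.
Proof.
move=> q0 GP; set I := ideal_span G; have hI : is_ideal I := ideal_spanP G.
(* D writes a polynomial as a polynomial in X_i *)
have [D DX DC] : exists2 D : {rmorphism S -> {poly S}},
    forall j, D 'X_j = if j == i then 'X else ('X_j)%:P
    & forall c, D c%:MP = c%:MP%:P.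
  exists (@mmap r k {poly S} (polyC \o @mpolyC r k)
            (fun j => if j == i then 'X else ('X_j)%:P)) => [j|c].
    by rewrite /= mmapX mmap1U.
  by rewrite /= mmapC.
have Dpeval q' j : D (peval q' 'X_j) = (map_poly (polyC \o @mpolyC r k) q').[D 'X_j].
  rewrite /peval -horner_map -map_poly_comp; congr _.[_].
  by apply: eq_map_poly => c; rewrite [LHS]DC.
have Deval p : (D p).['X_i] = p.
  elim/mpolyind: p => [|c m p _ _ IH]; first by rewrite rmorph0 horner0.
  rewrite rmorphD hornerD IH; congr (_ + p).
  rewrite -mul_mpolyC rmorphM DC hornerCM; congr (_ * _).
  rewrite mpolyXE_id rmorph_prod horner_prod; apply: eq_bigr => j _.
  by rewrite rmorphXn horner_exp DX; case: eqP => [->|_]; rewrite ?hornerX ?hornerC.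
have Dideal p : I p -> poly_ideal I (D p).
  case=> m [c [g [Gg ->]]]; rewrite rmorph_sum.
  have hpI := poly_idealP hI; apply: ideal_sum => // l _.
  rewrite rmorphM; apply: (ideal_mull _ hpI).
  have [j [q' [ne e]]] := GP _ (Gg l).
  have -> : D (g l) = (g l)%:P.
    rewrite e Dpeval DX (negbTE ne) map_poly_comp horner_map; congr (_.[_])%:P.
  by apply: poly_idealC => //; apply: ideal_span_gen.
move=> /Dideal; rewrite rmorphM Dpeval DX eqxx map_poly_comp -/(_ \Po 'X) comp_polyXr.
set Q := map_poly _ q => Db.
have {}Db : poly_ideal I (D b).
  apply: contrapT => /(poly_ideal_top hI) [l [nl ml]]; apply: nl.
  have mQ j : ((size Q).-1 < j)%N -> I Q`_j.
    move=> lt; have le : (size Q <= j)%N by lia.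
    by rewrite nth_default //; apply: ideal0.
  have := poly_ideal_coefM hI ml mQ (Db _); rewrite -lead_coefE lead_coef_map.
  move=> /(ideal_mulr (lead_coef q)^-1%:MP hI); rewrite -mulrA -mpolyCM mulfV ?lead_coef_eq0 //.
  by rewrite mulr1.
rewrite -[b]Deval horner_coef; apply: ideal_sum => // l _.
by apply: ideal_mulr => //; apply: Db.
Qed.

Lemma weakly_regular_separated (q : 'I_r -> {poly k}) : (forall i, q i != 0) ->
  weakly_regular [seq peval (q i) 'X_i | i <- enum 'I_r].
Proof.
move=> q0 l; rewrite size_map size_enum_ord => ltl b.
rewrite (nth_map (Ordinal ltl)) ?size_enum_ord // -map_take.
apply: weakly_regular_variable => // _ /= /mapP[j jl ->].
exists j, (q j); split=> //; apply/eqP => e; move: jl; rewrite {j}e.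
case/(nthP (Ordinal ltl)) => p; rewrite size_takel ?size_enum_ord ?(ltnW ltl) // => lp.
rewrite nth_take // => /(congr1 val); rewrite /= !nth_enum_ord ?(ltn_trans lp) // => e.
by rewrite e ltnn in lp.
Qed.

End RegularVariables.

(** If b s_i is a combination of the previous s_j, then in S also b is one; the
    A-linear retraction tau turns the coefficients in S into coefficients
    in A. *)
Lemma weakly_regular_retract (A S : comPzRingType) (Theta : {rmorphism A -> S})
    (tau : {additive S -> A}) (s : seq A) :
  (forall x p, tau (Theta x * p) = x * tau p) -> tau 1 = 1 ->
  weakly_regular (map Theta s) -> weakly_regular s.
Proof.
move=> tauM tau1 reg i lti b /span_seqP [c e].
have szt : size (take i s) = i by rewrite size_takel // ltnW.
have tK x : tau (Theta x) = x by rewrite -[Theta x]mulr1 tauM tau1 mulr1.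
have := reg i; rewrite size_map lti => /(_ isT (Theta b)).
rewrite (nth_map 0) // -rmorphM e -map_take => H.
have /span_seqP [d ed] : ideal_span [set` map Theta (take i s)] (Theta b).
  apply: H; apply/span_seqP; exists (Theta \o c).
  rewrite rmorph_sum size_map; apply: eq_bigr => j _.
  by rewrite rmorphM (nth_map 0).
apply/span_seqP; exists (tau \o d); rewrite -[LHS]tK ed raddf_sum size_map.
by apply: eq_bigr => j _; rewrite (nth_map 0) // mulrC tauM mulrC.
Qed.

Section Dependence.
Variables (k : fieldType) (r : nat).
Local Notation S := {mpoly k[r]}.

Definition degs_le (B : nat) (p : S) := forall m i, m \in msupp p -> (m i <= B)%N.

Lemma degs_le_sum (J : Type) (s : seq J) (p : pred J) (F : J -> S) B :
  (forall j, p j -> degs_le B (F j)) -> degs_le B (\sum_(j <- s | p j) F j).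
Proof.
move=> FB; elim/big_rec: _ => [m i|j x pj xB m i]; first by rewrite msupp0.
by move=> /msuppD_le; rewrite mem_cat => /orP[/(FB j pj)|/xB].
Qed.

Lemma degs_leM B C p q : degs_le B p -> degs_le C q -> degs_le (B + C) (p * q).
Proof.
move=> pB qC m i /msuppM_le /allpairsP[[m1 m2] /= [h1 h2 ->]].
by rewrite mnmDE leq_add ?pB ?qC.
Qed.

Lemma degs_leC B c : degs_le B c%:MP.
Proof.
move=> m i; rewrite msuppC; case: ifP => //= _; rewrite inE => /eqP ->.
by rewrite mnm0E.
Qed.

Lemma degs_le_trans B C p : (B <= C)%N -> degs_le B p -> degs_le C p.
Proof. by move=> BC pB m i /(pB m i) /leq_trans; apply. Qed.

Lemma degs_le_exp B p j : degs_le B p -> degs_le (j * B) (p ^+ j).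
Proof.
move=> pB; elim: j => [|j IH]; first by rewrite expr0 -mpolyC1; apply: degs_leC.
by rewrite exprS mulSn; apply: degs_leM.
Qed.

Lemma degs_le_evs B N (xs : seq S) c : (forall x, x \in xs -> degs_le B x) ->
  degs_le (size xs * (N * B)) (evs (@mpolyC r k) N xs c).
Proof.
elim: xs c => [|x xs IH] c xB /=; first exact: degs_leC.
apply: degs_le_sum => i _; rewrite mulSn; apply: degs_leM.
  apply: (@degs_le_trans (i * B)); first by rewrite leq_mul2r ltnW ?orbT.
  by apply/degs_le_exp/xB/mem_head.
by apply: IH => y ys; apply: xB; rewrite inE ys orbT.
Qed.

Lemma exists_degs_le (xs : seq S) : exists B, forall x, x \in xs -> degs_le B x.
Proof.
exists (\max_(x <- xs) msize x) => x xs_x m i mx.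
apply: leq_trans (leq_bigmax_seq _ xs_x _) => //.
apply: leq_trans (ltnW (msize_mdeg_lt mx)); rewrite mdegE (bigD1 i) //=.
exact: leq_addr.
Qed.

End Dependence.

Lemma evs_sum (k : fieldType) (A : comPzRingType) (iota : {rmorphism k -> A}) N xs
    (J : finType) (v : J -> k) (c : J -> seq nat -> k) :
  evs iota N xs (fun e => \sum_j v j * c j e) = \sum_j iota (v j) * evs iota N xs (c j).
Proof.
elim: xs c => [|x xs IH] c /=.
  by rewrite rmorph_sum; apply: eq_bigr => j _; rewrite rmorphM.
under eq_bigr => i _ do rewrite (IH (fun j e => c j (val i :: e))) mulr_sumr.
rewrite exchange_big /=; apply: eq_bigr => j _; rewrite mulr_sumr.
by apply: eq_bigr => i _; rewrite mulrCA.
Qed.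

Lemma exists_left_kernel (k : fieldType) m n (M : 'M[k]_(m, n)) : (n < m)%N ->
  exists2 v : 'rV_m, v != 0 & v *m M = 0.
Proof.
move=> lt; have : kermx M != 0.
  rewrite -mxrank_eq0 mxrank_ker -lt0n subn_gt0.
  exact: leq_ltn_trans (rank_leq_col _) lt.
by case/rowV0Pn => v /sub_kermxP vM v0; exists v.
Qed.

(** For r + 1 elements x_i the products x^e with all e_i < N number N^(r+1), but
    their degrees in each variable are O(N), so they lie in a space of dimension
    O(N^r); for N large they are linearly dependent. *)
Lemma alg_dependent_mpoly (k : fieldType) r : alg_dependent (@mpolyC r k) r.+1.
Proof.
move=> xs sxs; have [B xB] := exists_degs_le xs.
(* N exceeds the constant hidden in O(N^r) *)
pose N := ((r.+1 * B.+1) ^ r).+1; pose M := (r.+1 * (N * B)).+1.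
pose J : finType := (r.+1.-tuple 'I_N)%type; pose E : finType := {ffun 'I_r -> 'I_M}.
pose ex (t : J) : seq nat := map val (t : r.+1.-tuple 'I_N).
pose dl (t : J) (e : seq nat) : k := (ex t == e)%:R.
pose x t := evs (@mpolyC r k) N xs (dl t).
pose mon (u : E) := [multinom val ((u : {ffun 'I_r -> 'I_M}) i) | i < r].
have [|v v0 vM] := @exists_left_kernel k #|J| #|E|
    (\matrix_(t, u) (x (enum_val t))@_(mon (enum_val u))).
  rewrite card_ffun card_tuple !card_ord.
  apply: (@leq_ltn_trans ((r.+1 * B.+1 * N) ^ r)).
    have MN : (M <= r.+1 * B.+1 * N)%N.
      by have : (0 < N)%N by []; rewrite /M; move: (N) => N'; clear; nia.
    have le_exp a b j : (a <= b)%N -> (a ^ j <= b ^ j)%N.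
      by case: j => // j; rewrite leq_exp2r.
    exact: le_exp.
  by rewrite expnMn expnS ltn_mul2r expn_gt0; apply: ltnSn.
pose c e := \sum_t v 0 (enum_rank t) * dl t e.
have ct t : c (ex t) = v 0 (enum_rank t).
  rewrite /c (bigD1 t) //= big1 /dl ?eqxx ?mulr1 ?addr0 // => t' ne.
  rewrite /ex (inj_eq (inj_map val_inj)) -[(_ == _ :> seq _)]/(t' == t) (negbTE ne).
  by rewrite mulr0.
have [t vt] : exists t, v 0 (enum_rank t) != 0.
  apply: contrapT => no; case/eqP: v0; apply/rowP => j; rewrite mxE.
  apply/eqP; apply: contrapT => /negP vj; apply: no; exists (enum_val j).
  by rewrite enum_valK.
exists N, c, (ex t); split; rewrite ?ct /ex ?size_map ?size_tuple //; last first.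
  by apply/allP => _ /mapP[i _ ->] /=.
rewrite /c evs_sum; apply/mpolyP => m; rewrite mcoeff0.
have [mM|] := boolP [forall i, (m i < M)%N].
  pose u : E := [ffun i => inord (m i)].
  have : (v *m (\matrix_(t, u) (x (enum_val t))@_(mon (enum_val u)))) 0 (enum_rank u) = 0.
    by rewrite vM mxE.
  rewrite mxE => <-; rewrite raddf_sum (reindex _ (onW_bij _ (enum_val_bij J))) /=.
  apply: eq_bigr => j _; rewrite mxE mcoeffCM !enum_valK; congr (_ * _@__).
  apply/mnmP => i; rewrite mnmE enum_rankK ffunE /= inordK //.
  by move/forallP: mM.
case/forallPn => i; rewrite -leqNgt => Mm.
apply: memN_msupp_eq0; apply/negP.
have /[apply] : degs_le (r.+1 * (N * B)) (\sum_t (v 0 (enum_rank t))%:MP * x t).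
  apply: degs_le_sum => t' _; rewrite -[X in degs_le X]add0n.
  apply: degs_leM; first exact: degs_leC.
  by rewrite -sxs; apply: degs_le_evs.
by move/(_ i); rewrite leqNgt Mm.
Qed.

Lemma alg_dependent_inj (k : fieldType) (A S : comPzRingType)
    (iota : {rmorphism k -> A}) (iota' : {rmorphism k -> S})
    (Theta : {rmorphism A -> S}) d :
  injective Theta -> (forall c, Theta (iota c) = iota' c) ->
  alg_dependent iota' d -> alg_dependent iota d.
Proof.
move=> inj Ti dep xs sxs.
have [|N [c [e [ev se ae ce]]]] := dep (map Theta xs); first by rewrite size_map.
exists N, c, e; split=> //; apply: inj; rewrite rmorph0 -[RHS]ev.
elim: xs c {sxs ev ce} => [|x xs IH] c; first by rewrite /= Ti.
by rewrite /= rmorph_sum; apply: eq_bigr => i _; rewrite rmorphM rmorphXn IH.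
Qed.

(** * The equations of the scroll *)

Section LinearExtension.
Variables (k : nzRingType) (r : nat) (V : lmodType k) (v : 'X_{1..r} -> V).

Definition lin_ext (p : {mpoly k[r]}) : V := \sum_(e <- msupp p) p@_e *: v e.

Lemma lin_extwE p K : (msize p <= K)%N ->
  lin_ext p = \sum_(e : 'X_{1..r < K}) p@_e *: v e.
Proof.
move=> le; rewrite /lin_ext (big_mksub 'X_{1..r < K}) ?msupp_uniq //=; first last.
  by move=> x /msize_mdeg_lt /leq_trans; apply.
by rewrite big_rmcond //= => j /memN_msupp_eq0 ->; rewrite scale0r.
Qed.

Lemma lin_ext_is_linear : linear lin_ext.
Proof.
move=> c p q; pose K := maxn (msize (c *: p + q)) (maxn (msize p) (msize q)).
have [l1 l2 l3] : [/\ msize (c *: p + q) <= K, msize p <= K & msize q <= K]%N.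
  by rewrite /K; split; lia.
rewrite !(lin_extwE (K := K)) // scaler_sumr -big_split; apply: eq_bigr => e _.
by rewrite /= mcoeffD mcoeffZ scalerDl scalerA.
Qed.

HB.instance Definition _ :=
  GRing.isLinear.Build k {mpoly k[r]} V *:%R lin_ext lin_ext_is_linear.

Lemma lin_extX e : lin_ext 'X_[e] = v e.
Proof. by rewrite /lin_ext msuppX big_seq1 mcoeffX eqxx scale1r. Qed.

End LinearExtension.

Lemma mpoly_linear_ind (k : nzRingType) r (P : {mpoly k[r]} -> Prop) :
  P 0 -> (forall p q, P p -> P q -> P (p + q)) ->
  (forall c p, P p -> P (c *: p)) -> (forall e, P 'X_[e]) -> forall p, P p.
Proof.
move=> P0 PD PZ PX p; rewrite (mpolyE p).
by elim/big_rec: _ => [//|e q _ Pq]; apply: PD => //; apply: PZ.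
Qed.

Lemma mnm_ind r (P : 'X_{1..r} -> Prop) : P 0%MM ->
  (forall i mu, P mu -> P (U_(i) + mu)%MM) -> forall mu, P mu.
Proof.
move=> P0 PU mu; have [d] := ubnP (mdeg mu); elim: d mu => // d IH mu lt.
have [->//|mu0] := eqVneq mu 0%MM.
have [i mi] : exists i, mu i != 0%N.
  apply: contrapT => no; case/eqP: mu0; apply/mnmP => i; rewrite mnm0E.
  by apply/eqP; apply: contrapT => /negP mi; apply: no; exists i.
have le : (U_(i) <= mu)%MM by rewrite lep1mP.
have e := submK le; rewrite -e addmC; apply: PU; apply: IH.
by move: lt; rewrite -{1}e mdegD mdeg1 addn1 ltnS.
Qed.

Section Scroll.
Variables (k : fieldType) (m : nat).
Hypothesis m_gt0 : (0 < m)%N.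
Local Notation n := m.+3.
Local Notation T := {mpoly k[n]}.
Local Notation S := {mpoly k[4]}.

Definition va : 'I_4 := @Ordinal 4 0 isT.
Definition vb : 'I_4 := @Ordinal 4 1 isT.
Definition vs : 'I_4 := @Ordinal 4 2 isT.
Definition vt : 'I_4 := @Ordinal 4 3 isT.

(** The exponents of the images a^(m-j) b^j, s, t of the variables. *)
Definition scroll_exp (j : nat) : 'X_{1..4} :=
  if (j <= m)%N then (U_(va) *+ (m - j) + U_(vb) *+ j)%MM
  else if j == m.+1 then U_(vs)%MM else U_(vt)%MM.

Definition scroll_map : T -> S :=
  mmap (@mpolyC 4 k) (fun j : 'I_n => 'X_[scroll_exp j]).

HB.instance Definition _ := GRing.RMorphism.on scroll_map.

Definition ivar (j : nat) : T := 'X_(inord j).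

Lemma scroll_map_var j : (j < n)%N -> scroll_map (ivar j) = 'X_[scroll_exp j].
Proof. by move=> lt; rewrite /scroll_map mmapX mmap1U inordK. Qed.

Lemma scroll_mapC c : scroll_map c%:MP = c%:MP.
Proof. exact: mmapC. Qed.

Lemma scroll_mapZ c p : scroll_map (c *: p) = c *: scroll_map p.
Proof. by rewrite -mul_mpolyC rmorphM /= scroll_mapC mul_mpolyC. Qed.

Definition scroll_ideal : set T := ideal_span
  [set x | exists i j, [/\ (i < j)%N, (j < m)%N
    & x = ivar i * ivar j.+1 - ivar j * ivar i.+1]].

Let scroll_idealP : is_ideal scroll_ideal := ideal_spanP _.
Local Notation "x === y" := (scroll_ideal (x - y)) (at level 70).

Lemma congr_refl x : x === x.
Proof. by rewrite subrr; apply: ideal0. Qed.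

Lemma congr_sym x y : x === y -> y === x.
Proof. by move=> /(ideal_mull (-1) scroll_idealP); rewrite mulN1r opprB. Qed.

Lemma congr_trans y x z : x === y -> y === z -> x === z.
Proof. by move=> xy /(idealD scroll_idealP xy); rewrite addrA subrK. Qed.

Lemma congrM x y z : y === z -> x * y === x * z.
Proof. by rewrite -mulrBr; apply: ideal_mull. Qed.

(** The minor of the columns a and b moves one unit of index from one factor of
    y_a y_(b+1) to the other; this is iterated. *)
Lemma congr_yy i j i' j' : (i <= m)%N -> (j <= m)%N -> (i' <= m)%N -> (j' <= m)%N ->
  (i + j = i' + j')%N -> ivar i * ivar j === ivar i' * ivar j'.
Proof.
have step a b : (a < m)%N -> (b < m)%N -> ivar a * ivar b.+1 === ivar a.+1 * ivar b.
  move=> am bm; rewrite [ivar a.+1 * _]mulrC; have [ab|ba|->] := ltngtP a b.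
  - by apply: ideal_span_gen; exists a, b.
  - by apply: congr_sym; apply: ideal_span_gen; exists b, a.
  - exact: congr_refl.
have shift d a b : (a + d <= m)%N -> (b + d <= m)%N ->
    ivar a * ivar (b + d) === ivar (a + d) * ivar b.
  elim: d a b => [|d IH] a b ad bd; first by rewrite !addn0; apply: congr_refl.
  apply: (@congr_trans (ivar a.+1 * ivar (b + d))); first by rewrite addnS; apply: step; lia.
  by rewrite -[(a + d.+1)%N]addSnnS; apply: IH; lia.
move=> im jm i'm j'm e; have [le|lt] := leqP i i'.
  have := @shift (i' - i)%N i j'; rewrite subnKC //.
  have -> : (j' + (i' - i) = j)%N by lia.
  by apply; lia.
apply: congr_sym; have := @shift (i - i')%N i' j; rewrite subnKC ?(ltnW lt) //.
have -> : (j + (i - i') = j')%N by lia.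
by apply; lia.
Qed.

(** A monomial of degree d in the y_i whose indices sum to j, for j at most d m:
    it takes y_m as long as j allows, then one factor with the rest of j, then
    powers of y_0. *)
Fixpoint scroll_std (d j : nat) : T :=
  if d is d'.+1 then ivar (minn j m) * scroll_std d' (j - m) else 1.

(** Straightening: the first factor y_p of the standard monomial and y_l are
    replaced by two variables of which the first is as far right as possible, and
    the second is absorbed by induction. *)
Lemma scroll_stdM l d j : (l <= m)%N -> (j <= d * m)%N ->
  ivar l * scroll_std d j === scroll_std d.+1 (j + l).
Proof.
elim: d l j => [|d IH] l j lm.
  rewrite mul0n leqn0 => /eqP -> /=; rewrite add0n (minn_idPl lm).
  exact: congr_refl.
rewrite mulSn => jd; have lhs : scroll_std d.+1 j = ivar (minn j m) * scroll_std d (j - m) by [].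
have [mj|jm] := leqP m j.
  rewrite lhs (minn_idPr mj) -/(scroll_std d.+2 (j + l)).
  have -> : scroll_std d.+2 (j + l) = ivar m * scroll_std d.+1 ((j - m) + l).
    by rewrite [LHS]/(ivar _ * _) (minn_idPr _) ?(leq_trans mj) ?leq_addr // addnC -addnBA // addnC.
  by rewrite mulrCA; apply: congrM; apply: IH => //; lia.
have -> : scroll_std d.+2 (j + l) = ivar (minn (j + l) m) * scroll_std d.+1 (j + l - m) by [].
rewrite lhs (minn_idPl (ltnW jm)) (eqP (ltnW jm)).
set p := minn (j + l) m; set q := (j + l - m)%N.
have pq : (l + j = p + q)%N by rewrite /p /q; lia.
have [pm qm] : (p <= m)%N /\ (q <= m)%N by rewrite /p /q; lia.
apply: (@congr_trans (ivar p * (ivar q * scroll_std d 0))).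
  rewrite !mulrA; rewrite -mulrBl; apply: ideal_mulr => //.
  by apply: congr_yy => //; lia.
by apply: congrM; have := IH q 0%N qm; rewrite add0n; apply.
Qed.

Lemma scroll_map_std d j : (j <= d * m)%N ->
  scroll_map (scroll_std d j) = 'X_[U_(va) *+ (d * m - j) + U_(vb) *+ j].
Proof.
elim: d j => [|d IH] j.
  by rewrite mul0n leqn0 => /eqP ->; rewrite rmorph1 !mulm0n addm0 mpolyX0.
rewrite mulSn => jd /=; rewrite rmorphM /= IH; last lia.
have pm : (minn j m <= m)%N by rewrite geq_minr.
rewrite scroll_map_var; last lia.
rewrite /scroll_exp pm -mpolyXD; congr 'X_[_]; apply/mnmP => i.
rewrite !mnmDE !mulmnE !mnm1E; have : (minn j m + (j - m) = j)%N by lia.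
case: (va == i); case: (vb == i); lia.
Qed.

(** The standard monomial with image X^e, provided that m divides the degree of X^e in
    a and b. *)
Definition scroll_nf (e : 'X_{1..4}) : T :=
  scroll_std ((e va + e vb) %/ m) (e vb) * ivar m.+1 ^+ e vs * ivar m.+2 ^+ e vt.

Lemma mnm4P (e e' : 'X_{1..4}) : e va = e' va -> e vb = e' vb -> e vs = e' vs ->
  e vt = e' vt -> e = e'.
Proof.
move=> ha hb hs ht; apply/mnmP => i.
by case: i => -[|[|[|[|//]]]] lt; rewrite (bool_irrelevance lt isT).
Qed.

Lemma scroll_map_nf (e : 'X_{1..4}) : (m %| e va + e vb)%N -> scroll_map (scroll_nf e) = 'X_[e].
Proof.
move=> dv; rewrite !rmorphM !rmorphXn /= !scroll_map_var; try lia.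
have eb : (e vb <= (e va + e vb) %/ m * m)%N by rewrite divnK // leq_addl.
rewrite scroll_map_std // divnK // addnK /scroll_exp !ltnn !mpolyXn -!mpolyXD.
have [-> ->] : (m.+2 <= m)%N = false /\ (m.+2 == m.+1)%N = false by lia.
rewrite eqxx; congr 'X_[_].
by apply: mnm4P; rewrite !mnmDE !mulmnE !mnm1E /= ?mul0n ?mul1n ?addn0 ?add0n.
Qed.

(** The exponent of the image of a monomial. *)
Definition scroll_deg (mu : 'X_{1..n}) : 'X_{1..4} :=
  (\sum_(i < n) scroll_exp i *+ mu i)%MM.

Lemma scroll_map_mon mu : scroll_map 'X_[mu] = 'X_[scroll_deg mu].
Proof.
rewrite /scroll_map mmapX /mmap1 /scroll_deg -mprodXE.
by apply: eq_bigr => i _; rewrite mpolyXn.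
Qed.

Lemma scroll_degD i mu : scroll_deg (U_(i) + mu) = (scroll_exp i + scroll_deg mu)%MM.
Proof.
rewrite /scroll_deg (bigD1 i) //= [in RHS](bigD1 i) //= addmA; congr (_ + _)%MM.
  by rewrite mnmDE mnm1E eqxx add1n mulmS.
by apply: eq_bigr => j ne; rewrite mnmDE mnm1E eq_sym (negbTE ne).
Qed.

Lemma scroll_deg_dvd mu : (m %| scroll_deg mu va + scroll_deg mu vb)%N.
Proof.
elim/mnm_ind: mu => [|i mu IH].
  by rewrite /scroll_deg big1 ?mnm0E ?dvdn0 // => i _; rewrite mnm0E mulm0n.
rewrite scroll_degD !mnmDE addnACA dvdn_addl //.
rewrite /scroll_exp; case: ifP => [le|_]; last by case: ifP; rewrite !mnm1E.
by rewrite !mnmDE !mulmnE !mnm1E /= !mul1n !mul0n addn0 add0n subnK.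
Qed.

Lemma scroll_nf_mon mu : 'X_[mu] === scroll_nf (scroll_deg mu).
Proof.
elim/mnm_ind: mu => [|i mu IH].
  rewrite /scroll_deg big1 => [|i _]; last by rewrite mnm0E mulm0n.
  rewrite /scroll_nf !mnm0E div0n /= !mulr1 mpolyX0; exact: congr_refl.
rewrite mpolyXD scroll_degD; apply: (congr_trans (congrM _ IH)).
have dv := scroll_deg_dvd mu; set e := scroll_deg mu in dv *.
rewrite /scroll_nf !mnmDE /scroll_exp.
have -> : 'X_i = ivar i by rewrite /ivar inord_val.
case: ifP => [le|nle].
  rewrite !mnmDE !mulmnE !mnm1E /= !mul1n !mul0n addn0 !add0n.
  rewrite addnACA subnK // (@divnDl m (e va + e vb)) // divnn m_gt0 add1n.
  have : (e vb <= (e va + e vb) %/ m * m)%N by rewrite divnK // leq_addl.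
  rewrite [(i + _)%N]addnC => /(scroll_stdM le).
  move: (scroll_std _.+1 _) (scroll_std _ _) => x y key.
  set a := _ ^+ _; set b := _ ^+ _.
  have -> : ivar i * (y * a * b) - x * a * b = (ivar i * y - x) * (a * b) by ring.
  exact: ideal_mulr.
case: ifP => [/eqP ->|ne]; rewrite !mnm1E /= !add0n add1n exprS.
  rewrite !mulrA [ivar m.+1 * _]mulrC -!mulrA; exact: congr_refl.
have -> : nat_of_ord i = m.+2 by have := ltn_ord i; lia.
rewrite !mulrA [ivar m.+2 * _]mulrC -!mulrA [ivar m.+2 * (_ * _)]mulrCA; exact: congr_refl.
Qed.

(** A section of the parametrization over its image, extended by 0 to the
    monomials outside the image. *)
Definition scroll_sect : S -> T :=
  lin_ext (fun e : 'X_{1..4} => if (m %| e va + e vb)%N then scroll_nf e else 0).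

HB.instance Definition _ := GRing.Linear.on scroll_sect.

(** Every p is congruent to its normal form, which depends only on the image
    of p. *)
Lemma scroll_ker p : scroll_map p = 0 <-> scroll_ideal p.
Proof.
split=> [p0|].
  suff : p === scroll_sect (scroll_map p) by rewrite p0 linear0 subr0.
  elim/mpoly_linear_ind: p {p0} => [|p q IHp IHq|c p IH|mu].
  - by rewrite rmorph0 linear0; apply: congr_refl.
  - have -> : scroll_sect (scroll_map (p + q))
            = scroll_sect (scroll_map p) + scroll_sect (scroll_map q).
      by rewrite rmorphD; apply: linearD.
    by rewrite opprD addrACA; apply: (idealD scroll_idealP IHp IHq).
  - rewrite scroll_mapZ linearZ -scalerBr -mul_mpolyC; exact: ideal_mull.
  - by rewrite scroll_map_mon /scroll_sect lin_extX scroll_deg_dvd; apply: scroll_nf_mon.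
apply: (ideal_span_sub (I := [set x | scroll_map x = 0])).
  exact: (ideal_preimage scroll_map (ideal_zero S)).
move=> _ [i [j [ij jm ->]]] /=; rewrite rmorphB !rmorphM /= !scroll_map_var; try lia.
apply/eqP; rewrite subr_eq0 -!mpolyXD; apply/eqP; congr 'X_[_].
rewrite /scroll_exp !ifT; try lia.
by apply/mnmP => l; rewrite !mnmDE !mulmnE; case: (U_(va)%MM l); case: (U_(vb)%MM l); nia.
Qed.

End Scroll.

Arguments scroll_map {k m} _.
Arguments scroll_sect {k m} _.
Arguments ivar {k m} j.

(** * Quotients by the equations of the scroll *)

Section Factor.
Variables (T A S : comPzRingType) (Psi : {rmorphism T -> A}) (Phi : {rmorphism T -> S}).
Hypothesis Psi_onto : forall a, exists x, Psi x = a.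
Hypothesis Psi_Phi : forall x, Psi x = 0 <-> Phi x = 0.

Lemma factor_eq x y : Psi x = Psi y <-> Phi x = Phi y.
Proof.
have E (B : comPzRingType) (f : {rmorphism T -> B}) : f x = f y <-> f (x - y) = 0.
  by rewrite rmorphB; split=> [->|/eqP]; rewrite ?subrr // subr_eq0 => /eqP.
by rewrite !E.
Qed.

(** The kernel hypothesis is an argument so that the ring morphism structure, whose
    proof needs it, can be inferred. *)
Definition factor_def (_ : forall x, Psi x = 0 <-> Phi x = 0) (a : A) : S :=
  Phi (sval (cid (Psi_onto a))).
Local Notation factor := (factor_def Psi_Phi).

Lemma factorE x : factor (Psi x) = Phi x.
Proof. by rewrite /factor_def; case: cid => y /= /factor_eq. Qed.

Fact factor_zmod : zmod_morphism factor.
Proof.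
move=> a b; have [[x <-] [y <-]] := (Psi_onto a, Psi_onto b).
by rewrite -rmorphB !factorE rmorphB.
Qed.

Fact factor_monoid : monoid_morphism factor.
Proof.
split=> [|a b]; first by rewrite -(rmorph1 Psi) factorE rmorph1.
have [[x <-] [y <-]] := (Psi_onto a, Psi_onto b).
by rewrite -rmorphM !factorE rmorphM.
Qed.

HB.instance Definition _ := GRing.isZmodMorphism.Build A S factor factor_zmod.
HB.instance Definition _ := GRing.isMonoidMorphism.Build A S factor factor_monoid.

Lemma factor_inj : injective factor.
Proof.
move=> a b; have [[x <-] [y <-]] := (Psi_onto a, Psi_onto b).
by rewrite !factorE => /factor_eq.
Qed.

End Factor.

Lemma peval_map (k : fieldType) r (B : comNzRingType) (phi : {rmorphism {mpoly k[r]} -> B}) q z :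
  phi (peval q z) = (map_poly (phi \o @mpolyC r k) q).[phi z].
Proof. by rewrite /peval -horner_map -map_poly_comp. Qed.

Section ScrollCM.
Variables (k : fieldType) (m : nat).
Hypothesis m_gt0 : (0 < m)%N.
Local Notation n := m.+3.
Local Notation T := {mpoly k[n]}.
Local Notation S := {mpoly k[4]}.

(** Multiplication by a monomial of the image sends the monomials of the image
    into the image and the others to others, so projecting S to the image along
    the other monomials is linear over the image. *)
Lemma scroll_map_sectM (x : T) (p : S) :
  scroll_map (scroll_sect (m := m) (scroll_map x * p)) = scroll_map (x * scroll_sect p).
Proof.
elim/mpoly_linear_ind: x => [|x y IHx IHy|c x IH|mu].
- by rewrite rmorph0 !mul0r linear0 rmorph0.
- have -> : scroll_map (x + y) * p = scroll_map x * p + scroll_map y * p.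
    by rewrite rmorphD mulrDl.
  have -> : scroll_sect (scroll_map x * p + scroll_map y * p)
          = scroll_sect (scroll_map x * p) + scroll_sect (scroll_map y * p) :> T.
    exact: linearD.
  by rewrite mulrDl !(rmorphD scroll_map) /= IHx IHy.
- rewrite scroll_mapZ -!scalerAl scroll_mapZ -IH -scroll_mapZ; congr scroll_map.
  exact: linearZ.
elim/mpoly_linear_ind: p => [|p q IHp IHq|c p IH|e].
- by rewrite linear0 !mulr0 linear0.
- have -> : scroll_sect (p + q) = scroll_sect p + scroll_sect q :> T by apply: linearD.
  rewrite !mulrDr (rmorphD scroll_map) /= -IHp -IHq -(rmorphD scroll_map) /=.
  congr scroll_map; exact: linearD.
- have -> : scroll_sect (c *: p) = c *: scroll_sect p :> T by apply: linearZ.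
  rewrite -!scalerAr scroll_mapZ -IH -scroll_mapZ; congr scroll_map.
  exact: linearZ.
rewrite rmorphM /= scroll_map_mon -mpolyXD /scroll_sect !lin_extX !mnmDE addnACA.
rewrite dvdn_addr ?scroll_deg_dvd //; case: ifP => dv; last by rewrite rmorph0 mulr0.
by rewrite !scroll_map_nf // ?mpolyXD // !mnmDE addnACA dvdn_add ?scroll_deg_dvd.
Qed.

(** y_0, y_m, s, t, which are parameters because they map to powers of the
    variables of S. *)
Definition scroll_par (i : 'I_4) : T :=
  ivar (nth 0%N [:: 0%N; m; m.+1; m.+2] i).

Definition par_exp (i : 'I_4) : nat := nth 0%N [:: m; m; 1%N; 1%N] i.

Lemma scroll_map_par i : scroll_map (scroll_par i) = 'X_i ^+ par_exp i.
Proof.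
rewrite /scroll_par /par_exp mpolyXn.
case: i => -[|[|[|[|//]]]] lt; rewrite (bool_irrelevance lt isT) /= scroll_map_var;
  rewrite /scroll_exp ?leq0n ?leqnn ?ltnn ?eqxx ?subn0 ?subnn ?mulm0n ?addm0 ?add0m
    ?mulm1n //; try lia.
by rewrite ifF ?ifF //; lia.
Qed.

Variables (A : comPzRingType) (Psi : {rmorphism T -> A}).
Hypothesis Psi_onto : forall a, exists x, Psi x = a.
Hypothesis Psi_ker : forall x, Psi x = 0 <-> scroll_map x = 0.

Let iota : {rmorphism k -> A} := Psi \o @mpolyC n k.

(** A maps injectively to S with an A-linear retraction. By algebraicity of residue
    fields every maximal ideal of A contains nonzero polynomials in each of the
    four parameters; they map to univariate polynomials in distinct variables of
    S, hence form a regular sequence in S and, through the retraction, in A. *)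
Lemma scroll_cohen_macaulay : cohen_macaulay A /\ krull_dim A 4.
Proof.
pose Theta : {rmorphism A -> S} := factor_def Psi_onto Psi_ker.
have ThetaE x : Theta (Psi x) = scroll_map x by apply: factorE.
pose tau : {additive S -> A} := Psi \o scroll_sect.
apply: (@cohen_macaulay_dim k A iota 4).
- exact: noetherian_onto Psi_onto (@noetherian_mpoly k n).
- apply: (alg_dependent_inj (Theta := Theta) (iota' := @mpolyC 4 k)).
  + exact: factor_inj.
  + by move=> c; rewrite ThetaE scroll_mapC.
  + exact: alg_dependent_mpoly.
- move/(congr1 Theta)/eqP; rewrite rmorph1 rmorph0; exact/negP/oner_neq0.
move=> P mP.
have mPt := maximal_preimage Psi_onto mP.
have /choice [q qP] : forall i, exists q : {poly k}, q != 0 /\ P (Psi (peval q (scroll_par i))).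
  by move=> i; have [q q0 Pq] := residue_algebraic (scroll_par i) mPt; exists q.
exists [seq Psi (peval (q i) (scroll_par i)) | i <- enum 'I_4]; split.
- by move=> _ /= /mapP[i _ ->]; case: (qP i).
- apply: (weakly_regular_retract (Theta := Theta) (tau := tau)).
  + move=> a p; have [x <-] := Psi_onto a; rewrite ThetaE /= -rmorphM.
    by apply/(factor_eq Psi_ker); apply: scroll_map_sectM.
  + rewrite -[RHS](rmorph1 Psi); apply/(factor_eq Psi_ker).
    have e1 : scroll_sect (1 : S) = scroll_nf k m 0%MM.
      by rewrite -mpolyX0 /scroll_sect lin_extX !mnm0E dvdn0.
    rewrite [LHS](_ : _ = scroll_map (scroll_nf k m 0%MM)); last by rewrite -e1.
    by rewrite scroll_map_nf ?mpolyX0 ?rmorph1 // !mnm0E.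
  rewrite -map_comp.
  have -> : map (Theta \o (fun i => Psi (peval (q i) (scroll_par i)))) (enum 'I_4)
          = [seq peval (q i \Po 'X^(par_exp i)) 'X_i | i <- enum 'I_4].
    apply: eq_map => i; rewrite [LHS]ThetaE (peval_map scroll_map) /= scroll_map_par.
    rewrite /peval map_comp_poly horner_comp map_polyXn hornerXn.
    congr (_.[_]); apply: eq_map_poly => c; exact: scroll_mapC.
  apply: weakly_regular_separated => i; rewrite comp_poly_eq0; first by case: (qP i).
  rewrite size_polyXn ltnS /par_exp.
  by case: i => -[|[|[|[|//]]]].
- by rewrite size_map size_enum_ord.
Qed.

End ScrollCM.
(** * Fiber rings of ideals generated by forms of one degree *)

Section QuotientMorphism.
Variables (k : comNzRingType) (A : comAlgType k) (S : set A).

Fact quot_pi_zmod : zmod_morphism (@quot_pi k A S).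
Proof.
move=> x y; have := quot_piD S (x - y) y; rewrite subrK => ->.
by rewrite addrK.
Qed.

Fact quot_pi_monoid : monoid_morphism (@quot_pi k A S).
Proof. by split=> [|x y]; rewrite ?quot_piM. Qed.

HB.instance Definition _ :=
  GRing.isZmodMorphism.Build A (quot_alg S) (@quot_pi k A S) quot_pi_zmod.
HB.instance Definition _ :=
  GRing.isMonoidMorphism.Build A (quot_alg S) (@quot_pi k A S) quot_pi_monoid.

Lemma quot_pi_eq0 x : quot_pi S x = 0 <-> ideal_span S x.
Proof.
rewrite -(rmorph0 (@quot_pi k A S)); split.
  by move/quot_piP; rewrite subr0 => /asboolP.
by move=> Sx; apply/quot_piP; rewrite subr0; apply/asboolP.
Qed.

Lemma quot_pi_onto (y : quot_alg S) : exists x, quot_pi S x = y.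
Proof. by exists (quot_repr y); apply: quot_reprK. Qed.

End QuotientMorphism.

Section Order.
Variables (k : fieldType) (n : nat).
Local Notation R := {mpoly k[n]}.

(** The power R_+^e of the irrelevant ideal. *)
Definition ord_ge (e : nat) : set R := [set p | forall mu, mu \in msupp p -> (e <= mdeg mu)%N].

Lemma ord_geM e e' p q : ord_ge e p -> ord_ge e' q -> ord_ge (e + e') (p * q).
Proof.
move=> pe qe mu /msuppM_le /allpairsP[[a b] /= [ap bq ->]].
by rewrite mdegD leq_add ?pe ?qe.
Qed.

Lemma ord_ge_ideal e : is_ideal (ord_ge e).
Proof.
split=> [mu|p q pe qe mu|a p pe]; first by rewrite msupp0.
  by move=> /msuppD_le; rewrite mem_cat => /orP[/pe|/qe].
by have := @ord_geM 0 e a p; apply=> // mu.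
Qed.

Lemma ord_ge_homog e p : p \is e.-homog -> ord_ge e p.
Proof. by move=> /dhomogP pe mu /pe ->. Qed.

Lemma ord_ge_homog0 e p : p \is e.-homog -> ord_ge e.+1 p -> p = 0.
Proof.
move=> /dhomogP pe pge; apply/mpolyP => mu; rewrite mcoeff0; apply: memN_msupp_eq0.
by apply/negP => mup; have := pge _ mup; rewrite pe // ltnn.
Qed.

Lemma mcoeff_pihomog d (p : R) mu :
  (pihomog mdeg d p)@_mu = if mdeg mu == d then p@_mu else 0.
Proof.
elim/mpoly_linear_ind: p => [|p q IHp IHq|c p IH|nu].
- by rewrite linear0 !mcoeff0 if_same.
- by rewrite linearD !mcoeffD IHp IHq; case: ifP => //; rewrite addr0.
- by rewrite linearZ !mcoeffZ IH; case: ifP => //; rewrite mulr0.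
rewrite pihomogX; case: ifP => [/eqP <-|ne]; rewrite ?mcoeff0 mcoeffX.
  by case: (nu =P mu) => [->|]; rewrite ?eqxx ?if_same.
by case: (nu =P mu) => [<-|]; rewrite ?ne ?if_same.
Qed.

Lemma ord_ge_pihomog e (p : R) : ord_ge e p -> ord_ge e.+1 (p - pihomog mdeg e p).
Proof.
move=> pe mu; rewrite mcoeff_msupp mcoeffB mcoeff_pihomog.
case: ifP => [_|ne]; first by rewrite subrr eqxx.
by rewrite subr0 ltn_neqAle [e == _]eq_sym ne -mcoeff_msupp => /pe.
Qed.

Lemma irrelevant_ideal : is_ideal (@irrelevant n k).
Proof. exact: ideal_spanP. Qed.

Lemma irrelevantP (p : R) : irrelevant p <-> p@_0%MM = 0.
Proof.
split.
  case=> d [c [g [gX ->]]]; rewrite raddf_sum big1 // => i _ /=.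
  have [j _ <-] := gX i; rewrite mcoeffM big1 // => -[a b] /= /eqP.
  move=> e; rewrite mcoeffX; case: eqP => [ej|]; last by rewrite mulr0.
  by move/eqP: e; rewrite eq_sym mnmD_eq0 -ej mnm1_eq0 andbF.
move=> p0; rewrite (mpolyE p) big_seq; apply: ideal_sum => [|mu]; first exact: irrelevant_ideal.
rewrite mcoeff_msupp => nz; rewrite -mul_mpolyC; apply: ideal_mull; first exact: irrelevant_ideal.
have [i mi] : exists i, mu i != 0%N.
  apply: contrapT => no; case/eqP: nz; rewrite -p0; congr (p@__); apply/mnmP => i.
  by rewrite mnm0E; apply/eqP; apply: contrapT => /negP mi; apply: no; exists i.
have le : (U_(i) <= mu)%MM by rewrite lep1mP.
rewrite -(submK le) mpolyXD; apply: ideal_mull; first exact: irrelevant_ideal.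
by apply: ideal_span_gen; exists i.
Qed.

Lemma irrelevant_ord_ge (p : R) : irrelevant p -> ord_ge 1 p.
Proof.
move=> /irrelevantP p0 mu mup; rewrite lt0n mdeg_eq0; apply/eqP => e.
by rewrite e mcoeff_msupp p0 eqxx in mup.
Qed.

End Order.

Section Fiber.
Variables (k : fieldType) (n : nat) (G : 'I_n -> {mpoly k[n]}) (delta : nat).
Local Notation R := {mpoly k[n]}.
Local Notation J := (ideal_span (range G)).
Hypothesis G_homog : forall i, G i \is delta.-homog.

Definition gens_eval : R -> R := mmap (@mpolyC n k) G.
HB.instance Definition _ := GRing.RMorphism.on gens_eval.

Lemma gens_evalX i : gens_eval 'X_i = G i.
Proof. by rewrite /gens_eval mmapX mmap1U. Qed.

Lemma gens_evalZ c p : gens_eval (c *: p) = c *: gens_eval p.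
Proof. by rewrite -mul_mpolyC rmorphM /= [gens_eval _%:MP]mmapC mul_mpolyC. Qed.

Lemma genJ i : J (G i).
Proof. by apply: ideal_span_gen; exists i. Qed.

Lemma ideal_exp_mul d a b : J a -> ideal_exp J d b -> ideal_exp J d.+1 (a * b).
Proof. by move=> Ja Jb; apply: ideal_span_gen; exists a, b. Qed.

Lemma ideal_expS_sub d K : is_ideal K ->
  (forall i b, ideal_exp J d b -> K (G i * b)) -> ideal_exp J d.+1 `<=` K.
Proof.
move=> hK KG; apply: ideal_span_sub => // _ [a [b [Ja Jb ->]]].
have [c [v [g [vg ->]]]] := Ja; rewrite mulr_suml; apply: ideal_sum => // i _.
have [j _ <-] := vg i; rewrite -mulrA; apply: ideal_mull => //; exact: KG.
Qed.

Lemma gens_eval_mon mu :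
  ideal_exp J (mdeg mu) (gens_eval 'X_[mu]) /\
  gens_eval 'X_[mu] \is (delta * mdeg mu).-homog.
Proof.
elim/mnm_ind: mu => [|i mu [IH1 IH2]].
  by rewrite mpolyX0 rmorph1 mdeg0 muln0; split=> //; apply: dhomog1.
rewrite mdegD mdeg1 add1n mpolyXD rmorphM /= gens_evalX; split.
  by apply: ideal_exp_mul => //; apply: genJ.
by rewrite mulnS; apply: dhomogM.
Qed.

Lemma gens_eval_homog d Q : Q \is d.-homog ->
  ideal_exp J d (gens_eval Q) /\ gens_eval Q \is (delta * d).-homog.
Proof.
move=> /dhomogP Qd; rewrite (mpolyE Q) raddf_sum /= big_seq; split.
  apply: ideal_sum => [|mu /Qd mud]; first exact: ideal_expP.
  rewrite gens_evalZ -mul_mpolyC; apply: ideal_mull; first exact: ideal_expP.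
  by rewrite -mud; case: (gens_eval_mon mu).
apply: rpred_sum => mu /Qd mud; rewrite gens_evalZ; apply: rpredZ.
by rewrite -mud; case: (gens_eval_mon mu).
Qed.

Lemma ideal_exp_ord_ge d h : ideal_exp J d h -> ord_ge (delta * d) h.
Proof.
elim: d h => [|d IH] h; first by rewrite muln0.
apply: ideal_expS_sub => [|i b /IH]; first exact: ord_ge_ideal.
by rewrite mulnS; apply: ord_geM; apply: ord_ge_homog.
Qed.

Definition irr_exp d : set R := ideal_mul (@irrelevant n k) (ideal_exp J d).

Lemma irr_exp_ideal d : is_ideal (irr_exp d).
Proof. exact: ideal_spanP. Qed.

Lemma irr_exp_mul d a b : irrelevant a -> ideal_exp J d b -> irr_exp d (a * b).
Proof. by move=> ia Jb; apply: ideal_span_gen; exists a, b. Qed.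

Lemma irr_exp_ord_ge d h : irr_exp d h -> ord_ge (delta * d).+1 h.
Proof.
apply: ideal_span_sub => [|_ [a [b [ia Jb ->]]]]; first exact: ord_ge_ideal.
by rewrite -add1n; apply: ord_geM; [apply: irrelevant_ord_ge|apply: ideal_exp_ord_ge].
Qed.

Lemma irr_exp_sub d : irr_exp d `<=` ideal_exp J d.
Proof.
apply: ideal_span_sub => [|_ [a [b [ia Jb ->]]]]; first exact: ideal_expP.
by apply: ideal_mull => //; apply: ideal_expP.
Qed.

Lemma irrelevant_subC (x : R) : irrelevant (x - (x@_0%MM)%:MP).
Proof. by apply/irrelevantP; rewrite mcoeffB mcoeffC eqxx mulr1 subrr. Qed.

(** In an expression of h by products of d generators, replacing each
    coefficient by its constant term changes h by an element of R_+ J^d. *)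
Lemma ideal_exp_gens_eval d h : ideal_exp J d h ->
  exists2 Q, Q \is d.-homog & irr_exp d (h - gens_eval Q).
Proof.
have KP e : is_ideal [set h | exists2 Q, Q \is e.-homog & irr_exp e (h - gens_eval Q)].
  have hI := irr_exp_ideal e; split.
  - by exists 0; rewrite ?rpred0 // rmorph0 subrr; apply: ideal0.
  - move=> x y [Q Qe xQ] [Q' Qe' yQ]; exists (Q + Q'); first exact: rpredD.
    by rewrite rmorphD opprD addrACA; apply: idealD.
  - move=> a x [Q Qe xQ]; exists (a@_0%MM *: Q); first exact: rpredZ.
    have -> : a * x - gens_eval (a@_0%MM *: Q) =
              a * (x - gens_eval Q) + (a - (a@_0%MM)%:MP) * gens_eval Q.
      by rewrite gens_evalZ -mul_mpolyC; ring.
    apply: idealD => //; first exact: ideal_mull.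
    apply: irr_exp_mul; first exact: irrelevant_subC.
    by case: (gens_eval_homog Qe).
elim: d h => [|d IH] h.
  move=> _; exists (h@_0%MM)%:MP.
    by rewrite -alg_mpolyC; apply/rpredZ/dhomog1.
  rewrite [gens_eval _]mmapC -[_ - _]mulr1; apply: irr_exp_mul => //.
  exact: irrelevant_subC.
apply: (ideal_expS_sub (KP d.+1)) => i b /IH [Q Qd bQ].
exists ('X_i * Q).
  by rewrite -[d.+1]add1n; apply: dhomogM => //; rewrite dhomogX; apply/eqP/mdeg1.
rewrite rmorphM /= gens_evalX -mulrBr; move: bQ.
have -> : irr_exp d.+1 (G i * (b - gens_eval Q)) =
          [set x | irr_exp d.+1 (G i * x)] (b - gens_eval Q) by [].
have hI := irr_exp_ideal d.+1.
apply: ideal_span_sub => [|_ [x [y [ix Jy ->]]]] /=.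
  split=> [|x y|a x] /=; rewrite ?mulr0 ?mulrDr ?[_ * (a * _)]mulrCA.
  - exact: ideal0.
  - exact: idealD.
  - exact: ideal_mull.
rewrite mulrCA; apply: irr_exp_mul => //; apply: ideal_exp_mul => //; exact: genJ.
Qed.

Fact rees_gen_subproof i : (G i)%:P * 'X \in rees_pred J.
Proof.
apply/rees_predP => j; rewrite coefMX coefC; case: j => [//|[|j]]; last first.
  by apply: ideal0; apply: ideal_expP.
by rewrite /= -[G i]mulr1; apply: (@ideal_exp_mul 0 (G i) 1 (genJ i)).
Qed.

Definition rees_gen i : rees J := Rees (rees_gen_subproof i).

Fact rees_const_zmod : zmod_morphism (@rees_const n k J).
Proof. by move=> a b; apply/val_inj; rewrite /= !rmorphB. Qed.

Fact rees_const_monoid : monoid_morphism (@rees_const n k J).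
Proof. by split=> [|a b]; apply/val_inj; rewrite /= ?rmorph1 ?rmorphM. Qed.

HB.instance Definition _ :=
  GRing.isZmodMorphism.Build k (rees J) (@rees_const n k J) rees_const_zmod.
HB.instance Definition _ :=
  GRing.isMonoidMorphism.Build k (rees J) (@rees_const n k J) rees_const_monoid.

Definition rees_eval : R -> rees J := mmap (@rees_const n k J) rees_gen.
HB.instance Definition _ := GRing.RMorphism.on rees_eval.

Lemma rees_evalZ c p : rees_eval (c *: p) = c *: rees_eval p.
Proof. by rewrite /rees_eval mmapZ. Qed.

Lemma rees_eval_mon mu :
  rees_val (rees_eval 'X_[mu]) = (gens_eval 'X_[mu])%:P * 'X^(mdeg mu).
Proof.
elim/mnm_ind: mu => [|i mu IH]; first by rewrite mpolyX0 !rmorph1 mdeg0 expr0 mulr1.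
rewrite mpolyXD !rmorphM /= IH gens_evalX /rees_eval mmapX mmap1U /=.
by rewrite mdegD mdeg1 add1n exprS; ring.
Qed.

Lemma rees_eval_coef Q d : (rees_val (rees_eval Q))`_d = gens_eval (pihomog mdeg d Q).
Proof.
elim/mpoly_linear_ind: Q => [|p q IHp IHq|c p IH|mu].
- by rewrite !raddf0 /= coef0.
- by rewrite !raddfD /= coefD IHp IHq.
- rewrite linearZ rees_evalZ gens_evalZ -IH.
  have -> : rees_val (c *: rees_eval p) = (c%:MP)%:P * rees_val (rees_eval p) by [].
  by rewrite coefCM mul_mpolyC.
rewrite rees_eval_mon pihomogX coefCM coefXn eq_sym; case: eqP => _.
  by rewrite mulr1.
by rewrite mulr0 rmorph0.
Qed.

Lemma rees_val_sum (I : Type) (r : seq I) (P : pred I) (F : I -> rees J) :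
  rees_val (\sum_(i <- r | P i) F i) = \sum_(i <- r | P i) rees_val (F i).
Proof. exact: (big_morph (@rees_val n k J)). Qed.

Definition fiber_ideal : set (rees J) := ideal_span
  [set p : rees J | exists2 a : R, irrelevant a & rees_val p = a%:P].

(** The ideal generated by R_+ in the Rees algebra is graded by the powers
    of t. *)
Lemma fiber_idealP (p : rees J) : fiber_ideal p <-> forall d, irr_exp d p`_d.
Proof.
split.
  case=> c [v [g [gi ->]]] d; rewrite rees_val_sum coef_sum.
  apply: ideal_sum => [|i _]; first exact: irr_exp_ideal.
  have [a ia ga] := gi i; rewrite /= ga coefMC mulrC; apply: irr_exp_mul => //.
  by have /rees_predP := valP (v i).
move=> pI; have hI : is_ideal fiber_ideal := ideal_spanP _.
have monP d b : ideal_exp J d b -> b%:P * 'X^d \in rees_pred J.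
  move=> Jb; apply/rees_predP => j; rewrite coefCM coefXn; case: eqP => [->|_].
    by rewrite mulr1.
  by rewrite mulr0; apply: ideal0; apply: ideal_expP.
have monI d b (Jb : ideal_exp J d b) : irr_exp d b -> fiber_ideal (Rees (monP d b Jb)).
  move=> Ib; have [c [v [g [gi eb]]]] := Ib.
  have gJ i : ideal_exp J d (v i * g i).
    apply: ideal_mull; first exact: ideal_expP.
    by apply: irr_exp_sub; apply: ideal_span_gen; apply: gi.
  have -> : Rees (monP d b Jb) = \sum_i Rees (monP d _ (gJ i)).
    apply/val_inj; rewrite [RHS]rees_val_sum /= eb rmorph_sum mulr_suml.
    by apply: eq_bigr => i _.
  apply: ideal_sum => // i _; have [x [y [ix Jy gxy]]] := gi i.
  have Jvy : ideal_exp J d (v i * y) by apply: ideal_mull => //; apply: ideal_expP.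
  have xP : x%:P \in rees_pred J.
    by apply/rees_predP => -[|j] //; rewrite coefC; apply: (ideal0 (ideal_expP J j.+1)).
  have -> : Rees (monP d _ (gJ i)) = Rees (monP d _ Jvy) * Rees xP.
    by apply/val_inj; rewrite /= gxy; rewrite !polyCM; ring.
  by apply: ideal_mull => //; apply: ideal_span_gen; exists x.
have pJ d : ideal_exp J d p`_d by have /rees_predP := valP p.
have -> : p = \sum_(d < size p) Rees (monP d _ (pJ d)).
  apply/val_inj; rewrite [RHS]rees_val_sum /= -[LHS]coefK poly_def.
  by apply: eq_bigr => d _; rewrite /= mul_polyC.
by apply: ideal_sum => // d _; apply: monI.
Qed.

Definition fiber_map : R -> special_fiber J := fun Q => quot_pi _ (rees_eval Q).

Fact fiber_map_zmod : zmod_morphism fiber_map.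
Proof. by move=> p q; rewrite /fiber_map rmorphB; apply: quot_pi_zmod. Qed.

Fact fiber_map_monoid : monoid_morphism fiber_map.
Proof.
split; first by rewrite /fiber_map rmorph1.
by move=> p q; rewrite /fiber_map rmorphM; apply: quot_piM.
Qed.

HB.instance Definition _ :=
  GRing.isZmodMorphism.Build R (special_fiber J) fiber_map fiber_map_zmod.
HB.instance Definition _ :=
  GRing.isMonoidMorphism.Build R (special_fiber J) fiber_map fiber_map_monoid.

Lemma fiber_mapZ c p : fiber_map (c *: p) = c *: fiber_map p.
Proof. by rewrite /fiber_map rees_evalZ; apply: quot_piZ. Qed.

Lemma fiber_map_onto y : exists Q, fiber_map Q = y.
Proof.
have [p <-] := quot_pi_onto y.
have pJ d : ideal_exp J d p`_d by have /rees_predP := valP p.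
have /choice [Q QP] : forall d, exists Q, Q \is d.-homog /\ irr_exp d (p`_d - gens_eval Q).
  by move=> d; have [Q] := ideal_exp_gens_eval (pJ d); exists Q.
exists (\sum_(d < size p) Q d); apply/quot_piP.
apply/asboolP; apply/fiber_idealP => d.
set Y := rees_eval _; have -> : rees_val (Y - p) = rees_val Y - rees_val p by [].
rewrite coefB rees_eval_coef linear_sum /=.
have -> : \sum_(i < size p) pihomog mdeg d (Q i) = if (d < size p)%N then Q d else 0.
  have E (i : 'I_(size p)) : pihomog mdeg d (Q i) = if i == d :> nat then Q i else 0.
    have [Qi _] := QP i; case: eqP => [<-|/eqP ne]; first exact: pihomog_dE.
    by rewrite (pihomog_ne0 _ Qi) // eq_sym.
  rewrite (eq_bigr _ (fun i _ => E i)); case: ifP => [lt|nlt].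
    rewrite (bigD1 (Ordinal lt)) //= eqxx big1 ?addr0 // => i ne.
    by case: eqP => // e; case/eqP: ne; apply: val_inj.
  by rewrite big1 // => i _; case: eqP => // e; rewrite -e ltn_ord in nlt.
have hI := irr_exp_ideal d.
case: ifP => [_|/negbT]; last first.
  by rewrite -leqNgt rmorph0 => le; rewrite nth_default // subr0; apply: ideal0.
by rewrite -opprB -mulN1r; apply: ideal_mull => //; case: (QP d).
Qed.

(** A form of degree d in the generators has degree delta d in the variables,
    while R_+ J^d starts in degree delta d + 1; so a form of degree d is a relation
    in the fiber ring only if it is one among the generators themselves. *)
Lemma fiber_map_ker Q :
  fiber_map Q = 0 <-> forall d, gens_eval (pihomog mdeg d Q) = 0.
Proof.
have E : fiber_map Q = 0 <-> forall d, irr_exp d (gens_eval (pihomog mdeg d Q)).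
  rewrite [fiber_map Q = 0](quot_pi_eq0 _ (rees_eval Q)); split.
    by move=> /fiber_idealP H d; rewrite -rees_eval_coef.
  by move=> H; apply/fiber_idealP => d; rewrite rees_eval_coef.
rewrite E; split=> H d; last by rewrite H; apply: ideal0; apply: irr_exp_ideal.
have [_ hd] := gens_eval_homog (pihomogP mdeg d Q).
by apply: (ord_ge_homog0 hd); apply: irr_exp_ord_ge.
Qed.

End Fiber.

(** * The partial derivatives of f *)

Lemma mderiv_var (k : fieldType) n (i j : 'I_n) :
  ('X_j : {mpoly k[n]})^`M(i) = (i == j)%:R.
Proof.
rewrite mderivX mnm1E eq_sym; case: eqP => [->|_]; last by rewrite scale0r.
by rewrite -{1}[U_(j)%MM]add0m addmK mpolyX0 scale1r.
Qed.

Section Form.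
Variables (k : fieldType) (m : nat).
Local Notation n := m.+3.
Local Notation R := {mpoly k[n]}.
Local Notation S := {mpoly k[4]}.
Local Notation w := (ivar m.+1 : R).
Local Notation u := (ivar m.+2 : R).

Lemma xvar_ivar j : (j < n)%N -> xvar k n j.+1 = ivar j.
Proof.
move=> lt; rewrite /xvar /= insubT /ivar; congr 'X_ _; apply: val_inj.
by rewrite /= inordK.
Qed.

Lemma form_fE : form_f k n = 2%:R * w ^+ m.+2 * u
  + \sum_(j < m.+1) ivar j * w ^+ j * u ^+ (m.+2 - j).
Proof.
rewrite /form_f /= !xvar_ivar //; congr (_ + _).
rewrite big_add1 /= big_mkord; apply: eq_bigr => j _.
by rewrite xvar_ivar //; have := ltn_ord j; lia.
Qed.

(** The partial derivatives of f, as [mderiv_form] shows; indices are natural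
    numbers, so that the relations between neighbours are easy to write. *)
Definition grad_w : R := (2 * m.+2)%:R * w ^+ m.+1 * u
  + \sum_(j < m.+1) j%:R * ivar j * w ^+ j.-1 * u ^+ (m.+2 - j).
Definition grad_u : R := 2%:R * w ^+ m.+2
  + \sum_(j < m.+1) (m.+2 - j)%:R * ivar j * w ^+ j * u ^+ (m.+1 - j).
Definition grad (j : nat) : R :=
  if (j <= m)%N then w ^+ j * u ^+ (m.+2 - j)
  else if j == m.+1 then grad_w else grad_u.

Lemma mderivXn i (p : R) d : (p ^+ d)^`M(i) = d%:R * p ^+ d.-1 * p^`M(i).
Proof.
elim: d => [|d IH]; first by rewrite expr0 -mpolyC1 mderivC !mul0r.
rewrite exprS mderivM IH; case: d {IH} => [|d] /=; first by rewrite !expr0; ring.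
by rewrite exprS; ring.
Qed.

Lemma mderiv_ivar (i : 'I_n) j : (j < n)%N -> (ivar j : R)^`M(i) = (i == j :> nat)%:R.
Proof.
by move=> lt; rewrite /ivar mderiv_var -val_eqE /= inordK. Qed.

Lemma mderiv_form (i : 'I_n) : (form_f k n)^`M(i) = grad i.
Proof.
have jn (j : 'I_m.+1) : (j < n)%N by have := ltn_ord j; lia.
have d2 : (2%:R : R)^`M(i) = 0 by rewrite -mpolyC_nat mderivC.
have dj (j : 'I_m.+1) : (ivar j * w ^+ j * u ^+ (m.+2 - j))^`M(i) =
    (i == j :> nat)%:R * (w ^+ j * u ^+ (m.+2 - j))
    + (i == m.+1 :> nat)%:R * (j%:R * ivar j * w ^+ j.-1 * u ^+ (m.+2 - j))
    + (i == m.+2 :> nat)%:R * ((m.+2 - j)%:R * ivar j * w ^+ j * u ^+ (m.+1 - j)).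
  rewrite !mderivM !mderivXn !mderiv_ivar //.
  have -> : (m.+2 - j).-1 = (m.+1 - j)%N by lia.
  by ring.
rewrite form_fE mderivD (mderivM i (2%:R * w ^+ m.+2) u) (mderivM i 2%:R (w ^+ m.+2)).
rewrite d2 mderivXn !mderiv_ivar //.
have -> : (\sum_(j < m.+1) ivar j * w ^+ j * u ^+ (m.+2 - j))^`M(i) =
    \sum_(j < m.+1) (ivar j * w ^+ j * u ^+ (m.+2 - j))^`M(i).
  exact: raddf_sum.
rewrite (eq_bigr _ (fun j _ => dj j)) !big_split /= -!mulr_sumr /grad.
have [le|lt] := leqP i m.
  have [-> ->] : (i == m.+1 :> nat) = false /\ (i == m.+2 :> nat) = false by lia.
  have lei : (i < m.+1)%N by [].
  have -> : \sum_(j < m.+1) (i == j :> nat)%:R * (w ^+ j * u ^+ (m.+2 - j)) =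
            w ^+ i * u ^+ (m.+2 - i).
    rewrite (bigD1 (Ordinal lei)) //= eqxx mul1r big1 ?addr0 // => j ne.
    case: eqP => [e|_]; last by rewrite mul0r.
    by case/eqP: ne; apply: val_inj.
  by rewrite /=; ring.
rewrite big1 => [|j _]; last first.
  by have -> : (i == j :> nat) = false; [have := ltn_ord j; lia | rewrite mul0r].
case: eqP => e1.
  have -> : (i == m.+2 :> nat) = false by lia.
  by rewrite /grad_w natrM /=; ring.
have -> : (i == m.+2 :> nat) by have := ltn_ord i; lia.
by rewrite /grad_u /=; ring.
Qed.

Lemma dhomog_ivar j : (ivar j : R) \is 1.-homog.
Proof. by rewrite dhomogX; apply/eqP/mdeg1. Qed.

Lemma dhomog_ivarX j d : (ivar j : R) ^+ d \is d.-homog.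
Proof. by have := dhomogMn d (dhomog_ivar j); rewrite mul1n. Qed.

Lemma dhomog_nat d : (d%:R : R) \is 0.-homog.
Proof. by rewrite -mpolyC_nat -alg_mpolyC; apply/rpredZ/dhomog1. Qed.

Lemma dhomogMe d e c (p q : R) : p \is d.-homog -> q \is e.-homog -> (d + e)%N = c ->
  p * q \is c.-homog.
Proof. by move=> pd qe <-; apply: dhomogM. Qed.

Lemma grad_homog j : grad j \is (m.+2).-homog.
Proof.
rewrite /grad; case: leqP => jm.
  by apply: (dhomogMe (dhomog_ivarX _ _) (dhomog_ivarX _ _)); lia.
have sumh (F : 'I_m.+1 -> R) : (forall j, F j \is (m.+2).-homog) -> \sum_j F j \is (m.+2).-homog.
  by move=> Fh; apply: rpred_sum.
case: eqP => _; apply: rpredD.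
- apply: (dhomogMe (d := m.+1) _ (dhomog_ivar _)); last lia.
  by apply: (dhomogMe (dhomog_nat _) (dhomog_ivarX _ _)).
- apply: sumh => -[[|i] lt] /=; first by rewrite !mul0r rpred0.
  apply: (dhomogMe (d := i.+1) _ (dhomog_ivarX _ _)); last lia.
  apply: (dhomogMe (d := 1) _ (dhomog_ivarX _ _)); last lia.
  by apply: (dhomogMe (dhomog_nat _) (dhomog_ivar _)).
- by apply: (dhomogMe (dhomog_nat _) (dhomog_ivarX _ _)).
- apply: sumh => i; have lt := ltn_ord i.
  apply: (dhomogMe (d := i.+1) _ (dhomog_ivarX _ _)); last lia.
  apply: (dhomogMe (d := 1) _ (dhomog_ivarX _ _)); last lia.
  by apply: (dhomogMe (dhomog_nat _) (dhomog_ivar _)).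
Qed.

Lemma grad_mul i j i' j' : (i <= m)%N -> (j <= m)%N -> (i' <= m)%N -> (j' <= m)%N ->
  (i + j = i' + j')%N -> grad i * grad j = grad i' * grad j'.
Proof.
move=> im jm i'm j'm e; rewrite /grad im jm i'm j'm.
rewrite mulrACA [RHS]mulrACA -!exprD; congr (_ ^+ _ * _ ^+ _); lia.
Qed.

Hypothesis char0 : [pchar k] =i pred0.
Hypothesis m_gt0 : (0 < m)%N.

Lemma natf_neq0_char0 j : j.+1%:R != 0 :> k.
Proof. by rewrite ((pcharf0P k).1 char0). Qed.

Local Notation a := ('X_va : S).
Local Notation b := ('X_vb : S).
Local Notation s := ('X_vs : S).
Local Notation t := ('X_vt : S).

(** A substitution under which the partial derivatives become, up to a common
    factor, the parametrization a^(m-j) b^j, s, t of the scroll: u and w become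
    multiples of a and b, the values of the first two variables are found by
    solving the linear equations grad_w = factor * s and grad_u = factor * t,
    and the other variables go to 0. *)
Definition unproj (j : nat) : S :=
  if j == m.+2 then a ^+ m.+2
  else if j == m.+1 then b * a ^+ m.+1
  else if j == 1%N then a ^+ 2 * s - (2 * m.+2)%:R * b ^+ m.+1 * a
  else if j == 0%N then m.+2%:R^-1%:MP * (a ^+ 2 * t - 2%:R * b ^+ m.+2
         - m.+1%:R * b * (a * s - (2 * m.+2)%:R * b ^+ m.+1))
  else 0.

Definition unproj_factor : S := a ^+ (m.+1 * m.+2 + 2).

Lemma unproj_factor_neq0 : unproj_factor != 0.
Proof. by rewrite expf_neq0 // -msize_poly_eq0 msizeX. Qed.

(** The equations that determine the values of the first two variables. Exponents
    and coefficients are variables in these two lemmas: with m.+1 in their place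
    the powers would unfold during the ring computations. *)
Lemma unproj_identity_w d e (B : comNzRingType) (c a b s : B) : e = d.+1 ->
  c * (b * a ^+ d) ^+ d * a ^+ e + (a ^+ 2 * s - c * b ^+ d * a) * (a ^+ e) ^+ d
  = a ^+ (d * e + 2) * s.
Proof.
move=> he; pose P := a ^+ (d * e).
have e1 : (b * a ^+ d) ^+ d * a ^+ e = b ^+ d * (P * a).
  by rewrite exprMn -mulrA /P -exprSr -exprM -exprD; congr (_ * _ ^+ _); lia.
have e2 : (a ^+ e) ^+ d = P by rewrite -exprM mulnC.
rewrite -mulrA e1 e2 exprD -/P; by move: (b ^+ d) (P) => B' Q; ring.
Qed.

Lemma unproj_identity_u d e l (B : comNzRingType) (c c' a b s t : B) :
  e = d.+1 -> d = l.+1 ->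
  2%:R * (b * a ^+ d) ^+ e
  + (a ^+ 2 * t - 2%:R * b ^+ e - c' * b * (a * s - c * b ^+ d)) * (a ^+ e) ^+ d
  + c' * (a ^+ 2 * s - c * b ^+ d * a) * (b * a ^+ d) * (a ^+ e) ^+ l
  = a ^+ (d * e + 2) * t.
Proof.
move=> he hd; pose Q := a ^+ d * (a ^+ e) ^+ l.
have e1 : (b * a ^+ d) ^+ e = b ^+ e * (a * Q).
  by rewrite exprMn /Q -!exprM -exprD -exprS; congr (_ * _ ^+ _); lia.
have e2 : (a ^+ e) ^+ d = a * Q.
  by rewrite /Q -!exprM -exprD -exprS; congr (_ ^+ _); lia.
have e3 : a ^+ (d * e + 2) = a * Q * a ^+ 2 by rewrite exprD mulnC exprM e2.
have e4 x : x * (b * a ^+ d) * (a ^+ e) ^+ l = x * b * Q by rewrite /Q; ring.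
by rewrite e4 e1 e2 e3; move: (b ^+ d) (b ^+ e) (Q) => B' B'' Q'; ring.
Qed.

Lemma unproj_grad (phi : {rmorphism R -> S}) :
  (forall j, (j < n)%N -> phi (ivar j) = unproj j) ->
  forall j, (j < n)%N -> phi (grad j) = unproj_factor * 'X_[scroll_exp m j].
Proof.
move=> phiE j jn.
have ew : phi w = b * a ^+ m.+1.
  by rewrite phiE ?leqnSn // /unproj eqxx ifF //; lia.
have eu : phi u = a ^+ m.+2 by rewrite (phiE _ (ltnSn _)) /unproj ifT.
have x0 : phi (ivar 0) = m.+2%:R^-1%:MP * (a ^+ 2 * t - 2%:R * b ^+ m.+2
         - m.+1%:R * b * (a * s - (2 * m.+2)%:R * b ^+ m.+1)).
  by rewrite phiE.
have x1 : phi (ivar 1) = a ^+ 2 * s - (2 * m.+2)%:R * b ^+ m.+1 * a.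
  by rewrite phiE // /unproj !ifF //; lia.
have xj i : (1 < i)%N -> (i <= m)%N -> phi (ivar i) = 0.
  by move=> i1 im; rewrite phiE /unproj ?ifF //; lia.
have l1 : (1 < m.+1)%N by [].
have sum01 (F : 'I_m.+1 -> R) :
    (forall i : 'I_m.+1, (1 < i)%N -> phi (F i) = 0) ->
    phi (\sum_i F i) = phi (F ord0) + phi (F (Ordinal l1)).
  move=> F0; rewrite rmorph_sum (bigD1 ord0) //= (bigD1 (Ordinal l1)) //=.
  rewrite big1 ?addr0 // => i /andP[n0 n1]; apply: F0.
  case: i n0 n1 => -[|[|i]] lt // _ /eqP; case; exact: val_inj.
(* stated with variable exponents, as x^(d.+2) is also a product up to conversion *)
have mono c i d e : phi (c%:R * ivar i * w ^+ d * u ^+ e) =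
    c%:R * phi (ivar i) * phi w ^+ d * phi u ^+ e.
  by rewrite !rmorphM !rmorphXn rmorph_nat.
have monow c d : phi (c%:R * w ^+ d) = c%:R * phi w ^+ d.
  by rewrite rmorphM rmorphXn rmorph_nat.
have monowu' c d : phi (c%:R * w ^+ d * u) = c%:R * phi w ^+ d * phi u.
  by rewrite !rmorphM rmorphXn rmorph_nat.
have monowu d e : phi (w ^+ d * u ^+ e) = phi w ^+ d * phi u ^+ e.
  by rewrite rmorphM !rmorphXn.
have expab d i e l : (b * a ^+ d) ^+ i * (a ^+ e) ^+ l = b ^+ i * a ^+ (d * i + e * l).
  by rewrite exprMn -!exprM -mulrA -exprD.
rewrite /grad /scroll_exp; case: leqP => jm.
  rewrite monowu ew eu expab mpolyXD -!mpolyXn /unproj_factor.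
  rewrite mulrC [RHS]mulrA -exprD; congr (_ ^+ _ * _); nia.
case: eqP => _.
  rewrite /grad_w rmorphD sum01; last first.
    by move=> i i1; rewrite mono xj ?mulr0 ?mul0r // -ltnS.
  rewrite !mono monowu' !subSS subn0 mul0r !mul0r add0r [nat_of_ord _]/= [_.-1]/=.
  rewrite expr0 mulr1 mul1r x1 ew eu; exact: unproj_identity_w.
rewrite /grad_u rmorphD sum01; last first.
  by move=> i i1; rewrite mono xj ?mulr0 ?mul0r // -ltnS.
rewrite !mono monow !subSS !subn0 [nat_of_ord ord0]/= [nat_of_ord _]/= expr0 mulr1 expr1.
rewrite x0 x1 ew eu; set Z := (X in _%:MP * X).
have -> : m.+2%:R * (m.+2%:R^-1%:MP * Z) = Z.
  by rewrite mulrA -mpolyC_nat -mpolyCM mulfV ?natf_neq0_char0 // mul1r.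
rewrite addrA; exact: unproj_identity_u.
Qed.

Definition unproj_map : R -> S := mmap (@mpolyC 4 k) (fun i : 'I_n => unproj i).
HB.instance Definition _ := GRing.RMorphism.on unproj_map.

Lemma unproj_map_grad j : (j < n)%N ->
  unproj_map (grad j) = unproj_factor * 'X_[scroll_exp m j].
Proof. by apply: unproj_grad => i lt; rewrite /= /unproj_map mmapX mmap1U inordK. Qed.

End Form.
(** * The special fiber of the Jacobian ideal *)

Section FormFiber.
Variables (k : fieldType) (m : nat).
Hypothesis char0 : [pchar k] =i pred0.
Hypothesis m_gt0 : (0 < m)%N.
Local Notation n := m.+3.
Local Notation R := {mpoly k[n]}.
Local Notation f := (form_f k n).
Local Notation G := (fun i : 'I_n => f^`M(i)).
Local Notation J := (jacobian_ideal f).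

Lemma partial_homog (i : 'I_n) : f^`M(i) \is (m.+2).-homog.
Proof. by rewrite mderiv_form; apply: grad_homog. Qed.

(** A form that vanishes on the partial derivatives vanishes on the scroll. *)
Lemma unproj_gens_eval d Q : Q \is d.-homog ->
  unproj_map (gens_eval G Q) = unproj_factor k m ^+ d * scroll_map Q.
Proof.
move=> Qd; have mon mu : unproj_map (gens_eval G 'X_[mu]) =
    unproj_factor k m ^+ mdeg mu * scroll_map 'X_[mu].
  elim/mnm_ind: mu => [|i mu IH]; first by rewrite mpolyX0 mdeg0 expr0 !rmorph1 mulr1.
  rewrite mpolyXD !rmorphM /= IH gens_evalX mderiv_form.
  rewrite (unproj_map_grad char0 m_gt0 (ltn_ord i)) mdegD mdeg1 add1n exprS.
  have -> : scroll_map ('X_i : R) = 'X_[scroll_exp m i].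
    by rewrite -scroll_map_var // /ivar inord_val.
  by ring.
rewrite -(pihomog_dE Qd); elim/mpoly_linear_ind: Q {Qd} => [|p q IHp IHq|c p IH|mu].
- by rewrite !linear0 !rmorph0 mulr0.
- by rewrite linearD !rmorphD mulrDr /= IHp IHq.
- rewrite linearZ gens_evalZ scroll_mapZ -!mul_mpolyC rmorphM /= IH.
  have -> : unproj_map (c%:MP : R) = c%:MP by apply: mmapC.
  by rewrite mulrCA.
rewrite pihomogX; case: eqP => [<-|_]; first exact: mon.
by rewrite !rmorph0 mulr0.
Qed.

(** A relation among the partial derivatives is one among the a^(m-j) b^j, s, t
    by the substitution. Conversely the minors generate the relations of the
    latter, and they vanish at the w^j u^(n-1-j). *)
Lemma fiber_map_scroll (Q : R) : fiber_map G Q = 0 <-> scroll_map Q = 0.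
Proof.
rewrite (fiber_map_ker partial_homog); split=> [H|].
  rewrite (pihomog_partitionE (leqnn (msize Q))) rmorph_sum big1 // => d _.
  have := unproj_gens_eval (pihomogP mdeg d Q); rewrite H rmorph0 => /esym/eqP.
  by rewrite mulf_eq0 expf_eq0 (negbTE (unproj_factor_neq0 k m)) andbF => /eqP.
move/(scroll_ker m_gt0) => QI; apply/(fiber_map_ker partial_homog); move: Q QI.
apply: (ideal_span_sub (I := [set x | fiber_map G x = 0])).
  exact: (ideal_preimage (fiber_map G) (ideal_zero _)).
move=> _ [i [j [ij jm ->]]] /=; rewrite /fiber_map.
have -> : rees_eval G (ivar i * ivar j.+1 - ivar j * ivar i.+1) = 0.
  have E l : rees_eval G (ivar l) = rees_gen G (inord l) by rewrite /rees_eval mmapX mmap1U.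
  rewrite rmorphB !rmorphM /= !E; apply/val_inj => /=.
  rewrite !mderiv_form !inordK; try lia.
  have P (B : comNzRingType) (x y z t X : B) : x * y = z * t ->
      x * X * (y * X) - z * X * (t * X) = 0.
    by move=> e; rewrite mulrACA e mulrACA subrr.
  by apply: P; rewrite -!polyCM; congr polyC; apply: grad_mul; lia.
exact: (rmorph0 (quot_pi _)).
Qed.

Lemma scroll_minors (x : R) :
  ideal_span (ideal_minors2 (scroll_matrix k n)) x <-> scroll_ideal x.
Proof.
have E (i : 'I_2) (j : 'I_(n - 3)) : scroll_matrix k n i j = ivar (i + j).
  by rewrite mxE xvar_ivar //; have := ltn_ord i; have := ltn_ord j; lia.
split.
  apply: ideal_span_sub => [|{}x]; first exact: ideal_spanP.
  apply: ideal_span_sub => [|{}x]; first exact: ideal_spanP.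
  case=> i1 [i2 [j1 [j2 [i12 j12 ->]]]]; apply: ideal_span_gen; exists j1, j2.
  have [-> ->] : i1 = ord0 /\ i2 = lift ord0 ord0.
    by split; apply: val_inj; rewrite /= /bump /=; have := ltn_ord i1; have := ltn_ord i2; lia.
  by rewrite !E; split=> //; have := ltn_ord j2; lia.
apply: ideal_span_sub => [|_ [i [j [ij jm ->]]]]; first exact: ideal_spanP.
do 2!apply: ideal_span_gen.
have [li lj] : (i < n - 3)%N /\ (j < n - 3)%N by lia.
exists ord0, (lift ord0 ord0), (Ordinal li), (Ordinal lj); split=> //.
by rewrite !E.
Qed.

Local Notation scroll_pi := (quot_pi (ideal_minors2 (scroll_matrix k n))).

Lemma scroll_pi_ker x : scroll_pi x = 0 <-> scroll_map x = 0.
Proof. by rewrite quot_pi_eq0 scroll_minors (scroll_ker m_gt0). Qed.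

Lemma fiber_scroll_ker x : fiber_map G x = 0 <-> scroll_pi x = 0.
Proof. by rewrite fiber_map_scroll scroll_pi_ker. Qed.

Lemma scroll_fiber_ker x : scroll_pi x = 0 <-> fiber_map G x = 0.
Proof. by rewrite fiber_scroll_ker. Qed.

Lemma scroll_pi_onto y : exists x, scroll_pi x = y.
Proof. exact: quot_pi_onto. Qed.

Lemma fiber_onto (y : special_fiber J) : exists x, fiber_map G x = y.
Proof. exact: (fiber_map_onto partial_homog). Qed.

Definition fiber_scroll : special_fiber J -> scroll_alg k n :=
  factor_def fiber_onto fiber_scroll_ker.

Lemma fiber_scrollE x : fiber_scroll (fiber_map G x) = scroll_pi x.
Proof. exact: factorE. Qed.

Fact fiber_scroll_linear : linear fiber_scroll.
Proof.
move=> c x y; have [[p <-] [q <-]] := (fiber_onto x, fiber_onto y).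
have -> : c *: (fiber_map G p : special_fiber J) + fiber_map G q = fiber_map G (c *: p + q).
  by rewrite rmorphD /= fiber_mapZ.
rewrite !fiber_scrollE; transitivity (scroll_pi (c *: p) + scroll_pi q); first exact: quot_piD.
by congr (_ + _); apply: quot_piZ.
Qed.

HB.instance Definition _ :=
  GRing.isLinear.Build k (special_fiber J) (scroll_alg k n) *:%R fiber_scroll
    fiber_scroll_linear.

Lemma special_fiber_scroll : exists phi : {linear special_fiber J -> scroll_alg k n},
  monoid_morphism phi /\ bijective phi.
Proof.
exists fiber_scroll; split; first exact: (factor_monoid fiber_onto fiber_scroll_ker).
exists (factor_def scroll_pi_onto scroll_fiber_ker) => x.
  have [p <-] := fiber_onto x; rewrite /= fiber_scrollE.
  exact: (factorE scroll_pi_onto scroll_fiber_ker p).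
have [p <-] := scroll_pi_onto x; rewrite -[RHS]fiber_scrollE; congr fiber_scroll.
exact: factorE.
Qed.

Lemma special_fiber_cohen_macaulay :
  cohen_macaulay (special_fiber J) /\ krull_dim (special_fiber J) 4.
Proof. exact: (scroll_cohen_macaulay m_gt0 fiber_onto fiber_map_scroll). Qed.

End FormFiber.
(** * The reduction number *)

(** A matrix of largest rank among those with rows in V has row space V; the
    functional is a nonzero column of its cokernel. *)
Lemma subspace_functional (k : fieldType) d (V : set 'rV[k]_d) :
  V 0 -> (forall c v v', V v -> V v' -> V (c *: v + v')) -> (exists v, ~ V v) ->
  exists2 lambda : 'cV[k]_d, lambda != 0 & forall v, V v -> v *m lambda = 0.
Proof.
move=> V0 VL [v0 nVv0].
have Vsub p (M : 'M[k]_(p, d)) : (forall i, V (row i M)) -> forall v, (v <= M)%MS -> V v.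
  move=> MV v /submxP[D ->]; rewrite mulmx_sum_row.
  elim/big_rec: _ => // i x _ Vx; exact: VL.
pose b r := `[< exists M : 'M[k]_d, (forall i, V (row i M)) /\ \rank M = r >].
have exb : exists r, b r.
  exists (\rank (0 : 'M[k]_d)); apply/asboolP; exists 0; split=> // i.
  by rewrite row0.
have ub r : b r -> (r <= d)%N by move=> /asboolP[M [_ <-]]; apply: rank_leq_col.
case: (ex_maxnP exb ub) => r /asboolP[M [MV rM]] mx.
have VM v : V v -> (v <= M)%MS.
  move=> Vv; apply: contrapT => nvM.
  have /mx : b (\rank (M + v)%MS).
    apply/asboolP; exists (M + v)%MS; split=> // i.
    have /sub_addsmxP[[x y] ->] := row_sub i (M + v)%MS.
    rewrite -[x *m M]scale1r; apply: (VL 1); first by apply: (Vsub _ M) => //; apply: submxMl.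
    have -> : y *m v = y 0 0 *: v by rewrite -mul_scalar_mx -mx11_scalar.
    by rewrite -[_ *: v]addr0; apply: VL.
  rewrite leqNgt -rM => /negP; apply.
  rewrite ltn_neqAle mxrankS ?addsmxSl // andbT; apply/eqP => e; apply: nvM.
  have := mxrank_leqif_sup (addsmxSl M v); case=> _; rewrite e eqxx => /esym.
  by apply: submx_trans; apply: addsmxSr.
have [j cj] : exists j, col j (cokermx M) != 0.
  apply: contrapT => no; apply: nVv0; apply: (Vsub _ M) => //.
  suff C0 : cokermx M = 0 by rewrite submxE C0 mulmx0.
  apply/matrixP => i j; rewrite mxE; apply/eqP; apply: contrapT => /negP nz.
  apply: no; exists j; apply: contraNneq nz => c0.
  by have := congr1 (fun A : 'cV_d => A i 0) c0; rewrite !mxE => ->.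
exists (col j (cokermx M)) => // v /VM; rewrite submxE => /eqP e.
by rewrite colE mulmxA e mul0mx.
Qed.

Lemma pihomogM (k : fieldType) n (c g : {mpoly k[n]}) d e : g \is e.-homog ->
  pihomog mdeg d (c * g) = if (e <= d)%N then pihomog mdeg (d - e) c * g else 0.
Proof.
move=> ge; elim/mpoly_linear_ind: c => [|p q IHp IHq|a p IH|mu].
- by rewrite mul0r !linear0 mul0r if_same.
- by rewrite mulrDl !linearD /= IHp IHq; case: ifP => _; rewrite ?mulrDl ?addr0.
- by rewrite -scalerAl !linearZ /= IH; case: ifP => _; rewrite ?scaler0 // scalerAl.
have h : 'X_[mu] * g \is (mdeg mu + e).-homog by apply: dhomogM => //; rewrite dhomogX.
have [<-|ne] := eqVneq (mdeg mu + e)%N d.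
  by rewrite pihomog_dE // leq_addl addnK pihomogX eqxx.
rewrite (pihomog_ne0 ne h).
case: leqP => // le; rewrite pihomogX ifF ?mul0r //.
by apply/eqP => emu; case/eqP: ne; rewrite emu subnK.
Qed.

Lemma homogeneous_span (k : fieldType) n (I : Type) (g : I -> {mpoly k[n]}) e :
  (forall i, g i \is e.-homog) -> homogeneous_ideal (ideal_span (range g)).
Proof.
move=> ge; have hI := ideal_spanP (range g); split=> // d p [c [v [h [hg ->]]]].
rewrite linear_sum; apply: ideal_sum => // i _.
have [j _ <-] := hg i; rewrite /= (pihomogM _ _ (ge j)); case: ifP => _; last exact: ideal0.
by apply: ideal_mull => //; apply: ideal_span_gen; exists j.
Qed.

Section ReductionNumber.
Variables (k : fieldType) (m : nat).
Hypothesis char0 : [pchar k] =i pred0.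
Hypothesis m_gt1 : (1 < m)%N.
Local Notation n := m.+3.
Local Notation R := {mpoly k[n]}.
Local Notation S := {mpoly k[4]}.
Local Notation f := (form_f k n).
Local Notation G := (fun i : 'I_n => f^`M(i)).
Local Notation J := (ideal_span (range G)).

Let m_gt0 : (0 < m)%N := ltnW m_gt1.
Let hJ : is_ideal J := ideal_spanP _.

Definition par_ord (i : 'I_4) : 'I_n := inord (nth 0%N [:: 0%N; m; m.+1; m.+2] i).

Lemma scroll_parE i : scroll_par k m i = 'X_(par_ord i).
Proof. by []. Qed.

Definition par_ideal : set R := ideal_span (range (fun i => G (par_ord i))).

Let hK : is_ideal par_ideal := ideal_spanP _.

Lemma par_ideal_sub : par_ideal `<=` J.
Proof. by apply: ideal_span_sub => // _ [i _ <-]; apply: ideal_span_gen; exists (par_ord i). Qed.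

Lemma par_ideal_gen i : par_ideal (G (par_ord i)).
Proof. by apply: ideal_span_gen; exists i. Qed.

(** Among the indices 0, ..., m only the extreme ones are parameters; the
    product of two other generators is the product of an extreme one and
    another generator. *)
Lemma partial_mul (i j : 'I_n) c : ideal_mul par_ideal (ideal_exp J 1) (G i * (G j * c)).
Proof.
have hM : is_ideal (ideal_mul par_ideal (ideal_exp J 1)) by apply: ideal_spanP.
have J1 l : ideal_exp J 1 (G l).
  by rewrite -[G l]mulr1; apply: (ideal_exp_mul (d := 0)) => //; apply: genJ.
have key (a b : 'I_n) : (exists l, a = par_ord l) ->
    ideal_mul par_ideal (ideal_exp J 1) (G a * G b).
  move=> [l ->]; apply: ideal_span_gen; exists (G (par_ord l)), (G b).
  by split=> //; apply: par_ideal_gen.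
have par (a : 'I_n) : a = 0%N :> nat \/ (m <= a)%N -> exists l, a = par_ord l.
  move=> ha; have la := ltn_ord a.
  have [e|[e|[e|e]]] : a = 0%N :> nat \/ a = m :> nat \/ a = m.+1 :> nat \/ a = m.+2 :> nat by lia.
  - by exists va; apply: val_inj; rewrite /= inordK.
  - by exists vb; apply: val_inj; rewrite /= inordK //=; lia.
  - by exists vs; apply: val_inj; rewrite /= inordK //=; lia.
  - by exists vt; apply: val_inj; rewrite /= inordK //=; lia.
rewrite mulrA; apply: ideal_mulr => //.
have [/par pi|ni] := pselect (i = 0%N :> nat \/ (m <= i)%N); first exact: key.
have [/par pj|nj] := pselect (j = 0%N :> nat \/ (m <= j)%N); first by rewrite mulrC; apply: key.
have mul (a b : 'I_n) : (a <= m)%N -> (b <= m)%N -> (i + j = a + b)%N -> G i * G j = G a * G b.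
  by move=> am bm e; rewrite !mderiv_form; apply: grad_mul => //; lia.
have [le|lt] := leqP (i + j) m.
  rewrite (mul (inord 0) (inord (i + j))) ?inordK //; try lia.
  by apply: key; apply: par; left; rewrite inordK.
rewrite (mul (inord m) (inord (i + j - m))) ?inordK //; try lia.
by apply: key; apply: par; right; rewrite inordK //; lia.
Qed.

Lemma par_ideal_reduction : ideal_exp J 2 = ideal_mul par_ideal (ideal_exp J 1).
Proof.
have hM : is_ideal (ideal_mul par_ideal (ideal_exp J 1)) by apply: ideal_spanP.
rewrite eqEsubset; split.
  apply: (ideal_expS_sub hM) => i b.
  have hP : is_ideal [set b | ideal_mul par_ideal (ideal_exp J 1) (G i * b)].
    split=> [|x y|a x] /=; rewrite ?mulr0 ?mulrDr ?[_ * (a * _)]mulrCA.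
    - exact: ideal0.
    - exact: idealD.
    - exact: ideal_mull.
  move: b; apply: (ideal_expS_sub hP) => j b _ /=; exact: partial_mul.
by apply: ideal_span_mono => _ [a [b [/par_ideal_sub Ja Jb ->]]]; exists a, b.
Qed.

(** Equality in the fiber ring, tested by order of vanishing, is equality on the
    scroll. *)
Lemma homog_scroll_eq d (Q : R) : Q \is d.-homog ->
  ord_ge (m.+2 * d).+1 (gens_eval G Q) -> scroll_map Q = 0.
Proof.
move=> Qd ge; have [_ hd] := gens_eval_homog (partial_homog k (m := m)) Qd.
have e0 := ord_ge_homog0 hd ge.
have := unproj_gens_eval char0 m_gt0 Qd; rewrite e0 rmorph0 => /esym/eqP.
by rewrite mulf_eq0 expf_eq0 (negbTE (unproj_factor_neq0 k m)) andbF => /eqP.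
Qed.

Definition par_form (v : 'rV[k]_4) : R := \sum_i v 0 i *: 'X_(par_ord i).

Lemma par_form_homog v : par_form v \is 1.-homog.
Proof.
by apply: rpred_sum => i _; apply: rpredZ; rewrite dhomogX; apply/eqP/mdeg1.
Qed.

Lemma gens_eval_par_form v : gens_eval G (par_form v) = \sum_i v 0 i *: G (par_ord i).
Proof.
by rewrite /par_form rmorph_sum; apply: eq_bigr => i _; rewrite /= gens_evalZ gens_evalX.
Qed.

(** The parameters are forms of degree m + 2, so in this degree only the constant
    terms of the coefficients of x contribute. *)
Lemma par_ideal_lowest x : par_ideal x ->
  exists v, pihomog mdeg m.+2 x = gens_eval G (par_form v).
Proof.
have hp i : G (par_ord i) \is (m.+2).-homog by apply: partial_homog.
case=> p [c [g [gi ->]]].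
have /choice [j jP] : forall i, exists j : 'I_4, g i = G (par_ord j).
  by move=> i; have [j _ <-] := gi i; exists j.
exists (\row_l \sum_(i | j i == l) (c i)@_0%MM); rewrite gens_eval_par_form linear_sum /=.
rewrite (partition_big j xpredT) //=; apply: eq_bigr => l _; rewrite mxE scaler_suml.
apply: eq_bigr => i /eqP jl; rewrite jP jl (pihomogM _ _ (hp l)) leqnn subnn -mul_mpolyC.
congr (_ * _); apply/mpolyP => mu; rewrite mcoeff_pihomog mcoeffC mdeg_eq0.
by case: eqP => [->|_]; rewrite ?mulr1 ?mulr0.
Qed.

(** On the scroll this generator is the monomial a^(m-1) b, which is neither of
    a^m, b^m, s, t as m > 1. *)
Lemma not_par_ideal : ~ par_ideal (G (inord 1)).
Proof.
move=> /par_ideal_lowest [v e].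
have := pihomog_dE (partial_homog k (inord 1 : 'I_n)); rewrite e => {}e.
have : scroll_map ('X_(inord 1) - par_form v : R) = 0.
  apply: (@homog_scroll_eq 1).
    by apply: rpredB; [rewrite dhomogX; apply/eqP/mdeg1|apply: par_form_homog].
  rewrite rmorphB /= gens_evalX e subrr; exact: (ideal0 (ord_ge_ideal _ _ _)).
move=> /(congr1 (mcoeff (scroll_exp m 1))); rewrite rmorphB mcoeffB mcoeff0 /=.
rewrite -[scroll_map _]/(scroll_map (ivar 1)) scroll_map_var // mcoeffX eqxx.
rewrite /par_form rmorph_sum raddf_sum big1 => [|i _] /=; first by move/eqP; rewrite subr0 oner_eq0.
rewrite scroll_mapZ mcoeffZ -scroll_parE scroll_map_par // (@mpolyXn 4 k) mcoeffX.
rewrite [(_ == _)%MM](_ : _ = false) ?mulr0 //.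
apply/eqP => /(congr1 (fun mu : 'X_{1..4} => mu vb)).
rewrite /scroll_exp m_gt0 !mnmDE !mulmnE !mnm1E /=.
by rewrite /par_exp; case: i => -[|[|[|[|//]]]] lt //=; lia.
Qed.

Lemma par_ideal_not_trivial : ideal_exp J 1 <> ideal_mul par_ideal (ideal_exp J 0).
Proof.
move=> e; apply: not_par_ideal.
have : ideal_exp J 1 (G (inord 1)).
  by rewrite -[G _]mulr1; apply: (ideal_exp_mul (d := 0)) => //; apply: genJ.
rewrite e; apply: ideal_span_sub => // _ [a [b [Ka _ ->]]]; exact: ideal_mulr.
Qed.

Section Functional.
Variable lambda : 'cV[k]_4.

Definition par_weight (e : 'X_{1..4}) : k :=
  if [forall i, (par_exp m i %| e i)%N] then \prod_i lambda i 0 ^+ (e i %/ par_exp m i)%N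
  else 0.

(** The linear functional on S dual to the point lambda: it sends the powers of
    the parameters to their values at lambda and kills the other monomials. It
    stands for evaluation at a point of the scroll with parameters lambda,
    which may exist only after an extension of k. *)
Definition par_val : S -> k^o := lin_ext (par_weight : 'X_{1..4} -> k^o).

Lemma par_exp_gt0 i : (0 < par_exp m i)%N.
Proof. by case: i => -[|[|[|[|//]]]] lt. Qed.

Lemma par_valD p q : par_val (p + q) = par_val p + par_val q.
Proof. exact: linearD. Qed.

Lemma par_valZ c p : par_val (c *: p) = c * par_val p.
Proof. exact: linearZ. Qed.

Lemma par_val1 : par_val 1 = 1.
Proof.
rewrite -mpolyX0 /par_val lin_extX /par_weight ifT; last by apply/forallP => i; rewrite mnm0E dvdn0.
by apply: big1 => i _; rewrite mnm0E div0n expr0.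
Qed.

Lemma par_valM i p : par_val ('X_i ^+ par_exp m i * p) = lambda i 0 * par_val p.
Proof.
elim/mpoly_linear_ind: p => [|p q IHp IHq|c p IH|e].
- by rewrite mulr0 /par_val linear0 mulr0.
- by rewrite mulrDr !par_valD IHp IHq mulrDr.
- by rewrite -scalerAr !par_valZ IH mulrCA.
rewrite mpolyXn -mpolyXD /par_val !lin_extX /par_weight.
have E j : (U_(i) *+ par_exp m i + e)%MM j = ((if j == i then par_exp m i else 0) + e j)%N.
  by rewrite mnmDE mulmnE mnm1E eq_sym; case: eqP => [->|_]; rewrite ?mul1n.
have -> : [forall j, (par_exp m j %| (U_(i) *+ par_exp m i + e)%MM j)%N]
        = [forall j, (par_exp m j %| e j)%N].
  apply: eq_forallb => j; rewrite E; case: eqP => [->|_]; last by rewrite add0n.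
  by rewrite dvdn_addr.
case: ifP => _; last by rewrite mulr0.
rewrite (bigD1 i) //= [in RHS](bigD1 i) //= mulrA -exprS; congr (_ ^+ _ * _).
  by rewrite E eqxx divnDl // divnn par_exp_gt0 add1n.
by apply: eq_bigr => j ne; rewrite E (negbTE ne) add0n.
Qed.

Lemma par_val_form v p :
  par_val (scroll_map (par_form v) * p) = (v *m lambda) 0 0 * par_val p.
Proof.
rewrite /par_form rmorph_sum mulr_suml mxE mulr_suml /=.
rewrite [LHS](raddf_sum (par_val : {linear S -> k^o})); apply: eq_bigr => i _.
rewrite scroll_mapZ -scroll_parE scroll_map_par // -mul_mpolyC -mulrA mul_mpolyC.
rewrite [LHS]par_valZ par_valM.
by rewrite mulrA.
Qed.

End Functional.

(** If the linear forms in the parameters that belong to L do not fill the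
    space of all of them, a functional lambda other than 0 kills them. Extended to S as
    par_val, it kills the initial forms of L J^r, because those of L are linear
    forms killed by lambda; but L J^r contains the power z^(r+1) of a parameter z
    with lambda z other than 0, on which par_val is (lambda z)^(r+1). *)
Lemma minimal_par_ideal L : reduction L J -> L `<=` par_ideal -> L = par_ideal.
Proof.
move=> [[hL Lhom] LJ [r er]] LK; rewrite eqEsubset; split=> //.
pose V := [set v : 'rV[k]_4 | L (gens_eval G (par_form v))].
have [allV|/existsNP nV] := pselect (forall v, V v).
  apply: ideal_span_sub => // _ [i _ <-].
  have := allV (delta_mx 0 i); rewrite /V /= gens_eval_par_form (bigD1 i) //=.
  rewrite mxE !eqxx scale1r big1 ?addr0 // => j ne.
  by rewrite mxE eqxx (negbTE ne) scale0r.
exfalso.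
have LZ c x : L x -> L (c *: x) by rewrite -mul_mpolyC; apply: ideal_mull.
have [||lambda l0 lV] := @subspace_functional k 4 V _ _ nV.
- rewrite /V /= gens_eval_par_form big1 => [|i _]; first exact: ideal0.
  by rewrite mxE scale0r.
- move=> c v v'; rewrite /V /= !gens_eval_par_form => Lv Lv'.
  rewrite (eq_bigr (fun i => c *: (v 0 i *: G (par_ord i)) + v' 0 i *: G (par_ord i))).
    by rewrite big_split -scaler_sumr; apply: idealD => //; apply: LZ.
  by move=> i _; rewrite !mxE scalerDl scalerA.
have [i li] : exists i, lambda i 0 != 0.
  apply: contrapT => no; case/eqP: l0; apply/colP => i; rewrite mxE.
  by apply/eqP; apply: contrapT => /negP nz; apply: no; exists i.
pose z := 'X_(par_ord i) ^+ r.+1 : R.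
have zh : z \is (r.+1).-homog.
  rewrite -[r.+1]mul1n; apply: dhomogMn; rewrite dhomogX; apply/eqP/mdeg1.
(* the forms of degree r+1 that come from L J^r are killed by the functional *)
pose K := [set h | exists Q : R, [/\ Q \is (r.+1).-homog,
  ord_ge (m.+2 * r.+1).+1 (h - gens_eval G Q) & par_val lambda (scroll_map Q) = 0]].
have pv0 : par_val lambda 0 = 0 by apply: linear0.
have hO e : is_ideal (@ord_ge k n e) := ord_ge_ideal k n e.
have hKK : is_ideal K.
  split.
  - exists 0; rewrite rpred0 !rmorph0 subrr; split=> //; exact: (ideal0 (hO _)).
  - move=> x y [Q [Qh xQ Q0]] [Q' [Qh' yQ' Q0']]; exists (Q + Q'); split.
    + exact: rpredD.
    + by rewrite rmorphD opprD addrACA; apply: (idealD (hO _)).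
    + by rewrite rmorphD par_valD Q0 Q0' addr0.
  - move=> a x [Q [Qh xQ Q0]]; exists (a@_0%MM *: Q); split.
    + exact: rpredZ.
    + have -> : a * x - gens_eval G (a@_0%MM *: Q) =
          a * (x - gens_eval G Q) + (a - (a@_0%MM)%:MP) * gens_eval G Q.
        by rewrite gens_evalZ -mul_mpolyC; ring.
      apply: (idealD (hO _)); first exact: (ideal_mull _ (hO _)).
      rewrite -[(_ * _).+1]add1n; apply: ord_geM.
        by apply: irrelevant_ord_ge; apply: irrelevant_subC.
      have [_ hd] := gens_eval_homog (partial_homog k (m := m)) Qh; exact: ord_ge_homog.
    + by rewrite scroll_mapZ par_valZ Q0 mulr0.
have [Q [Qh zQ Q0]] : K (gens_eval G z).
  have [zJ _] := gens_eval_homog (partial_homog k (m := m)) zh.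
  move: zJ; rewrite er; apply: (ideal_span_sub hKK) => _ [a [b [La Jb ->]]].
  have [v av] := par_ideal_lowest (LK _ La).
  have Vv : V v by rewrite /V /= -av; apply: Lhom.
  have [Q' Qh' bQ'] := ideal_exp_gens_eval (partial_homog k (m := m)) Jb.
  exists (par_form v * Q'); split.
  - by rewrite -[r.+1]add1n; apply: dhomogM => //; apply: par_form_homog.
  - have age : ord_ge m.+2 a.
      have := LK _ La; apply: (ideal_span_sub (hO _)) => _ [j _ <-].
      by apply/ord_ge_homog/partial_homog.
    have -> : a * b - gens_eval G (par_form v * Q') =
        a * (b - gens_eval G Q') + (a - pihomog mdeg m.+2 a) * gens_eval G Q'.
      by rewrite rmorphM /= av; ring.
    rewrite mulnS -addnS; apply: (idealD (hO _)).
      by apply: ord_geM => //; apply: (irr_exp_ord_ge (partial_homog k (m := m))).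
    rewrite addnS -addSn; apply: ord_geM; first exact: ord_ge_pihomog.
    have [_ hd] := gens_eval_homog (partial_homog k (m := m)) Qh'; exact: ord_ge_homog.
  - by rewrite rmorphM [LHS]par_val_form lV // mxE mul0r.
have : scroll_map (z - Q) = 0.
  by apply: (@homog_scroll_eq r.+1); rewrite ?rpredB // rmorphB.
move/(congr1 (par_val lambda)); rewrite rmorphB /= -scaleN1r par_valD par_valZ Q0 mulr0 addr0 pv0.
suff -> : par_val lambda (scroll_map z) = lambda i 0 ^+ r.+1.
  by move/eqP; rewrite expf_eq0 (negbTE li) andbF.
rewrite /z rmorphXn /= -scroll_parE scroll_map_par //.
elim: r.+1 => [|j IH]; first by rewrite !expr0 par_val1.
by rewrite !exprS par_valM IH.
Qed.

(** A minimal reduction with reduction number 0 would contain J, hence also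
    par_ideal, and by minimality it would be par_ideal, which does not contain
    J. *)
Lemma jacobian_reduction_number : reduction_number J 1.
Proof.
have trivial K : ideal_exp J 1 = ideal_mul K (ideal_exp J 0) -> is_ideal K -> J `<=` K.
  move=> e hKK x Jx; have : ideal_exp J 1 x.
    by rewrite -[x]mulr1; apply: (ideal_exp_mul (d := 0)).
  rewrite e; apply: ideal_span_sub => // _ [a [b [Ka _ ->]]]; exact: ideal_mulr.
have redK : reduction par_ideal J.
  split; [|exact: par_ideal_sub|by exists 1%N; apply: par_ideal_reduction].
  by apply: (@homogeneous_span _ _ _ _ m.+2) => i; apply: partial_homog.
split.
  exists par_ideal; first by split=> // L; apply: minimal_par_ideal.
  split; first exact: par_ideal_reduction.
  by case=> // /par_ideal_not_trivial.
move=> K [|s] // [[[hKK _] KJ _] Kmin] [e _]; exfalso.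
apply: par_ideal_not_trivial; rewrite (Kmin _ redK) //.
exact: subset_trans par_ideal_sub (trivial K e hKK).
Qed.

End ReductionNumber.
(** * Logarithmic derivations of f *)

Section VariableDivision.
Variables (k : fieldType) (n : nat) (l : 'I_n).
Local Notation R := {mpoly k[n]}.

Definition kill_var : R -> R :=
  mmap (@mpolyC n k) (fun i => if i == l then 0 else 'X_i : R).
HB.instance Definition _ := GRing.RMorphism.on kill_var.

Lemma kill_varX i : kill_var 'X_i = if i == l then 0 else 'X_i.
Proof. by rewrite /kill_var mmapX mmap1U. Qed.

Lemma kill_var_dvd p : exists q, p - kill_var p = 'X_l * q.
Proof.
elim/mpoly_linear_ind: p => [|p p' [q e] [q' e']|c p [q e]|mu].
- by exists 0; rewrite rmorph0 subrr mulr0.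
- by exists (q + q'); rewrite mulrDr -e -e' rmorphD opprD addrACA.
- exists (c *: q); have -> : kill_var (c *: p) = c *: kill_var p.
    by rewrite -!mul_mpolyC rmorphM; congr (_ * _); apply: mmapC.
  by rewrite -scalerBr e scalerAr.
elim/mnm_ind: mu => [|i mu [q e]]; first by exists 0; rewrite mpolyX0 rmorph1 subrr mulr0.
rewrite mpolyXD rmorphM /= kill_varX; case: eqP => [->|_].
  by exists 'X_[mu]; rewrite mul0r subr0.
by exists ('X_i * q); rewrite -mulrBr e mulrCA.
Qed.

Lemma kill_var0 p : kill_var p = 0 -> exists q, p = 'X_l * q.
Proof. by move=> p0; have [q] := kill_var_dvd p; rewrite p0 subr0; exists q. Qed.

End VariableDivision.

Lemma euler_formula (k : fieldType) n d (p : {mpoly k[n]}) : p \is d.-homog ->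
  \sum_i 'X_i * p^`M(i) = d%:R * p.
Proof.
have mon mu : \sum_i 'X_i * ('X_[mu] : {mpoly k[n]})^`M(i) = (mdeg mu)%:R * 'X_[mu].
  elim/mnm_ind: mu => [|j mu IH].
    by rewrite mdeg0 mul0r big1 // => i _; rewrite mpolyX0 -mpolyC1 mderivC mulr0.
  rewrite mpolyXD mdegD mdeg1 natrD mulrDl mul1r.
  under eq_bigr => i _ do rewrite mderivM mulrDr.
  rewrite big_split /=; congr (_ + _).
    rewrite (bigD1 j) //= big1 ?addr0 => [|i ne].
      by rewrite mderiv_var eqxx mul1r.
    by rewrite mderiv_var (negbTE ne) mul0r mulr0.
  by under eq_bigr => i _ do rewrite mulrCA; rewrite -mulr_sumr IH mulrCA.
move=> pd; rewrite -(pihomog_dE pd); elim/mpoly_linear_ind: p {pd} => [|p q IHp IHq|c p IH|mu].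
- by rewrite linear0 mulr0 big1 // => i _; rewrite mderiv0 mulr0.
- rewrite linearD mulrDr /= -IHp -IHq -big_split /=; apply: eq_bigr => i _.
  by rewrite mderivD mulrDr.
- have -> : pihomog mdeg d (c *: p) = c *: pihomog mdeg d p by apply: linearZ.
  rewrite -scalerAr -IH [RHS]scaler_sumr; apply: eq_bigr => i _.
  by rewrite mderivZ -scalerAr.
rewrite pihomogX; case: eqP => [<-|_]; first exact: mon.
by rewrite mulr0 big1 // => i _; rewrite mderiv0 mulr0.
Qed.

Section SaitoBasis.
Variables (k : fieldType) (m : nat).
Hypothesis char0 : [pchar k] =i pred0.
Local Notation n := m.+3.
Local Notation R := {mpoly k[n]}.
Local Notation w := (ivar m.+1 : R).
Local Notation u := (ivar m.+2 : R).
Local Notation f := (form_f k n).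

(** Coefficients of n derivations of degree 0 preserving (f): the last one is
    Euler's, the others are linear syzygies of the partial derivatives, coming
    from w grad_j = u grad_(j+1), from the expansion of u grad_w and from that of
    w grad_w - (n-1) u grad_u. They form a basis, by triangularity: the j-th
    syzygy ends at the coordinate j + 1, with an entry associate to u. *)
Definition log_coef (j i : nat) : R :=
  if j == m.+2 then ivar i
  else if j == m.+1 then
    if i == m.+2 then - (m.+2%:R * u) else if i == m.+1 then w
    else (m.+2 * (m.+2 - i))%:R * ivar i - i%:R * ivar i
  else if j == m then
    if i == m.+2 then 0 else if i == m.+1 then u
    else if i == m then - ((2 * m.+2)%:R * w) else - (i.+1%:R * ivar i.+1)
  else if i == j then w else if i == j.+1 then - u else 0.

Definition log_unit (j : nat) : k :=
  if j == m.+1 then - m.+2%:R else if j == m then 1 else - 1.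

Lemma log_unit_neq0 j : log_unit j != 0.
Proof.
rewrite /log_unit; case: ifP => _; first by rewrite oppr_eq0 natf_neq0_char0.
by case: ifP => _; rewrite ?oppr_eq0 oner_neq0.
Qed.

Lemma log_coef_diag j : (j < m.+2)%N -> log_coef j j.+1 = (log_unit j)%:MP * u.
Proof.
move=> jm; rewrite /log_coef /log_unit ifF; last lia.
case: (j =P m.+1) => [->|ne]; first by rewrite eqxx mpolyCN mpolyC_nat mulNr.
case: (j =P m) => [->|ne'].
  by rewrite ifF ?eqxx ?mpolyC1 ?mul1r //; lia.
by rewrite ifF ?eqxx ?mpolyCN ?mpolyC1 ?mulN1r //; lia.
Qed.

Lemma log_coef_above j i : (j < m.+2)%N -> (j.+1 < i)%N -> (i < n)%N -> log_coef j i = 0.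
Proof.
move=> jm ji ilt; rewrite /log_coef ifF; last lia.
rewrite ifF; last lia.
case: eqP => [e|ne]; first by rewrite ifT //; lia.
by rewrite !ifF //; lia.
Qed.

Lemma log_coef_homog j i : log_coef j i \is 1.-homog.
Proof.
have hN (p : R) : p \is 1.-homog -> - p \is 1.-homog by rewrite rpredN.
have hM c l : (c%:R * ivar l : R) \is 1.-homog.
  by apply: (dhomogMe (dhomog_nat _ _ _) (dhomog_ivar _ _ _)).
rewrite /log_coef; repeat case: ifP => _; rewrite ?rpred0 ?dhomog_ivar //;
  try (by apply: hN; rewrite ?hM ?dhomog_ivar).
by apply: rpredB; apply: hM.
Qed.

Lemma sum_split_last (F : nat -> R) :
  \sum_(i < n) F i = \sum_(i < m.+1) F i + F m.+1 + F m.+2.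
Proof. by rewrite !big_ord_recr. Qed.

Lemma form_homog : f \is (m.+3).-homog.
Proof.
rewrite form_fE; apply: rpredD.
  apply: (dhomogMe (d := m.+2) _ (dhomog_ivar _ _ _)); last lia.
  by apply: (dhomogMe (dhomog_nat _ _ _) (dhomog_ivarX _ _ _ _)).
apply: rpred_sum => i _; have lt := ltn_ord i.
apply: (dhomogMe (d := i.+1) _ (dhomog_ivarX _ _ _ _)); last lia.
by apply: (dhomogMe (dhomog_ivar _ _ _) (dhomog_ivarX _ _ _ _)).
Qed.

Lemma log_coef_euler : \sum_(i < n) log_coef m.+2 i * grad k m i = n%:R * f.
Proof.
rewrite -(euler_formula form_homog); apply: eq_bigr => i _.
by rewrite /log_coef eqxx mderiv_form /ivar inord_val.
Qed.

Lemma log_coef_syz j : (j < m.+2)%N -> \sum_(i < n) log_coef j i * grad k m i = 0.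
Proof.
move=> jm; have [jlt|] := ltnP j m.
  have lj : (j < n)%N by lia.
  have lj1 : (j.+1 < n)%N by lia.
  rewrite (bigD1 (Ordinal lj)) //= (bigD1 (Ordinal lj1)) /=; last first.
    by apply/eqP => /(congr1 val) /= e; lia.
  rewrite big1 ?addr0 => [|i /andP[/eqP n1 /eqP n2]]; last first.
    rewrite /log_coef !ifF ?mul0r //; try lia.
    - by apply/eqP => e; apply: n2; apply: val_inj.
    - by apply/eqP => e; apply: n1; apply: val_inj.
  rewrite /log_coef eqxx ifF; last lia.
  rewrite ifF; last lia.
  rewrite ifF; last lia.
  rewrite eqxx !ifF; try lia.
  rewrite /grad !ifT; try lia.
  have -> : (m.+2 - j = (m.+2 - j.+1).+1)%N by lia.
  by move: (m.+2 - j.+1)%N => d; rewrite !exprS; ring.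
move=> mj; have {mj jm} [->|->] : j = m \/ j = m.+1 by lia.
  rewrite (sum_split_last (fun i => log_coef m i * grad k m i)).
  have [m1 m2] : (m == m.+1) = false /\ (m == m.+2) = false by lia.
  have -> : log_coef m m.+2 = 0 by rewrite log_coef_above.
  have -> : log_coef m m.+1 = u.
    by rewrite log_coef_diag // /log_unit m1 eqxx mpolyC1 mul1r.
  rewrite mul0r addr0 big_ord_recr /=.
  have -> : log_coef m m = - ((2 * m.+2)%:R * w).
    by rewrite /log_coef m1 m2 eqxx.
  have -> : grad k m m.+1 = grad_w k m by rewrite /grad ltnn eqxx.
  have -> : grad k m m = w ^+ m * u ^+ 2.
    by rewrite /grad leqnn; congr (_ * _ ^+ _); lia.
  have E (i : 'I_m) : log_coef m i * grad k m i =
      - (u * (i.+1%:R * ivar i.+1 * w ^+ i * u ^+ (m.+1 - i))).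
    have li := ltn_ord i; rewrite /log_coef m1 m2 eqxx.
    have [-> [-> ->]] : (i == m.+2 :> nat) = false /\ (i == m.+1 :> nat) = false
      /\ (i == m :> nat) = false by lia.
    rewrite /grad ifT; last lia.
    have -> : (m.+2 - i = (m.+1 - i).+1)%N by lia.
    by move: (m.+1 - i)%N => d; rewrite exprS; ring.
  rewrite (eq_bigr _ (fun i _ => E i)) sumrN -mulr_sumr.
  have -> : grad_w k m = (2 * m.+2)%:R * (w * w ^+ m) * u +
      \sum_(i < m) i.+1%:R * ivar i.+1 * w ^+ i * u ^+ (m.+1 - i).
    by rewrite /grad_w big_ord_recl /= mul0r !mul0r add0r -exprS; congr (_ + _).
  set s := \sum_(i < m) _; move: (w ^+ m) => x; ring.
rewrite (sum_split_last (fun i => log_coef m.+1 i * grad k m i)).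
have -> : log_coef m.+1 m.+2 = - (m.+2%:R * u).
  by rewrite log_coef_diag // /log_unit eqxx mpolyCN mpolyC_nat mulNr.
have m12 : (m.+1 == m.+2) = false by lia.
have -> : log_coef m.+1 m.+1 = w by rewrite /log_coef m12 eqxx.
have -> : grad k m m.+1 = grad_w k m by rewrite /grad ltnn eqxx.
have -> : grad k m m.+2 = grad_u k m.
  by rewrite /grad eq_sym m12 ifF //; lia.
have E (i : 'I_m.+1) : log_coef m.+1 i * grad k m i =
    m.+2%:R * (u * ((m.+2 - i)%:R * ivar i * w ^+ i * u ^+ (m.+1 - i)))
    - w * (i%:R * ivar i * w ^+ i.-1 * u ^+ (m.+2 - i)).
  have li := ltn_ord i; rewrite /log_coef m12 eqxx.
  have [-> ->] : (i == m.+2 :> nat) = false /\ (i == m.+1 :> nat) = false by lia.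
  rewrite /grad ifT; last lia.
  have -> : (m.+2 - i = (m.+1 - i).+1)%N by lia.
  rewrite natrM; move: (m.+1 - i)%N => d; rewrite exprS.
  case: (nat_of_ord i) => [|i'] /=; first by rewrite !mul0r; ring.
  by rewrite (exprS w); ring.
rewrite (eq_bigr _ (fun i _ => E i)) sumrB -!mulr_sumr /grad_w /grad_u.
set s := \sum_(i < m.+1) _; set s' := \sum_(i < m.+1) _.
have -> : w ^+ m.+2 = w * w ^+ m.+1 by rewrite exprS.
by rewrite natrM; move: (w ^+ m.+1) => x; ring.
Qed.

Definition grad_col : 'cV[R]_n := \col_i grad k m i.
Definition log_mx : 'M[R]_n := \matrix_(j, i) log_coef j i.

(** The order of vanishing along u = 0 drops by one from each partial derivative
    to the next, and the leading coefficients are powers of w up to constants;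
    this makes the elimination of syzygies triangular. *)
Lemma grad_leading j : (j < n)%N -> exists (c : k) r, c != 0 /\
  grad k m j = u ^+ (m.+2 - j) * (c%:MP * w ^+ j + u * r).
Proof.
move=> jn; have [jm|mj] := leqP j m.
  exists 1, 0; split; first exact: oner_neq0.
  by rewrite /grad jm mulr0 addr0 mpolyC1 mul1r mulrC.
have [e|e] : j = m.+1 \/ j = m.+2 by lia.
  exists (2 * m.+2)%:R, (\sum_(i < m.+1) i%:R * ivar i * w ^+ i.-1 * u ^+ (m - i)).
  split; first by rewrite -[(2 * m.+2)%N]prednK ?natf_neq0_char0 //; lia.
  rewrite /grad e ltnn eqxx /grad_w mpolyC_nat.
  have -> : (m.+2 - m.+1 = 1)%N by lia.
  rewrite expr1 mulrDr mulrA [u * _]mulrC; congr (_ + _); first by rewrite mulrAC.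
  rewrite !mulr_sumr; apply: eq_bigr => i _; have li := ltn_ord i.
  have -> : (m.+2 - i = (m - i).+2)%N by lia.
  by move: (m - i)%N => d; rewrite !exprS; ring.
exists 2%:R, (\sum_(i < m.+1) (m.+2 - i)%:R * ivar i * w ^+ i * u ^+ (m - i)).
split; first exact: natf_neq0_char0.
have [h1 h2] : (m.+2 <= m)%N = false /\ (m.+2 == m.+1) = false by lia.
rewrite /grad e h1 h2 /grad_u mpolyC_nat subnn expr0 mul1r; congr (_ + _).
rewrite mulr_sumr; apply: eq_bigr => i _; have li := ltn_ord i.
have -> : (m.+1 - i = (m - i).+1)%N by lia.
by move: (m - i)%N => d; rewrite !exprS; ring.
Qed.

Lemma grad_dvd i j : (i < j)%N -> (j < n)%N -> exists r, grad k m i = u ^+ (m.+2 - j) * (u * r).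
Proof.
move=> ij jn; have [|c [r [_ ->]]] := @grad_leading i; first lia.
exists (u ^+ (j - i).-1 * (c%:MP * w ^+ i + u * r)).
have -> : (m.+2 - i = (m.+2 - j) + (1 + (j - i).-1))%N by lia.
by rewrite !exprD expr1; ring.
Qed.

Lemma ivar_neq0 j : (ivar j : R) != 0.
Proof. by rewrite -msize_poly_eq0 msizeX. Qed.

(** If a_j is the last coordinate of the syzygy, grad_j contributes
    u^(n-1-j) (c w^j + u r), and the previous grad_i are divisible by a higher power
    of u. Dividing by u^(n-1-j) and setting u = 0 gives c w^j a_j = 0. *)
Lemma syz_last_dvd (a : 'rV[R]_n) (j : 'I_n) :
  (forall i : 'I_n, (j < i)%N -> a 0 i = 0) -> a *m grad_col = 0 ->
  exists q, a 0 j = u * q.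
Proof.
move=> aj /(congr1 (fun A : 'M[R]_1 => A 0 0)); rewrite !mxE (bigD1 j) //= mxE => e.
have [c [r [c0 gj]]] := grad_leading (ltn_ord j).
have [s es] : exists s, \sum_(i < n | i != j) a 0 i * grad_col i 0 =
    u ^+ (m.+2 - j) * (u * s).
  elim/big_rec: _ => [|i x ne [s ->]]; first by exists 0; rewrite !mulr0.
  have [ij|ji|ij] := ltngtP i j; last by case/eqP: ne; apply: val_inj.
    have [t et] := grad_dvd ij (ltn_ord j).
    by exists (a 0 i * t + s); rewrite mxE et; ring.
  by exists s; rewrite aj // mul0r add0r.
have {}e : a 0 j * (c%:MP * w ^+ j + u * r) + u * s = 0.
  move: e; rewrite es gj mulrCA -mulrDr => /eqP.
  by rewrite mulf_eq0 expf_eq0 (negbTE (ivar_neq0 _)) andbF => /eqP.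
apply: (kill_var0 (l := inord m.+2)).
have ku : kill_var (inord m.+2) u = 0 by rewrite kill_varX eqxx.
have kw : kill_var (inord m.+2) w = w.
  by rewrite kill_varX ifF //; apply/eqP => /(congr1 val) /=; rewrite !inordK //; lia.
move/(congr1 (kill_var (inord m.+2))): e.
rewrite rmorphD !rmorphM rmorphD !rmorphM rmorphXn /= ku kw rmorph0 !mul0r !addr0.
have -> : kill_var (inord m.+2) (c%:MP : R) = c%:MP by apply: mmapC.
move=> /eqP; rewrite !mulf_eq0 mpolyC_eq0 (negbTE c0) expf_eq0 (negbTE (ivar_neq0 _)).
by rewrite andbF !orbF => /eqP.
Qed.

Lemma log_mx_syz (j : 'I_n) : (j < m.+2)%N -> row j log_mx *m grad_col = 0.
Proof.
move=> jm; apply/matrixP => i l; rewrite !mxE -[RHS](log_coef_syz jm).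
by apply: eq_bigr => i' _; rewrite !mxE.
Qed.

(** The last coordinate, a multiple of u, is cancelled by the row of the matrix
    that ends there; when only the coordinate 0 is left, it vanishes because
    grad_0 is not 0. *)
Lemma syz_span (a : 'rV[R]_n) : a *m grad_col = 0 -> exists c, a = c *m log_mx.
Proof.
move=> ag.
suff H j : (j < n)%N -> forall a : 'rV[R]_n, (forall i : 'I_n, (j < i)%N -> a 0 i = 0) ->
    a *m grad_col = 0 -> exists c, a = c *m log_mx.
  by apply: (H m.+2) => // i; have := ltn_ord i; lia.
elim: j => [|j IH] jn {ag}a aj ag.
  exists 0; rewrite mul0mx; apply/rowP => i; rewrite mxE.
  have [/aj //|] := ltnP 0 i; rewrite leqn0 => /eqP i0.
  have := congr1 (fun A : 'M[R]_1 => A 0 0) ag; rewrite !mxE (bigD1 i) //= big1.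
    rewrite addr0 mxE i0 /grad /= expr0 mul1r => /eqP.
    by rewrite mulf_eq0 expf_eq0 (negbTE (ivar_neq0 _)) /= orbF => /eqP.
  move=> l ne; rewrite aj ?mul0r // lt0n; apply: contraNneq ne => l0.
  by apply/eqP/val_inj; rewrite /= l0 i0.
have [q eq] := @syz_last_dvd a (Ordinal jn) aj ag.
have lj : (j < n)%N := ltnW jn.
have jm : (j < m.+2)%N by lia.
pose q' := (log_unit j)^-1%:MP * q.
have [||c ec] := IH lj (a - q' *: row (Ordinal lj) log_mx).
- move=> i; rewrite leq_eqVlt => /orP[/eqP e|lt].
    have -> : i = Ordinal jn by apply: val_inj.
    rewrite !mxE eq /= log_coef_diag // /q' mulrACA -mpolyCM mulVf ?log_unit_neq0 //.
    by rewrite mpolyC1 mul1r mulrC subrr.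
  by rewrite !mxE aj // log_coef_above // mulr0 subrr.
- by rewrite mulmxBl ag -scalemxAl log_mx_syz // scaler0 subrr.
exists (c + q' *: delta_mx 0 (Ordinal lj)).
by rewrite mulmxDl -ec -scalemxAl -rowE subrK.
Qed.

Lemma form_neq0 : f != 0.
Proof.
apply/eqP => f0; have := @mderiv_form k m ord0; rewrite f0 mderiv0 /grad /= expr0 mul1r.
by move/esym/eqP; rewrite expf_eq0 (negbTE (ivar_neq0 _)) andbF.
Qed.

Lemma natR_neq0 : (n%:R : R) != 0.
Proof. by rewrite -mpolyC_nat mpolyC_eq0 natf_neq0_char0. Qed.

Lemma log_mx_euler : row ord_max log_mx *m grad_col = (n%:R * f)%:M.
Proof.
apply/matrixP => i l; rewrite !ord1 [in RHS]mxE eqxx mulr1n -log_coef_euler !mxE.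
by apply: eq_bigr => i' _; rewrite !mxE.
Qed.

(** Subtracting a multiple of Euler's derivation leaves a derivation that kills
    f, whose coefficients form a syzygy of the partial derivatives. *)
Lemma log_span (a : 'rV[R]_n) h : (a *m grad_col) 0 0 = h * f -> exists c, a = c *m log_mx.
Proof.
move=> ah; pose e := (n%:R : k)^-1%:MP * h.
have [|c ec] := @syz_span (a - e *: row ord_max log_mx).
  rewrite mulmxBl -scalemxAl log_mx_euler; apply/matrixP => i l; rewrite !ord1 !mxE.
  rewrite -[X in X - _]/(\sum_j _) eqxx mulr1n.
  have := ah; rewrite mxE => ->; rewrite /e mulrACA -mpolyC_nat -mpolyCM.
  by rewrite mulVf ?natf_neq0_char0 // mpolyC1 mul1r subrr.
exists (c + e *: delta_mx 0 ord_max).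
by rewrite mulmxDl -ec -scalemxAl -rowE subrK.
Qed.

(** Evaluating at f kills all rows but Euler's, so the last coordinate is 0; the
    other rows end at distinct coordinates. *)
Lemma log_mx_free (c : 'rV[R]_n) : c *m log_mx = 0 -> c = 0.
Proof.
move=> c0.
have H (j : 'I_n) : (forall l : 'I_n, (j < l)%N -> c 0 l = 0) -> c 0 j = 0.
  move=> cj; have [jm|mj] := ltnP j m.+2.
    have := congr1 (fun A : 'rV[R]_n => A 0 (inord j.+1)) c0.
    rewrite !mxE (bigD1 j) //= mxE inordK // log_coef_diag // big1 ?addr0.
      move=> /eqP; rewrite !mulf_eq0 mpolyC_eq0 (negbTE (log_unit_neq0 _)).
      by rewrite (negbTE (ivar_neq0 _)) !orbF => /eqP.
    move=> l ne; have [lj|jl|e] := ltngtP l j; last by case/eqP: ne; apply: val_inj.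
      by rewrite mxE inordK // log_coef_above ?mulr0 //; lia.
    by rewrite cj // mul0r.
  have ej : j = ord_max by apply: val_inj => /=; have := ltn_ord j; lia.
  have : (c *m log_mx *m grad_col) 0 0 = 0 by rewrite c0 mul0mx mxE.
  rewrite -mulmxA mxE (bigD1 ord_max) //= big1 ?addr0 => [|l ne].
    have -> : (log_mx *m grad_col) ord_max 0 = n%:R * f.
      by have := congr1 (fun A : 'M[R]_1 => A 0 0) log_mx_euler; rewrite -row_mul !mxE eqxx.
    by move/eqP; rewrite !mulf_eq0 (negbTE natR_neq0) (negbTE form_neq0) !orbF -ej => /eqP.
  have lm : (l < m.+2)%N.
    by have := ltn_ord l; rewrite ltnS leq_eqVlt => /orP[/eqP e|//]; case/eqP: ne; apply: val_inj.
  have -> : (log_mx *m grad_col) l 0 = 0.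
    by have := congr1 (fun A : 'M[R]_1 => A 0 0) (log_mx_syz lm); rewrite -row_mul !mxE.
  by rewrite mulr0.
apply/rowP => j; rewrite mxE.
have [d] := ubnP (m.+2 - j)%N; elim: d j => // d IH j jd.
by apply: H => l jl; apply: IH; have := ltn_ord l; lia.
Qed.

End SaitoBasis.
(** * The resolution of the module of derivations *)

Section DerivationsOfPolynomials.
Variables (k : fieldType) (n : nat).
Local Notation R := {mpoly k[n]}.
Implicit Types a b : 'rV[R]_n.

Fact der_of_subproof a :
  ((fun p => \sum_i a 0 i * p^`M(i)) : R -> R^o) \in @der_pred n k.
Proof.
apply/asboolP; split=> [c p q|p q].
  rewrite scaler_sumr -big_split; apply: eq_bigr => i _.
  by rewrite /= mderivD mderivZ mulrDr scalerAr.
rewrite !mulr_sumr -big_split; apply: eq_bigr => i _.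
by rewrite /= mderivM; ring.
Qed.

Definition der_of a : der n k := Der (der_of_subproof a).

Lemma der_ofE (th : der n k) : th = der_of (\row_i der_val th 'X_i).
Proof.
apply/val_inj/funext => p /=.
have /asboolP[lin leib] : der_val th \in @der_pred n k by case: th.
have th0 : der_val th 0 = 0.
  by have := lin (-1) 0 0; rewrite scaler0 addr0 scaleN1r addNr.
have thZ c q : der_val th (c *: q) = c *: der_val th q.
  by have := lin c q 0; rewrite !addr0 th0 addr0.
have thD q q' : der_val th (q + q') = der_val th q + der_val th q'.
  by have := lin 1 q q'; rewrite !scale1r.
elim/mpoly_linear_ind: p => [|p q IHp IHq|c p IH|mu].
- by rewrite th0 big1 // => i _; rewrite mderiv0 mulr0.
- rewrite thD IHp IHq -big_split; apply: eq_bigr => i _.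
  by rewrite /= mderivD mulrDr.
- rewrite thZ IH scaler_sumr; apply: eq_bigr => i _.
  by rewrite mderivZ scalerAr.
elim/mnm_ind: mu => [|i mu IH].
  have := leib 1 1; rewrite mpolyX0 !mul1r => /eqP.
  rewrite addrC -subr_eq subrr => /eqP <-; rewrite big1 // => i _.
  by rewrite -mpolyC1 mderivC mulr0.
rewrite mpolyXD leib IH mulr_sumr.
under [RHS]eq_bigr => j _ do rewrite mderivM mulrDr.
rewrite big_split /= addrC; congr (_ + _); first by apply: eq_bigr => j _; rewrite mulrCA.
rewrite (bigD1 i) //= big1 ?addr0 => [|j ne].
  by rewrite mxE mderiv_var eqxx mul1r mulrC.
by rewrite mderiv_var (negbTE ne) mul0r mulr0.
Qed.

Lemma der_of_inj : injective der_of.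
Proof.
move=> a b e; apply/rowP => i.
have E c : der_val (der_of c) 'X_i = c 0 i.
  rewrite /= (bigD1 i) //= big1 ?addr0 => [|j ne].
    by rewrite mderiv_var eqxx mulr1.
  by rewrite mderiv_var (negbTE ne) mulr0.
by rewrite -(E a) e E.
Qed.

Lemma der_ofD a b : der_of (a + b) = der_of a + der_of b.
Proof.
apply/val_inj/funext => p; suff : \sum_i (a + b) 0 i * p^`M(i) =
  \sum_i a 0 i * p^`M(i) + \sum_i b 0 i * p^`M(i) by [].
by rewrite -big_split; apply: eq_bigr => i _; rewrite /= mxE mulrDl.
Qed.

Lemma der_ofZ c a : der_of (c *: a) = c *: der_of a.
Proof.
apply/val_inj/funext => p; suff : \sum_i (c *: a) 0 i * p^`M(i) =
  c * \sum_i a 0 i * p^`M(i) by [].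
by rewrite mulr_sumr; apply: eq_bigr => i _; rewrite mxE mulrA.
Qed.

End DerivationsOfPolynomials.

Section Resolution.
Variables (k : fieldType) (m : nat).
Hypothesis char0 : [pchar k] =i pred0.
Local Notation n := m.+3.
Local Notation R := {mpoly k[n]}.
Local Notation f := (form_f k n).
Local Notation B := (log_mx k m).
Local Notation E := (@der_hypersurface n k f).

Lemma der_of_form (a : 'rV[R]_n) : der_val (der_of a) f = (a *m grad_col k m) 0 0.
Proof. by rewrite /= mxE; apply: eq_bigr => i _; rewrite mxE mderiv_form. Qed.

Lemma span_formP (x : R) : ideal_span [set f] x <-> exists h, x = h * f.
Proof.
split; last first.
  by case=> h ->; apply: ideal_mull; [apply: ideal_spanP|apply: ideal_span_gen].
apply: (ideal_span_sub (I := [set x | exists h, x = h * f])) => [|_ ->].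
  split.
  - by exists 0; rewrite mul0r.
  - by move=> _ _ [h ->] [h' ->]; exists (h + h'); rewrite mulrDl.
  - by move=> a _ [h ->]; exists (a * h); rewrite mulrA.
by exists 1; rewrite mul1r.
Qed.

Fact log_of_subproof (c : 'rV[R]_n) : der_of (c *m B) \in @logder_pred n k f.
Proof.
apply/asboolP; rewrite der_of_form; apply/span_formP.
exists (c 0 ord_max * n%:R); rewrite -mulmxA mxE (bigD1 ord_max) //= big1 ?addr0.
  have -> : (B *m grad_col k m) ord_max 0 = n%:R * f.
    by have := congr1 (fun A : 'M[R]_1 => A 0 0) (log_mx_euler k m); rewrite -row_mul !mxE eqxx.
  by rewrite mulrA.
move=> l ne; have lm : (l < m.+2)%N.
  by have := ltn_ord l; rewrite ltnS leq_eqVlt => /orP[/eqP e|//]; case/eqP: ne; apply: val_inj.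
have -> : (B *m grad_col k m) l 0 = 0.
  by have := congr1 (fun A : 'M[R]_1 => A 0 0) (log_mx_syz k lm); rewrite -row_mul !mxE.
by rewrite mulr0.
Qed.

Definition log_of (c : 'rV[R]_n) : logder f := LogDer (log_of_subproof c).

Lemma log_ofD c d : log_of (c + d) = log_of c + log_of d.
Proof. by apply/val_inj; rewrite /= mulmxDl der_ofD. Qed.

Lemma log_ofZ a c : log_of (a *: c) = a *: log_of c.
Proof. by apply/val_inj; rewrite /= -scalemxAl der_ofZ. Qed.

Lemma log_of_onto (th : logder f) : exists c, th = log_of c.
Proof.
case: th => th thP; have := thP => /asboolP; rewrite {1}(der_ofE th) der_of_form => /span_formP[h].
case/(log_span char0) => c ec; exists c; apply/val_inj => /=.
by rewrite -ec -der_ofE.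
Qed.

Definition log_class (c : 'rV[R]_n) : E := qmod_pi (fder_submod f) (log_of c).

Lemma log_classE (c : 'rV[R]_n) : \sum_j c 0 j *: log_class (delta_mx 0 j) = log_class c.
Proof.
have D c' d : log_class (c' + d) = log_class c' + log_class d.
  by rewrite /log_class log_ofD; apply: qmod_piD.
have Z a c' : log_class (a *: c') = a *: log_class c'.
  by rewrite /log_class log_ofZ; apply: qmod_piZ.
have C0 : log_class 0 = 0.
  by have := Z 0 0; rewrite !scale0r.
rewrite [in RHS](row_sum_delta c) (big_morph log_class D C0).
by apply: eq_bigr => j _; rewrite Z.
Qed.

(** The derivation f d/dx_i is a combination of the basis; as the basis has
    degree 0, its coefficients may be replaced by their components of degree
    n - 1. *)
Lemma form_mx : exists D : 'M[R]_n,
  (forall i j, D i j \is (m.+2).-homog) /\ D *m B = f%:M.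
Proof.
have /choice [c cP] : forall i : 'I_n, exists c : 'rV[R]_n, f *: delta_mx 0 i = c *m B.
  move=> i; apply: (log_span char0 (h := grad k m i)).
  by rewrite -scalemxAl -rowE !mxE mulrC.
exists (\matrix_(i, j) pihomog mdeg m.+2 (c i 0 j)).
split=> [i j|]; first by rewrite mxE pihomogP.
apply/matrixP => i l; rewrite !mxE.
have := congr1 (fun A : 'rV[R]_n => pihomog mdeg m.+3 (A 0 l)) (cP i).
rewrite !mxE eqxx /= linear_sum /= => e.
transitivity (\sum_j pihomog mdeg m.+3 (c i 0 j * B j l)).
  apply: eq_bigr => j _; rewrite !mxE (pihomogM _ _ (log_coef_homog k m j l)) /=.
  by rewrite subSS subn0.
rewrite -e eq_sym; case: eqP => _; first by rewrite mulr1 pihomog_dE // form_homog.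
by rewrite mulr0 linear0.
Qed.

Lemma dhomog_irrelevant d (p : R) : p \is (d.+1).-homog -> irrelevant p.
Proof.
move=> pd; apply/irrelevantP; apply/eqP; rewrite mcoeff_eq0; apply/negP.
by move/(dhomog_mf pd); rewrite /= mdeg0.
Qed.

(** The module of derivations preserving (f) is free on n derivations of degree
    0, and f Der(R) is free on the f d/dx_i of degree n - 1. The quotient has the
    minimal resolution 0 -> R(-(n-1))^n -> R^n, with shifts minus homological degree
    equal to 0 and n - 2. *)
Lemma der_hypersurface_regularity : regularity (@der_hypersurface_gr n k f) (n%:Z - 2).
Proof.
have [D [Dh DB]] := form_mx.
have free := log_mx_free char0.
have log0 c : log_class c = 0 <-> exists b, c = b *m D.
  have -> : log_class c = 0 <-> fder (log_of c).
    have <- : qmod_pi (fder_submod f) 0 = 0.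
      by apply: (addrI (qmod_pi _ 0)); rewrite -qmod_piD !addr0.
    split.
      by move/qmod_piP; rewrite subr0 => /asboolP.
    by move=> cf; apply/qmod_piP; rewrite subr0; apply/asboolP.
  split=> [[eta]|[b ->]].
    rewrite (der_ofE eta) -der_ofZ => /der_of_inj; set b := \row_i _ => e.
    exists b; apply/eqP; rewrite -subr_eq0; apply/eqP/free.
    by rewrite mulmxBl e -mulmxA DB mul_mx_scalar subrr.
  by exists (der_of b); rewrite -der_ofZ /= -mulmxA DB mul_mx_scalar.
pose rk i : nat := if i is j.+2 then 0%N else n.
pose sh i : 'I_(rk i) -> int := fun=> if i is 0%N then 0 else Posz m.+2.
pose df i : 'M[R]_(rk i.+1, rk i) :=
  match i return 'M[R]_(rk i.+1, rk i) with 0%N => D | _ => 0 end.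
pose aug (j : 'I_(rk 0%N)) : E := log_class (delta_mx 0 j).
have h1 i : (1 < i)%N -> rk i = 0%N by case: i => [|[|i]].
have h2 j : @der_hypersurface_gr n k f (sh 0%N j) (aug j).
  exists (log_of (delta_mx 0 j)) => //.
  exists (fun i => ((delta_mx 0 j : 'rV[R]_n) *m B) 0 i); split=> // i.
  have -> : ((delta_mx 0 j : 'rV[R]_n) *m B) 0 i = log_coef k m j i by rewrite -rowE !mxE.
  exact: log_coef_homog.
have h3 i j l : homogeneous_deg (@sh i.+1 j - @sh i l) (df i j l).
  by case: i j l => [|i] j l; [rewrite /sh subr0; apply: Dh | case: j].
have h4 i j l : irrelevant (df i j l).
  by case: i j l => [|i] j l; [apply: (@dhomog_irrelevant m.+1); apply: Dh | case: j].
have h5 (e : E) : exists c : 'rV[R]_(rk 0%N), e = \sum_j c 0 j *: aug j.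
  rewrite -(qmod_reprK e); have [c ->] := log_of_onto (qmod_repr e); exists c.
  by rewrite log_classE.
have h6 (c : 'rV[R]_(rk 0%N)) : \sum_j c 0 j *: aug j = 0 <-> exists b, c = b *m df 0%N.
  by rewrite log_classE; apply: log0.
have h7 i (c : 'rV[R]_(rk i.+1)) : c *m df i = 0 <-> exists b, c = b *m df i.+1.
  case: i c => [|i] c; last first.
    by rewrite (thinmx0 c) mul0mx; split=> // _; exists 0; rewrite mul0mx.
  split=> [cD|[b ->]]; last by rewrite mulmx0 mul0mx.
  exists 0; rewrite mul0mx; apply/rowP => j; rewrite mxE.
  have : (c *m D *m B) 0 j = 0 by rewrite cD mul0mx mxE.
  rewrite -mulmxA DB mul_mx_scalar mxE => /eqP.
  by rewrite mulf_eq0 (negbTE (form_neq0 k m)) => /eqP.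
exists (MinFreeRes h1 h2 h3 h4 h5 h6 h7); split=> /=.
  by exists 1%N, ord0; rewrite /sh; lia.
by case=> [|[|i]] j; rewrite /sh; [lia | lia | case: j].
Qed.

End Resolution.
Unset Implicit Arguments.

Theorem proposition2p3 (k : fieldType) (char0 : [pchar k] =i pred0) :
  (forall n : nat, (5 <= n)%N ->
     let f := form_f k n in
     let J := jacobian_ideal f in
     [/\ (exists phi : {linear special_fiber J -> scroll_alg k n},
            monoid_morphism phi /\ bijective phi)
         /\ cohen_macaulay (special_fiber J),
         analytic_spread J 4,
         reduction_number J 1
       & regularity (@der_hypersurface_gr n k f) (n%:Z - 2)]) /\
  regularity (@der_hypersurface_gr 4 k (form_f k 4)) (4%:Z - 2).
Proof.
split; last exact: (@der_hypersurface_regularity k 1 char0).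
case=> [|[|[|m]]] // m5 f J.
have m_gt1 : (1 < m)%N by [].
have [CM dim] := special_fiber_cohen_macaulay char0 (ltnW m_gt1).
split.
- split=> //; exact: special_fiber_scroll char0 (ltnW m_gt1).
- exact: dim.
- exact: jacobian_reduction_number.
- exact: (@der_hypersurface_regularity k m char0).
Qed.
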